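(* Let $\mathbb{M}=(\Omega,(\mathcal{F}_t)_{t\ge0},(X_t)_{t\ge0},(P_x)_{x\in E_\triangle})$ be a right process with state space $E$ and life time $\zeta$ for which $\mu$ is excessive, as in the context. Let $\mathbb{M}$ be strictly irreducible and recurrent. Then the following holds: (a) Any bounded excessive function $u$ satisfies, for any $t>0$, $p_tu(x)=u(x)$ for $\mu$-a.e. $x\in E$. (b) Any excessive function is constant on $E$ $\mu$-a.e. (c) If there are two finely open sets $G,\tilde G\subset E$ with $G\cap\tilde G=\emptyset$ and $\mu(G),\mu(\tilde G)>0$, then $P_x(\zeta=\infty)=1$ for $\mu$-a.e. $x\in E$. (d) If $B$ is not $\mu$-polar and finely open in $E$, then $P_x(L_B<\infty)=0$ for $\mu$-a.e. $x\in E$.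
   Context: $E$ is a Hausdorff topological space whose Borel $\sigma$-algebra $\mathcal{B}(E)$ is generated by the continuous functions on $E$; $\mu$ is a $\sigma$-finite positive measure on $\mathcal{B}(E)$. $\mathbb{M}$ is a right process with state space $E$, cemetery $\triangle$, $E_\triangle=E\cup\{\triangle\}$, life time $\zeta$ (functions on $E$ are extended by $0$ at $\triangle$), and semigroup $p_tf(x)=E_x[f(X_t)]$, $t>0$, where $E_x$ is expectation with respect to $P_x$. It is assumed that $\mu$ is excessive relative to $(p_t)_{t>0}$: $\int_E p_t1_A\,d\mu\le\mu(A)$ for all $A\in\mathcal{B}(E)$, $t>0$. A function $u\ge0$ on $E$ is excessive if $p_tu(x)\nearrow u(x)$ as $t\searrow0$ for all $x\in E$; it is assumed that excessive functions are nearly Borel measurable with respect to $\mathbb{M}$. ''Finely open'' refers to the fine topology of $\mathbb{M}$. $\mathbb{M}$ is recurrent if for any $f\in L^1(E,\mu)$ with $f\ge0$ $\mu$-a.e. one has $E_x[\int_0^\infty f(X_t)\,dt]\in\{0,\infty\}$ for $\mu$-a.e. $x\in E$. A $\mu$-measurable set $B$ is weakly invariant relative to $\mathbb{M}$ if for any $t>0$, $E_x[1_B(X_t)]=0$ for $\mu$-a.e. $x\in E\setminus B$. $\mathbb{M}$ is strictly irreducible if every weakly invariant set $B$ satisfies $\mu(B)=0$ or $\mu(E\setminus B)=0$. For a set $B\subset E$: $\sigma_B:=\inf\{t>0:X_t\in B\}$ is the first hitting time (with $\inf\emptyset=\infty$) and $L_B:=\sup\{t\ge0:X_t\in B\}$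 the last exit time (with $\sup\emptyset=0$). A set $B\subset E$ is $\mu$-polar if there is $B_0\in\mathcal{B}(E)$, $B_0\supset B$, with $\int_E P_x(\sigma_{B_0}<\infty)\,\mu(dx)=0$.
   Formalization: In (d) the finely open set B is additionally assumed μ-measurable; without this (d) fails, e.g. for a Vitali transversal of the orbits of a process jumping at rate 1 by an irrational rotation of the circle, with μ Lebesgue measure. *)

(* Defs.v *)
From HB Require Import structures.
From mathcomp Require Import all_boot all_order all_algebra.
From mathcomp Require Import all_classical all_reals all_analysis.
From mathcomp Require Import measurable_realfun.

Set Implicit Arguments.
Unset Strict Implicit.
Unset Printing Implicit Defensive.
Import Order.TTheory GRing.Theory Num.Theory.
Import numFieldNormedType.Exports.

Local Open Scope classical_set_scope.
Local Open Scope ring_scope.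
Local Open Scope ereal_scope.

Definition borel (T : ptopologicalType) := g_sigma_algebraType (@open T).

(* The preimages of open sets under continuous real functions generate the
   Borel sigma-algebra. *)
Definition borel_generated_by_continuous (R : realType)
    (E : ptopologicalType) : Prop :=
  <<s [set f @^-1` U | f in [set f : E -> R | continuous f]
                     & U in [set U : set R | open U]] >> = <<s @open E >>.

(* E together with a cemetery point None; a set is open iff its trace on E is,
   i.e. None is isolated. *)
Definition cemetery (E : Type) := option E.

Section cemetery_topology.
Variable E : ptopologicalType.

HB.instance Definition _ := Choice.on (cemetery E).
HB.instance Definition _ := Pointed.on (cemetery E).

Definition cemetery_open (U : set (cemetery E)) := open (Some @^-1` U).

Fact cemetery_openT : cemetery_open setT.
Proof. by rewrite /cemetery_open preimage_setT; exact: openT. Qed.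

Fact cemetery_openI (A B : set (cemetery E)) :
  cemetery_open A -> cemetery_open B -> cemetery_open (A `&` B).
Proof. exact: openI. Qed.

Fact cemetery_open_bigU (I : Type) (f : I -> set (cemetery E)) :
  (forall i, cemetery_open (f i)) -> cemetery_open (\bigcup_i f i).
Proof. by move=> fo; apply: bigcup_open => i _; exact: fo. Qed.

HB.instance Definition _ := @isOpenTopological.Build (cemetery E)
  cemetery_open cemetery_openT cemetery_openI cemetery_open_bigU.
End cemetery_topology.

Definition ext0 (R : realType) (E : Type) (f : E -> \bar R)
    (x : cemetery E) : \bar R :=
  if x is Some y then f y else 0.

(* A belongs to the completion of the sigma-algebra of T with respect to m. *)
Definition completion_measurable (R : realType) d (T : measurableType d)
    (m : set T -> \bar R) (A : set T) : Prop :=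
  exists A1 A2 : set T, [/\ measurable A1, measurable A2, A1 `<=` A, A `<=` A2
    & m (A2 `\` A1) = 0].

Definition universally_measurable_fun (R : realType) d (T : measurableType d)
    (f : T -> \bar R) : Prop :=
  forall S : set (\bar R), measurable S ->
  forall nu : probability T R, completion_measurable nu (f @^-1` S).

(* The value of a path at a time in [0, +oo], with X_oo = None. *)
Definition at_time (R : realType) (E Omega : Type)
    (X : R -> Omega -> cemetery E) (s : \bar R) (w : Omega) : cemetery E :=
  if s is r%:E then X r w else None.

Definition stopping_time (R : realType) (Omega : Type)
    (F : R -> set (set Omega)) (sigma : Omega -> \bar R) : Prop :=
  (forall w, 0 <= sigma w) /\
  forall t : R, (0 <= t)%R -> F t [set w | sigma w <= t%:E].

Definition stopped_events (R : realType) d (Omega : measurableType d)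
    (F : R -> set (set Omega)) (sigma : Omega -> \bar R) : set (set Omega) :=
  [set L | measurable L /\
    forall t : R, (0 <= t)%R -> F t (L `&` [set w | sigma w <= t%:E])].

(* Right processes in the sense of Ma and Roeckner (Introduction to the Theory
   of (Non-Symmetric) Dirichlet Forms, Chapter IV).  Time is indexed by R, but
   only times t >= 0 carry meaning.  The strong Markov property is written out
   with the defining integral identity of conditional expectations, under each
   P_x; integrating in x gives it for every initial law.  Constant stopping
   times give the simple Markov property. *)
Record right_process (R : realType) (E : ptopologicalType) d
    (Omega : measurableType d) := RightProcess {
  filt : R -> set (set Omega) ;
  position : R -> Omega -> cemetery E ;
  lifetime : Omega -> \bar R ;
  law : cemetery E -> probability Omega R ;
  filt_sigma_algebra : forall t : R, (0 <= t)%R ->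
    sigma_algebra setT (filt t) ;
  filt_measurable : forall t : R, (0 <= t)%R -> filt t `<=` measurable ;
  filt_le : forall s t : R, (0 <= s)%R -> (s <= t)%R -> filt s `<=` filt t ;
  filt_right_continuous : forall t : R, (0 <= t)%R ->
    \bigcap_(s in [set s : R | (t < s)%R]) filt s `<=` filt t ;
  position_adapted : forall (t : R) (A : set (borel (cemetery E))), (0 <= t)%R ->
    measurable A -> filt t (position t @^-1` A) ;
  lifetime_ge0 : forall w, 0 <= lifetime w ;
  position_lifetime : forall (t : R) w, (0 <= t)%R ->
    (position t w = None <-> lifetime w <= t%:E) ;
  position_shift : exists theta : R -> Omega -> Omega,
    forall (s t : R) w, (0 <= s)%R -> (0 <= t)%R ->
      position s (theta t w) = position (s + t)%R w ;
  law_universally_measurable : forall L : set Omega, measurable L ->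
    universally_measurable_fun (fun x : borel (cemetery E) => law x L) ;
  law_borel_measurable : forall L : set Omega,
    <<s [set position t @^-1` A | t in [set t : R | (0 <= t)%R]
          & A in (measurable : set (set (borel (cemetery E))))] >> L ->
    measurable_fun setT (fun x : borel (cemetery E) => law x L) ;
  law_normal : forall x, law x [set w | position 0%R w = x] = 1 ;
  position_right_continuous : forall (t : R) w, (0 <= t)%R ->
    position s w @[s --> t^'+] --> position t w ;
  strong_markov : forall (x : cemetery E) (sigma : Omega -> \bar R)
      (L : set Omega) (t : R) (A : set (borel (cemetery E))),
    stopping_time filt sigma -> stopped_events filt sigma L ->
    (0 <= t)%R -> measurable A ->
    law x (L `&` [set w | A (at_time position (sigma w + t%:E) w)]) =
    \int[law x]_(w in L) law (at_time position (sigma w) w) (position t @^-1` A)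
}.

Section right_process_notions.
Context (R : realType) (E : ptopologicalType) (d : measure_display)
  (Omega : measurableType d) (M : right_process R E Omega).

(* The events below that involve hitting or exit times need not lie in the
   sigma-algebra of Omega but only in its completions.  They are measured with
   the outer measure (law M x)^*, which extends the completion of law M x; null
   events are expressed with .-negligible and {ae _, _}.  Likewise, for a
   nonnegative integrand that is measurable for the completion, the library
   integral, a supremum over measurable simple functions below the integrand,
   is the integral with respect to the completed measure. *)

Definition semigroup (t : R) (f : E -> \bar R) (x : E) : \bar R :=
  \int[law M (Some x)]_w ext0 f (position M t w).

Definition hitting (D : set (cemetery E)) (w : Omega) : \bar R :=
  ereal_inf [set t%:E | t in [set t : R | (0 < t)%R /\ D (position M t w)]].

(* Adding 0 to the set encodes sup set0 = 0. *)
Definition last_exit (D : set (cemetery E)) (w : Omega) : \bar R :=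
  ereal_sup ([set 0] `|`
    [set t%:E | t in [set t : R | (0 <= t)%R /\ D (position M t w)]]).

(* Universal measurability is what makes p_t u meaningful. *)
Definition excessive (u : E -> \bar R) : Prop :=
  [/\ universally_measurable_fun (R := R) (u : borel E -> \bar R),
      forall x, 0 <= u x,
      forall x (s t : R), (0 < s)%R -> (s <= t)%R ->
        semigroup t u x <= semigroup s u x
    & forall x, semigroup t u x @[t --> (0%R : R)^'+] --> u x].

Definition initial_law (nu : probability (borel (cemetery E)) R)
    (L : set Omega) : \bar R :=
  \int[nu]_x law M x L.

Definition nearly_borel (D : set (cemetery E)) : Prop :=
  forall nu : probability (borel (cemetery E)) R,
  exists D1 D2 : set (borel (cemetery E)),
  [/\ measurable D1, measurable D2, D1 `<=` D, D `<=` D2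
    & (initial_law nu).-negligible
        [set w | exists2 t : R, (0 <= t)%R & (D2 `\` D1) (position M t w)]].

Definition nearly_borel_fun (u : E -> \bar R) : Prop :=
  forall S : set (\bar R), measurable S -> nearly_borel (ext0 u @^-1` S).

(* Open sets of the fine topology (Blumenthal-Getoor, II.4.1): from any of its
   points the process almost surely stays in G during an initial interval, the
   complement of G being enclosed in a nearly Borel set D to that effect. *)
Definition finely_open (G : set E) : Prop :=
  forall x, G x -> exists D : set (cemetery E),
    [/\ nearly_borel D, Some @` (~` G) `<=` D
      & {ae law M (Some x), forall w, 0 < hitting D w}].

Variable mu : {measure set (borel E) -> \bar R}.

Definition excessive_measure : Prop :=
  forall (A : set (borel E)) (t : R), measurable A -> (0 < t)%R ->
    \int[mu]_x semigroup t (fun y => (\1_A y)%:E) x <= mu A.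

Definition recurrent : Prop :=
  forall f : borel E -> R, mu.-integrable setT (EFin \o f) ->
    {ae mu, forall x, (0 <= f x)%R} ->
    {ae mu, forall x : borel E,
      let U := \int[law M (Some x)]_w
        \int[lebesgue_measure]_(t in `[0%R, +oo[) ext0 (EFin \o f) (position M t w)
      in U = 0 \/ U = +oo}.

Definition weakly_invariant (B : set E) : Prop :=
  forall t : R, (0 < t)%R ->
    {ae mu, forall x : borel E,
      (~` B) x -> semigroup t (fun y => (\1_B y)%:E) x = 0}.

Definition strictly_irreducible : Prop :=
  forall B : set (borel E), completion_measurable mu B ->
    weakly_invariant B -> mu.-negligible B \/ mu.-negligible (~` B).

Definition polar (B : set E) : Prop :=
  exists B0 : set (borel E), [/\ measurable B0, B `<=` B0
    & \int[mu]_x (law M (Some x))^*%mu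
        [set w | hitting (Some @` B0) w < +oo] = 0].

End right_process_notions.

(* Main.v *)
Require Import Defs.
From HB Require Import structures.
From mathcomp Require Import all_boot all_order all_algebra.
From mathcomp Require Import all_classical all_reals all_analysis.
From mathcomp Require Import measurable_realfun.

(* Write U_A(x) for the expected occupation time of A from x.  If U_A = 0 a.e.,
   then A is weakly invariant, and since the process is alive initially, strict
   irreducibility forces mu A = 0.  If a bounded v is supermedian a.e. and
   v - p_t v > 1/k on A, telescoping along the path bounds U_A; by recurrence
   U_A = 0 a.e., so mu A = 0, and v is invariant.  Applied to 1 this shows that
   the process is conservative; applied to the truncations of an excessive u it
   shows that the level sets of u are weakly invariant, so that u is constant.
   For the last exit time of a set B with mu B > 0, the probability of a
   positive occupation time of B is a.e. a constant c; by the Markov property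
   the event that B is occupied after every time n has probability c and is
   independent of the whole path, so c = c ^ 2 and c = 1.
   A finely open subset of a Borel null set A lies in {U_A > 0}, and a path
   started where U_A = 0 never hits this set: otherwise, by Choquet
   capacitability, it would hit with positive probability a subset Z for which
   the entry time is attained at a stopping time, and there the strong Markov
   property gives U_A = 0. *)

Set Implicit Arguments.
Unset Strict Implicit.
Unset Printing Implicit Defensive.
Import Order.TTheory GRing.Theory Num.Theory.
Import numFieldNormedType.Exports.

Local Open Scope classical_set_scope.
Local Open Scope ring_scope.
Local Open Scope ereal_scope.

(** * Integration *)

(** The state space carries no metric and no compactness; its Borel sets are merely generated by
    continuous functions. Joint measurability in time therefore comes from real functions F(X_t),
    limits of step functions by right continuity. The laws are known to be Borel in x only on path
    events, so the Markov property is applied to path events alone; this is why visits are replaced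
    by positive occupation times. Excessive functions are only universally measurable, and a Borel
    minorant v inherits p_t v <= v only almost everywhere. The excessiveness of mu, which makes p_t
    1_N vanish a.e. for every null N, keeps such exceptional sets harmless along the paths. In the
    capacitability argument the compactness missing in E is supplied by the time interval [0, N] and
    by branches of a Souslin scheme that are bounded in each coordinate. The filtration is not
    assumed complete, so the first entry into a set is not at hand as a stopping time; an essential
    supremum of stopping times takes its place. *)

Section integration.
Import HBNNSimple.
Context d (T : measurableType d) (R : realType).
Implicit Types (m : {measure set T -> \bar R}) (D : set T).

(* No measurability is required: the integral of a nonnegative function is a
   supremum over the simple functions below it. *)
Lemma le_integral_nonmeas m D (f g : T -> \bar R) :
  (forall x, D x -> 0 <= f x) -> (forall x, D x -> f x <= g x) ->
  \int[m]_(x in D) f x <= \int[m]_(x in D) g x.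
Proof.
move=> f0 fg; have g0 x : D x -> 0 <= g x.
  by move=> Dx; exact: le_trans (f0 _ Dx) (fg _ Dx).
rewrite !ge0_integralE//; apply: ereal_sup_le => _ [h hf <-].
exists h => // x; rewrite (le_trans (hf x))//.
by rewrite /patch; case: ifPn => // /set_mem/fg.
Qed.

(** [f] need not be measurable: it lies below [+oo * \1_N] for a null set [N], and the integral of
    that function is +oo times 0, which is 0. *)
Lemma integral_ae0 m (f : T -> \bar R) :
  (forall x, 0 <= f x) -> {ae m, forall x, f x = 0} -> \int[m]_x f x = 0.
Proof.
move=> f0 [N [mN N0 fN]]; apply/eqP; rewrite eq_le integral_ge0 ?andbT//.
have f1 x : 0 <= (+oo * (\1_N x)%:E : \bar R) by apply: mule_ge0; rewrite ?lee_fin.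
apply: le_trans (le_integral_nonmeas (g := fun x => +oo * (\1_N x)%:E) _ _ _) _.
- by [].
- move=> x _; have [Nx|Nx] := pselect (N x).
    by rewrite indicE mem_set// mule1 leey.
  rewrite indicE memNset// mule0; suff -> : f x = 0 by [].
  by apply: contrapT => fx; apply: Nx; apply: fN.
- rewrite ge0_integralZl//; last exact/measurable_EFinP.
  by rewrite integral_indic// setIT [m N]N0 mule0.
Qed.

Lemma ge0_integral_eq0_ae m (f : T -> \bar R) :
  measurable_fun setT f -> (forall x, 0 <= f x) -> \int[m]_x f x = 0 ->
  {ae m, forall x, f x = 0}.
Proof.
move=> mf f0 If; have [+ _] := ae_eq_integral_abs m measurableT mf.
under eq_integral do rewrite gee0_abs//.
by move=> /(_ If); apply: filterS => x; apply.
Qed.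

End integration.

(** * Integration against a mixture of measures *)

Section mixture.
Context d1 d2 (Y : measurableType d1) (Z : measurableType d2) (R : realType).
Import HBNNSimple.

(** The identity for sets passes to simple functions, then to nonnegative functions by monotone
    convergence under both integrals. It turns the Markov property, stated for events, into one for
    functions. *)
Lemma integral_mixture (m0 : {measure set Y -> \bar R}) (D : set Y)
    (l : Y -> {measure set Z -> \bar R}) (m : {measure set Z -> \bar R})
    (f : Z -> \bar R) :
  measurable D ->
  (forall U, measurable U -> measurable_fun setT (fun y => l y U)) ->
  (forall U, measurable U -> m U = \int[m0]_(y in D) l y U) ->
  measurable_fun setT f -> (forall z, 0 <= f z) ->
  \int[m]_z f z = \int[m0]_(y in D) \int[l y]_z f z.
Proof.
move=> mD ml mE mf f0.
have mlf g : measurable_fun setT g -> (forall z, 0 <= g z) ->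
    measurable_fun D (fun y => \int[l y]_z g z).
  move=> mg g0; apply: measurable_funTS.
  exact: measurable_fun_integral_kernel.
pose f_ := nnsfun_approx measurableT mf.
have nn (h : {nnsfun Z >-> R}) :
    \int[m]_z (h z)%:E = \int[m0]_(y in D) \int[l y]_z (h z)%:E.
  under [LHS]eq_integral do rewrite fimfunE -fsumEFin//.
  rewrite ge0_integral_fsum//; last 2 first.
  - by move=> r; exact/measurable_EFinP/measurable_funM.
  - by move=> r z _; rewrite nnfun_muleindic_ge0.
  under [RHS]eq_integral.
    move=> y _; under eq_integral do rewrite fimfunE -fsumEFin//.
    rewrite ge0_integral_fsum//; last 2 first.
    - by move=> r; exact/measurable_EFinP/measurable_funM.
    - by move=> r z _; rewrite nnfun_muleindic_ge0.
    over.
  rewrite ge0_integral_fsum//; last 2 first.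
  - move=> r; rewrite (_ : (fun _ => _) =
        fun y => r%:E * l y (h @^-1` [set r])).
      apply: measurable_funeM; apply: measurable_funTS; exact: ml.
    apply/funext => y.
    by rewrite integralZl_indic_nnsfun// integral_indic// setIT.
  - move=> r y _; apply: integral_ge0 => z _; exact: nnfun_muleindic_ge0.
  apply: eq_fsbigr => r /set_mem [z _ zr].
  rewrite integralZl_indic_nnsfun// integral_indic// setIT mE//.
  under [RHS]eq_integral.
    move=> y _; rewrite integralZl_indic_nnsfun// integral_indic// setIT; over.
  rewrite ge0_integralZl//; last by rewrite -zr lee_fin.
  by apply: measurable_funTS; exact: ml.
have cvgf z : (f_ n z)%:E @[n --> \oo] --> f z by exact: cvg_nnsfun_approx.
have mf_ n : measurable_fun setT (fun z => (f_ n z)%:E) by exact/measurable_EFinP.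
have ndf z : {homo (fun n => (f_ n z)%:E) : a b / (a <= b)%N >-> a <= b}.
  by move=> a b ab; rewrite lee_fin; exact/lefP/nd_nnsfun_approx.
have limf (n : {measure set Z -> \bar R}) :
    \int[n]_z f z = limn (fun k => \int[n]_z (f_ k z)%:E).
  rewrite -monotone_convergence//.
  - by apply: eq_integral => z _; apply/esym/cvg_lim.
  - by move=> k z _; rewrite lee_fin.
rewrite limf; under eq_integral do rewrite limf.
rewrite monotone_convergence//.
- by congr (limn _); apply/funext => k; exact: nn.
- by move=> k; apply: mlf => // z; rewrite lee_fin.
- by move=> k y _; apply: integral_ge0 => z _; rewrite lee_fin.
- move=> y _ a b ab; apply: ge0_le_integral => //.
  + by move=> z _; rewrite lee_fin.
  + by move=> z _; exact: ndf.
Qed.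

End mixture.

(** * Lebesgue integrals over time: Tonelli and translation *)

Section time_integral.
Context (R : realType).
Notation TR := (measurableTypeR R).
Notation leb := (@lebesgue_measure R).

Lemma tonelli_in d (T : measurableType d)
    (m : {sigma_finite_measure set T -> \bar R}) (D : set TR) (f : TR -> T -> \bar R) :
  measurable D -> measurable_fun setT (fun p : TR * T => f p.1 p.2) ->
  (forall t w, 0 <= f t w) ->
  \int[m]_w \int[leb]_(t in D) f t w = \int[leb]_(t in D) \int[m]_w f t w.
Proof.
move=> mD mf f0; pose g (p : TR * T) := f p.1 p.2 * (\1_D p.1)%:E.
have g0 p : 0 <= g p by apply: mule_ge0 => //; rewrite lee_fin.
have mg : measurable_fun setT g.
  apply: emeasurable_funM => //; apply/measurable_EFinP.
  by apply: measurableT_comp => //; exact: measurable_indic.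
have E w t : ((fun t => f t w) \_ D) t = g (t, w).
  rewrite /g /patch indicE /=; case: ifPn => tD; last by rewrite mule0.
  by rewrite mule1.
have -> : \int[m]_w \int[leb]_(t in D) f t w = \int[m]_w \int[leb]_t g (t, w).
  apply: eq_integral => w _; rewrite integral_mkcond.
  by apply: eq_integral => t _; rewrite E.
rewrite -(fubini_tonelli (m1 := leb) (m2 := m) g)//.
rewrite [RHS]integral_mkcond; apply: eq_integral => t _.
rewrite /patch /g; case: ifPn => tD /=.
  by apply: eq_integral => w _; rewrite indicE tD mule1.
by rewrite integral0_eq// => w _; rewrite indicE (negbTE tD) mule0.
Qed.

Lemma lebesgue_measure_shift (a : R) (A : set TR) : measurable A ->
  leb ((fun t : TR => (a + t)%R : TR) @^-1` A) = leb A.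
Proof.
move=> mA; have ms : measurable_fun setT (fun t : TR => (a + t)%R : TR).
  by apply: measurable_funD => //; exact: measurable_id.
pose phi : {mfun TR >-> TR} := HB.pack (fun t : TR => (a + t)%R : TR)
  (isMeasurableFun.Build _ _ _ _ _ ms).
apply/esym; rewrite -[RHS]/(pushforward leb phi A).
apply: lebesgue_measure_unique => //= _ [[u v]] _ <-.
rewrite /pushforward/= (_ : _ @^-1` _ = `](u - a)%R, (v - a)%R]%classic).
  by rewrite !lebesgue_measure_itv/= !lte_fin ltrD2r -!EFinD opprD addrACA subrr addr0.
by apply/seteqP; split => t /=; rewrite !in_itv/= ltrBlDl lerBrDl.
Qed.

Lemma integral_shift (a : R) (f : TR -> \bar R) :
  measurable_fun setT f -> (forall t, 0 <= f t) ->
  \int[leb]_t f (a + t)%R = \int[leb]_t f t.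
Proof.
move=> mf f0; have ms : measurable_fun setT (fun t : TR => (a + t)%R : TR).
  by apply: measurable_funD => //; exact: measurable_id.
have := @ge0_integral_pushforward _ _ TR TR R _ ms leb setT f measurableT mf.
rewrite preimage_setT => <-//.
by apply: eq_measure_integral => A mA _; rewrite -[RHS](lebesgue_measure_shift a mA).
Qed.

End time_integral.

(** * Souslin schemes and capacitability *)

Definition agree (m : nat) (z z' : nat -> nat) :=
  forall i, (i < m)%N -> z' i = z i.

Definition locally_constant (T : Type) (G : (nat -> nat) -> T) :=
  forall z, exists m, forall z', agree m z z' -> G z' = G z.

(** The Souslin operation over the Baire space. [G k z] may depend on any finite number of
    coordinates of [z], where the classical indexing by finite sequences allows only the first k;
    schemes can then be merged by reindexing the branch. *)
Definition souslin (Y : Type) (B : set (set Y)) : set (set Y) :=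
  [set H | exists G : nat -> (nat -> nat) -> set Y,
    [/\ forall k z, B (G k z), forall k, locally_constant (G k)
      & H = [set y | exists z, forall k, G k z y]]].

Section souslin.
Context (Y : Type) (B : set (set Y)).

Definition unpair (k : nat) : nat * nat := odflt (0%N, 0%N) (unpickle k).

Lemma unpairK p : unpair (pickle p) = p.
Proof. by rewrite /unpair pickleK. Qed.

Lemma souslin_base : B `<=` souslin B.
Proof.
move=> A BA; exists (fun _ _ => A); split => //; first by exists 0%N.
by apply/seteqP; split => [y Ay|y [_ /(_ 0%N)]//]; exists (fun=> 0%N).
Qed.

Lemma souslin_bigcup (F : (set Y)^nat) :
  (forall i, souslin B (F i)) -> souslin B (\bigcup_i F i).
Proof.
move=> /choice[G GF].
exists (fun k z => G (z 0%N) k (fun i => z i.+1)); split.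
- by move=> k z; case: (GF (z 0%N)).
- move=> k z; have [_ /(_ k (fun i => z i.+1))[m hm] _] := GF (z 0%N).
  exists m.+1 => z' zz'; rewrite (zz' 0%N)//; apply: hm => i im; exact: zz'.
- apply/seteqP; split => y.
    move=> [i _]; have [_ _ ->] := GF i; move=> [z zG].
    by exists (fun j => if j is j'.+1 then z j' else i).
  by move=> [z zG]; exists (z 0%N) => //; have [_ _ ->] := GF (z 0%N); exists (fun i => z i.+1).
Qed.

(** A single branch [z] carries one branch for every [i], in its coordinates [pickle (i, j)]. How
    far the merged scheme looks into [z] depends on this coding, which local constancy tolerates. *)
Lemma souslin_bigcap (F : (set Y)^nat) :
  (forall i, souslin B (F i)) -> souslin B (\bigcap_i F i).
Proof.
move=> /choice[G GF].
exists (fun k z => G (unpair k).1 (unpair k).2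
                     (fun j => z (pickle ((unpair k).1, j)))); split.
- by move=> k z; case: (GF (unpair k).1).
- move=> k z; set i := (unpair k).1.
  have [_ /(_ (unpair k).2 (fun j => z (pickle (i, j))))[m hm] _] := GF i.
  exists (\max_(j < m) (pickle (i, nat_of_ord j)).+1)%N => z' zz'.
  apply: hm => j jm; apply: zz'.
  exact: (leq_bigmax (Ordinal jm)).
- apply/seteqP; split => y.
    move=> yF; have /choice[z zG] i : exists z, forall k, G i k z y.
      by have := yF i Logic.I; have [_ _ ->] := GF i.
    exists (fun k => z (unpair k).1 (unpair k).2) => k.
    rewrite (_ : (fun j => _) = z (unpair k).1)//.
    by apply/funext => j; rewrite unpairK.
  move=> [z zG] i _; have [_ _ ->] := GF i.
  exists (fun j => z (pickle (i, j))) => k.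
  by have := zG (pickle (i, k)); rewrite unpairK.
Qed.

(** Souslin sets need not be stable under complements, so each set is carried together with its
    complement: the sets for which both are Souslin form a sigma-algebra. *)
Lemma sigma_algebra_souslin :
  B setT -> (forall A, B A -> souslin B (~` A)) -> <<s B >> `<=` souslin B.
Proof.
move=> BT BC; suff H : <<s B >> `<=` [set A | souslin B A /\ souslin B (~` A)].
  by move=> A /H[].
apply: smallest_sub => [|A BA]; last by split; [exact: souslin_base|exact: BC].
split.
- by split; rewrite ?setC0; [rewrite -setCT; exact: BC|exact: souslin_base].
- by move=> A [A1 A2]; rewrite setTD; split; rewrite ?setCK.
- move=> F SF; split; first by apply: souslin_bigcup => i; case: (SF i).
  by rewrite setC_bigcup; apply: souslin_bigcap => i; case: (SF i).
Qed.

End souslin.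

(** At a finite stage [m] a condition [G k s] is tested only if the first [m] coordinates of [s]
    settle it. *)
Definition determined (T : Type) (m : nat) (G : (nat -> nat) -> T) z :=
  forall z', agree m z z' -> G z' = G z.

(** * Compactness along an ultrafilter *)

Section compactness.
Local Open Scope ring_scope.
Context (R : realType).

Lemma ultra_pigeonhole (U : set_system nat) (s : nat -> nat) (n : nat) :
  UltraFilter U -> U [set m | (s m <= n)%N] ->
  exists2 a, (a <= n)%N & U [set m | s m = a].
Proof.
move=> UU; elim: n => [|n IH] Un.
  by exists 0%N => //; apply: filterS Un => m /=; rewrite leqn0 => /eqP.
have [Us|Us] := in_ultra_setVsetC [set m | s m = n.+1] UU; first by exists n.+1.
have /IH[a an Ua] : U [set m | (s m <= n)%N].
  apply: filterS2 Un Us => m /= sn /eqP; rewrite neq_ltn.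
  by move=> /orP[//|]; rewrite ltnNge sn.
by exists a => //; exact: leq_trans an _.
Qed.

Lemma ultra_infty : exists2 U : set_system nat, UltraFilter U & \oo `<=` U.
Proof.
by have [U [UU sU]] := @ultraFilterLemma nat \oo _; exists U.
Qed.

(* A diagonal form of Koenig's lemma: the branch z and the point t are limits
   along an ultrafilter of the finite stages. *)
Lemma konig_closed (T : Type) (N : R) (n : nat -> nat)
    (G : nat -> (nat -> nat) -> T) (D : T -> set R) :
  (forall k z, closed (D (G k z))) -> (forall k, locally_constant (G k)) ->
  (forall m, exists t s, [/\ t \in `[0, N], forall i, (i < m)%N -> (s i <= n i)%N
     & forall k, (k < m)%N -> determined m (G k) s -> D (G k s) t]) ->
  exists t z, [/\ t \in `[0, N], forall i, (z i <= n i)%N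
    & forall k, D (G k z) t].
Proof.
move=> clD lcG /choice[t /choice[s ts]].
have [U UU ooU] := ultra_infty.
have Uge m : U [set j | (m <= j)%N] by apply: ooU; exists m.
have Uz i : exists2 a, (a <= n i)%N & U [set m | s m i = a].
  apply: ultra_pigeonhole; apply: filterS (Uge i.+1) => m /= im.
  by have [_ /(_ i im)] := ts m.
have /choice[z zU] : forall i, exists a, (a <= n i)%N /\ U [set m | s m i = a].
  by move=> i; have [a an Ua] := Uz i; exists a.
have Uagree m : U [set j | agree m z (s j)].
  elim: m => [|m IH]; first by apply: filterS (Uge 0%N).
  have [_ Um] := zU m; apply: filterS2 IH Um => j /= jm sjm i.
  by rewrite ltnS leq_eqVlt => /orP[/eqP ->//|/jm].
have tU : U (t @^-1` [set` `[0, N]]).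
  by apply: filterS (Uge 0%N) => m _ /=; have [] := ts m.
have [//|l [l0N tl]] := @segment_compact R 0 N (t @ U) _.
exists l, z; split => //; first by move=> i; case: (zU i).
move=> k; have [m hm] := lcG k z.
(* For almost every j along [U], [s j] agrees with [z] so far that [G k (s j)] equals [G k z] and is
   settled at stage j. So [t j] lies in the closed set [D (G k z)], and the limit [l] does too. *)
rewrite ((closure_id _).1 (clD k z)) => V lV; apply: tl lV => /=.
near=> j.
have jm : agree m z (s j) by near: j; exact: Uagree.
have mj : (maxn m k.+1 <= j)%N by near: j; exact: Uge.
move: mj; rewrite geq_max => /andP[mj kj].
have [_ _ /(_ k kj)] := ts j; rewrite /= (hm _ jm); apply.
move=> z' z'j; rewrite (hm _ jm); apply: hm => i im.
by rewrite z'j ?(leq_trans im)// jm.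
Unshelve. all: by end_near. Qed.

End compactness.

(** * Projection of Souslin sets of closed rectangles *)

Section projection.
Context (R : realType) d (T : measurableType d) (P : probability T R).
Notation TR := (measurableTypeR R).

(** The outer measure of [S] exceeds [a]; projections need not be measurable here. *)
Definition big (a : \bar R) (S : set T) :=
  forall A, measurable A -> S `<=` A -> a < P A.

Lemma big_subset a S S' : S `<=` S' -> big a S -> big a S'.
Proof. by move=> SS' bS A mA SA; apply: bS => //; exact: subset_trans SA. Qed.

Lemma not_bigP a S : ~ big a S -> exists A, [/\ measurable A, S `<=` A & P A <= a].
Proof.
move=> /existsNP[A /not_implyP[mA /not_implyP[SA /negP PA]]].
by exists A; split => //; rewrite leNgt.
Qed.

Lemma not_negligible_big S : ~ P.-negligible S ->
  exists2 a : R, (0 < a)%R & big a%:E S.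
Proof.
apply: contra_notP => nS.
have /choice[A PA] k : exists A, [/\ measurable A, S `<=` A & P A <= (k.+1%:R^-1)%:E].
  apply: not_bigP => bS; apply: nS; exists k.+1%:R^-1%R => //.
exists (\bigcap_k A k); split.
- by apply: bigcapT_measurable => k; case: (PA k).
- apply/eqP; rewrite eq_le measure_ge0 andbT.
  apply/lee_addgt0Pr => e e0; rewrite add0e.
  have [k ke] : exists k, (k.+1%:R^-1 < e)%R.
    near \oo => k; exists k; near: k; exact: near_infty_natSinv_lt (PosNum e0).
  have [mA _ PAk] := PA k.
  apply: le_trans (_ : _ <= (k.+1%:R^-1)%:E) _; last by rewrite lee_fin ltW.
  apply: le_trans PAk; apply: le_measure; rewrite ?inE//.
    by apply: bigcapT_measurable => j; case: (PA j).
  exact: bigcap_inf.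
- by move=> x Sx k _; case: (PA k) => _ /(_ x Sx).
Unshelve. all: by end_near. Qed.

(** Outer measure is continuous along increasing sequences: the hulls [A m] need not increase, but
    the intersections [A' m] of their tails do, and they still contain [S m]. *)
Lemma big_bigcup a (S : (set T)^nat) :
  {homo S : m n / (m <= n)%N >-> m `<=` n} ->
  big a (\bigcup_m S m) -> exists m, big a (S m).
Proof.
move=> ndS bS; apply: contrapT => /forallNP nb.
have /choice[A PA] m := not_bigP (nb m).
pose A' m := \bigcap_(j in [set j | (m <= j)%N]) A j.
have mA' m : measurable (A' m).
  by apply: bigcap_measurable => [|j _]; [exists m => /=|case: (PA j)].
have : (P \o A') m @[m --> \oo] --> P (\bigcup_m A' m).
  apply: nondecreasing_cvg_mu => //; first exact: bigcupT_measurable.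
  move=> m n mn; apply/subsetPset => x A'x j /= nj; apply: A'x.
  exact: leq_trans nj.
move=> cA'; have : P (\bigcup_m A' m) <= a.
  apply: (cvge_to_le cA').
  near=> m => /=; have [mA _ Pa] := PA m.
  apply: le_trans Pa; apply: le_measure; rewrite ?inE//.
  by move=> x; apply; exact: leqnn.
apply/negP; rewrite -ltNge; apply: bS; first exact: bigcupT_measurable.
move=> x [m _ Sx]; exists m => // j /= mj.
by have [_ + _] := PA j; apply; exact: ndS Sx.
Unshelve. all: by end_near. Qed.

Definition closed_rectangle : set (set (TR * T)) :=
  [set A `*` F | A in @closed R & F in measurable].

Let hit (N : R) (H : set (TR * T)) : set T :=
  [set w | exists2 t : R, t \in `[0%R, N] & H (t, w)].

(** A measurable relaxation of the projection: the bounds and the tests concern the first [m]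
    coordinates only. [konig_closed] recovers genuine branches from the intersection of all
    stages. *)
Let stage (N : R) (G : nat -> (nat -> nat) -> set (TR * T)) (n : nat -> nat) m :=
  [set w | exists t s, [/\ t \in `[0%R, N], forall i, (i < m)%N -> (s i <= n i)%N
     & forall k, (k < m)%N -> determined m (G k) s -> G k s (t, w)]].

(** Only finite prefixes of [s] matter, so the stage is a countable union. For a fixed prefix,
    rectangles separate time from chance: either no time meets all the closed factors and the set is
    empty, or one such time serves every [w] and the set is an intersection of the measurable
    factors. *)
Lemma measurable_stage N G n m : (forall k z, closed_rectangle (G k z)) ->
  measurable (stage N G n m).
Proof.
move=> rG.
have /choice[A /choice[F AF]] : forall kz : nat * (nat -> nat), exists A F,
    [/\ closed A, measurable F & G kz.1 kz.2 = A `*` F].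
  by move=> [k z]; have [A cA [F mF <-]] := rG k z; exists A, F.
pose dt k s := (k < m)%N /\ determined m (G k) s.
pose L (s : nat -> nat) := [set w | exists2 t : R, t \in `[0%R, N] &
  forall k, dt k s -> G k s (t, w)].
have mL s : measurable (L s).
  have [[t tN tA]|nt] := pselect (exists2 t : R, t \in `[0%R, N] &
      forall k, dt k s -> A (k, s) t).
    rewrite (_ : L s = \bigcap_k (if pselect (dt k s) then F (k, s) else setT)).
      apply: bigcapT_measurable => k; case: pselect => /= [_|//].
      by have [] := AF (k, s).
    apply/seteqP; split => w /=.
      move=> [t' t'N Gt'] k _; case: pselect => //= ks.
      by have := Gt' k ks; have [_ _ ->] := AF (k, s) => -[].
    move=> wF; exists t => // k ks; have [_ _ ->] := AF (k, s); split => /=.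
      exact: tA.
    by have := wF k Logic.I; case: pselect.
  rewrite (_ : L s = set0)//; apply/seteqP; split => // w [t tN tG].
  apply: nt; exists t => // k ks.
  by have := tG k ks; have [_ _ ->] := AF (k, s) => -[].
have [dec decK] : exists dec : nat -> seq nat, forall s, dec (pickle s) = s.
  by exists (fun j => odflt [::] (unpickle j)) => s; rewrite pickleK.
pose bd (s : seq nat) := forall i, (i < m)%N -> (nth 0%N s i <= n i)%N.
rewrite (_ : stage _ _ _ _ = \bigcup_(j in [set j | bd (dec j)])
    L (nth 0%N (dec j))); first by apply: bigcup_measurable => j _; exact: mL.
apply/seteqP; split => w; last first.
  by move=> [j sn [t tN tL]]; exists t, (nth 0%N (dec j)); split => // k km dk; apply: tL.
move=> [t [s [tN sn sG]]]; have ag i : (i < m)%N -> nth 0%N (mkseq s m) i = s i.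
  by move=> im; rewrite nth_mkseq.
exists (pickle (mkseq s m)); rewrite ?decK /=.
  by move=> i im; rewrite decK ag ?sn.
exists t => // k [km dk]; rewrite -(dk s); last by move=> i im; rewrite ag.
apply: sG => // z' z's; rewrite [RHS]dk; last by move=> i im; rewrite ag.
by apply: dk => i im; rewrite z's// ag.
Qed.

(* Choquet's capacitability argument: the bounds n are chosen one coordinate
   at a time so as to keep the outer measure of the projection above a. *)
Lemma capacity (N : R) (G : nat -> (nat -> nat) -> set (TR * T)) :
  (forall k z, closed_rectangle (G k z)) ->
  (forall k, locally_constant (G k)) ->
  ~ P.-negligible (hit N [set y | exists z, forall k, G k z y]) ->
  exists n : nat -> nat, ~ P.-negligible (hit N
    [set y | exists z, (forall i, (z i <= n i)%N) /\ forall k, G k z y]).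
Proof.
move=> rG lcG /not_negligible_big[a a0 ba].
pose Q (l : seq nat) := hit N [set y | exists z,
  (forall i, (i < size l)%N -> (z i <= nth 0%N l i)%N) /\ forall k, G k z y].
have /choice[f fP] l : exists b, big a%:E (Q l) -> big a%:E (Q (rcons l b)).
  have [bQ|nQ] := pselect (big a%:E (Q l)); last by exists 0%N.
  suff [b Qb] : exists b, big a%:E (Q (rcons l b)) by exists b.
  apply: big_bigcup.
    move=> b c bc w [t tN [z [zb zG]]]; exists t => //; exists z; split => // i.
    rewrite size_rcons ltnS => il; have := zb i.
    rewrite size_rcons ltnS => /(_ il); rewrite !nth_rcons.
    case: ifP => // _; case: ifP => // _ /leq_trans; exact.
  apply: big_subset bQ => w [t tN [z [zb zG]]].
  exists (z (size l)) => //; exists t => //; exists z; split => // i.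
  rewrite size_rcons ltnS nth_rcons => il.
  by case: ltnP => [/zb//|li]; rewrite eqn_leq il li/= (@anti_leq i (size l))// il li.
pose l := fix l m := if m is m'.+1 then rcons (l m') (f (l m')) else [::].
pose n m := f (l m).
have lE m : l m = mkseq n m.
  by elim: m => //= m IH; rewrite mkseqS -IH.
have bl m : big a%:E (Q (mkseq n m)).
  elim: m => [|m]; last by rewrite -!lE; exact: fP.
  by apply: big_subset ba => w [t tN [z zG]]; exists t => //; exists z.
exists n.
have bL m : a%:E <= P (stage N G n m).
  apply: ltW; apply: (bl m); first exact: measurable_stage.
  move=> w [t tN [z [zn zG]]]; exists t, z; split => // i im.
  by have := zn i; rewrite size_mkseq nth_mkseq//; apply.
have mL m : measurable (stage N G n m) by exact: measurable_stage.
have cL : (P \o stage N G n) m @[m --> \oo] --> P (\bigcap_m stage N G n m).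
  apply: nonincreasing_cvg_mu => //.
  - by rewrite (le_lt_trans (probability_le1 _ _))// ltry.
  - exact: bigcapT_measurable.
  - move=> m m' mm'; apply/subsetPset => w [t [s [tN sn sG]]].
    exists t, s; split => //.
      by move=> i im; apply: sn; exact: leq_trans mm'.
    move=> k km dk; apply: sG; first exact: leq_trans mm'.
    by move=> z' z's; apply: dk => i im; apply: z's; exact: leq_trans mm'.
have aP : a%:E <= P (\bigcap_m stage N G n m).
  by apply: (cvge_to_ge cL); apply: nearW => m; exact: bL.
(* By [konig_closed], a point of every stage has a branch bounded by [n] in the scheme. The
   intersection of the stages, of measure at least [a], thus lies in the projection. *)
move=> neg; have : P.-negligible (\bigcap_m stage N G n m).
  apply: negligibleS neg => w Lw.
  have [] := @konig_closed R _ N n G (fun H => [set t | H (t, w)]) _ lcG.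
  - move=> k z; have [A cA [F mF <-]] := rG k z.
    have [Fw|Fw] := pselect (F w).
      suff -> : [set t : R | (A `*` F) (t, w)] = A by [].
      by apply/seteqP; split => t /=; [case|split].
    suff -> : [set t : R | (A `*` F) (t, w)] = set0 by exact: closed0.
    by apply/seteqP; split => t // [].
  - by move=> m; exact: Lw.
  - by move=> t [z [tN zn zG]]; exists t => //; exists z.
move=> /negligibleP => /(_ (bigcapT_measurable mL)) P0.
by move: aP; rewrite P0 lee_fin leNgt a0.
Qed.

Lemma open_Fsigma_real (U : set R) : open U ->
  exists2 F : (set R)^nat, (forall i, closed (F i)) & U = \bigcup_i F i.
Proof.
move=> oU.
exists (fun n => ~` \bigcup_(y in ~` U) ball y (n.+1%:R^-1 : R)%R).
  move=> n; rewrite closedC; apply: bigcup_open => y _; exact: ball_open.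
apply/seteqP; split => [x Ux|x [n _ nx]]; last first.
  by apply: contrapT => Ux; apply: nx; exists x => //; apply: ballxx; rewrite invr_gt0.
have /nbhs_ballP[e /= e0 eU] : nbhs x U by exact: open_nbhs_nbhs.
near \oo => n; exists n => // -[y nUy /ball_sym yx]; apply: nUy; apply: eU.
apply: le_ball yx; apply: ltW; near: n; exact: near_infty_natSinv_lt (PosNum e0).
Unshelve. all: by end_near. Qed.

Lemma setC_closed_rectangle A : closed_rectangle A ->
  souslin closed_rectangle (~` A).
Proof.
move=> [C cC [F mF <-]]; have [D cD DE] := open_Fsigma_real (closed_openC cC).
rewrite (_ : ~` (C `*` F) = \bigcup_i
    (if i is j.+1 then D j `*` setT else setT `*` ~` F)).
  apply: souslin_bigcup => -[|j]; apply: souslin_base.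
    by exists setT; [exact: closedT|exists (~` F) => //; exact: measurableC].
  by exists (D j) => //; exists setT.
apply/seteqP; split => -[t w].
  move=> /not_andP[/= nC|nF]; last by exists 0%N.
  by have : (~` C) t by []; rewrite DE => -[j _ Dj]; exists j.+1.
move=> [[|j] _ /= [tD wF] [Ct Fw]]; first exact: wF.
by have : (~` C) t by rewrite DE; exists j.
Qed.

(** The rays [[x, +oo[] generate the Borel sets of the line, so closed rectangles generate the
    product sigma-algebra. *)
Lemma measurable_souslin (H : set (TR * T)) : measurable H ->
  souslin closed_rectangle H.
Proof.
move=> mH; apply: sigma_algebra_souslin.
- by exists setT; [exact: closedT|exists setT => //; rewrite setXTT].
- exact: setC_closed_rectangle.
have cT (A : set R) : closed A -> <<s closed_rectangle >> (A `*` setT).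
  by move=> cA; apply: sub_sigma_algebra; exists A => //; exists setT.
have sT (A : set TR) : measurable A -> <<s closed_rectangle >> (A `*` setT).
  rewrite [X in X A -> _]RGenCInfty.measurableE; move: A.
  apply: smallest_sub; last first.
    by move=> _ [x ->]; apply: cT; exact: interval_closed.
  have /= sa := smallest_sigma_algebra setT closed_rectangle.
  split.
  - by rewrite set0X; exact: sigma_algebra0.
  - move=> A sA; rewrite setTD (_ : _ `*` _ = ~` (A `*` setT)).
      by rewrite -setTD; exact: sigma_algebraCD.
    by apply/seteqP; split => -[t w] /=; [move=> [+ _ []]|move/not_andP => [|]].
  - move=> F sF; rewrite setX_bigcupl.
    exact: sigma_algebra_bigcup.
move: H mH; rewrite measurable_prod_measurableType; apply: smallest_sub.
  exact: smallest_sigma_algebra.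
move=> _ [A mA [F mF <-]].
rewrite (_ : A `*` F = (A `*` setT) `&` (setT `*` F)); last first.
  by apply/seteqP; split => -[t w] /=; [case|move=> [[? _] [_ ?]]].
apply: (@measurableI _ (g_sigma_algebraType closed_rectangle)); first exact: sT.
by apply: sub_sigma_algebra; exists setT; [exact: closedT|exists F].
Qed.

End projection.

(** * Borel sets as Souslin sets over zero sets *)

Section zero_sets.
Context (R : realType) (E : ptopologicalType).
Local Open Scope ring_scope.

(** Zero sets stand in for closed sets: their complements are countable unions of zero sets, whereas
    an open set of [E] need not be a countable union of closed sets. *)
Definition zero_set : set (set E) :=
  [set Z | exists2 g : E -> R, continuous g & Z = [set x | g x = 0]].

Lemma zero_set_le (f : E -> R) (a : R) : continuous f ->
  zero_set [set x | f x <= a].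
Proof.
move=> cf; exists (fun x => Num.max (f x - a) 0).
  move=> x; apply: (@continuous_max _ E (fun x => f x - a) (cst 0) x).
    by apply: continuousB; [exact: cf|exact: cst_continuous].
  exact: cst_continuous.
apply/seteqP; split => x /=.
  by rewrite -subr_le0 => /max_idPr.
by move/max_idPr; rewrite subr_le0.
Qed.

Lemma setC_zero_set Z : zero_set Z -> souslin zero_set (~` Z).
Proof.
move=> [g cg ->].
have cN : continuous (fun x => - `|g x|).
  by move=> x; apply: cvgN; apply: cvg_norm; exact: cg.
rewrite (_ : ~` _ = \bigcup_n [set x | - `|g x| <= - n.+1%:R^-1]).
  by apply: souslin_bigcup => n; apply: souslin_base; exact: zero_set_le.
apply/seteqP; split => x /=.
  move=> /eqP; rewrite -normr_gt0 => g0; near \oo => n; exists n => //=.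
  by rewrite lerN2 ltW//; near: n; exact: near_infty_natSinv_lt (PosNum g0).
move=> [n _ /=]; rewrite lerN2 => ng g0; move: ng.
by rewrite g0 normr0 leNgt invr_gt0 ltr0n.
Unshelve. all: by end_near. Qed.

Lemma borel_souslin_zero_set : borel_generated_by_continuous R E ->
  forall A : set (borel E), measurable A -> souslin zero_set A.
Proof.
move=> bE A mA; apply: sigma_algebra_souslin.
- exists (cst 0); first by move=> x; exact: cst_continuous.
  by apply/seteqP; split.
- exact: setC_zero_set.
have : <<s @open E >> A by exact: mA.
rewrite -bE; apply: smallest_sub; first exact: smallest_sigma_algebra.
move=> _ [f /= cf [U /= oU <-]].
have mf : @measurable_fun _ _ (g_sigma_algebraType zero_set) R setT f.
  apply: (measurability _ (RGenOInfty.measurableE R)) => _ [_ [a ->] <-].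
  rewrite setTI (_ : _ @^-1` _ = ~` [set x | f x <= a]).
    by apply: measurableC; apply: sub_sigma_algebra; exact: zero_set_le.
  apply/seteqP; split => x /=; rewrite in_itv/= andbT; first by rewrite ltNge => /negP.
  by move=> /negP; rewrite -ltNge.
rewrite -[X in _ X]setTI; exact: mf (open_measurable oU).
Qed.

(** [U m] relaxes the first [m] conditions g = 0 to |g| < 1/(m+1). As bounded prefixes of length [m]
    are finite in number, its closure stays inside the finite union of the closed sets where |g| <=
    1/(m+1). A point of all these closures satisfies every stage approximately, and compactness of
    the bounded branches yields an exact branch. The form of the conclusion is what allows a path to
    be caught in [Z] through entries into open sets. *)
Lemma zero_set_hull (G : nat -> (nat -> nat) -> set E) (n : nat -> nat) :
  (forall k z, zero_set (G k z)) -> (forall k, locally_constant (G k)) ->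
  let Z := [set x | exists z, (forall i, (z i <= n i)%N) /\ forall k, G k z x] in
  exists U : (set E)^nat, [/\ forall m, open (U m), forall m, Z `<=` U m
    & \bigcap_m closure (U m) `<=` Z].
Proof.
move=> zG lcG Z.
(* The function is attached to the set [G k z] and not to the index, so that equal sets get equal
   functions and local constancy is inherited. *)
have [g gP] : exists g : set E -> E -> R, forall k z,
    continuous (g (G k z)) /\ G k z = [set x | g (G k z) x = 0].
  have /choice[g gP] (A : set E) : exists g : E -> R, zero_set A ->
      continuous g /\ A = [set x | g x = 0].
    have [[g cg gA]|nz] := pselect (zero_set A); first by exists g.
    by exists (cst 0).
  by exists g => k z; exact: gP.
have GE k z x : G k z x <-> g (G k z) x = 0.
  by rewrite {1}(gP k z).2.
pose bd m (s : nat -> nat) := forall i, (i < m)%N -> (s i <= n i)%N.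
pose V (c : R -> R -> bool) m (s : nat -> nat) := [set x |
  forall k, (k < m)%N /\ determined m (G k) s ->
    c `|g (G k s) x| (m.+1%:R^-1)].
have cnorm k s : continuous (fun x => `|g (G k s) x|).
  by move=> x; apply: cvg_norm; exact: (gP k s).1.
have fin_bigcap m s c : V c m s = \bigcap_(k in [set k | (k < m)%N /\ determined m (G k) s])
    [set x | c `|g (G k s) x| (m.+1%:R^-1)] by [].
have oV m s : open (V <%R m s).
  rewrite fin_bigcap -closedC setC_bigcap; apply: closed_bigcup.
    by apply: sub_finite_set (finite_II m) => k [].
  move=> k _; apply: open_closedC; rewrite (_ : [set x | _] =
    (fun x => `|g (G k s) x|) @^-1` [set y | y < m.+1%:R^-1])//.
  by apply: open_comp => //; exact: open_lt.
have cV m s : closed (V <=%R m s).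
  rewrite fin_bigcap; apply: closed_bigI => k _.
  rewrite (_ : [set x | _] =
    (fun x => `|g (G k s) x|) @^-1` [set y | y <= m.+1%:R^-1])//.
  by apply: preimage_closed => //; exact: closed_le.
exists (fun m => \bigcup_(s in [set s | bd m s]) V <%R m s); split.
- by move=> m; apply: bigcup_open => s _; exact: oV.
- move=> m x [z [zn zG']]; exists z => // k _ /=.
  have /GE -> := zG' k.
  by rewrite normr0 invr_gt0 ltr0n.
move=> x Ux; have V_x m : exists2 s, bd m s & V <=%R m s x.
  (* Prefixes become functions between finite ordinals, to obtain a finite union of closed sets. *)
  pose M := (\max_(i < m) n i).+1.
  pose s_of (f : {ffun 'I_m -> 'I_M}) (i : nat) : nat :=
    if insub i is Some j then f j else 0%N.
  pose W := \bigcup_(f in [set f | bd m (s_of f)]) V <=%R m (s_of f).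
  have cW : closed W.
    by apply: closed_bigcup => [|f _]; [exact: finite_finset|exact: cV].
  suff : W x by move=> [f bf Vf]; exists (s_of f).
  rewrite (closure_id W).1//; apply: closureS (Ux m Logic.I).
  move=> y [s bs Vs].
  have sM i : (i < m)%N -> (s i < M)%N.
    move=> im; rewrite ltnS (leq_trans (bs i im))//.
    exact: (leq_bigmax (Ordinal im)).
  pose f : {ffun 'I_m -> 'I_M} := [ffun i : 'I_m => Ordinal (sM i (ltn_ord i))].
  have fs i : (i < m)%N -> s_of f i = s i.
    by move=> im; rewrite /s_of insubT /= ffunE.
  exists f => [i im|k [km dk]]; first by rewrite fs// bs.
  have ds : determined m (G k) s.
    move=> z zs; rewrite [LHS]dk => [|i im]; last by rewrite zs// fs.
    by apply/esym; apply: dk => i im; rewrite fs.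
  have -> : G k (s_of f) = G k s by apply: ds => i im; rewrite fs.
  by apply: ltW; exact: Vs.
(* The time variable is here an error bound t with |g| <= t <= 1/(k+1); at stage [m] the value
   1/(m+1) serves. The limit t lies below every 1/(j+1), which forces g = 0. *)
have [] := @konig_closed R _ 1 n (fun k z => (k, G k z))
  (fun p => [set t : R | `|g p.2 x| <= t /\ t <= p.1.+1%:R^-1]).
- move=> k z; rewrite (_ : [set t | _] = `[`|g (G k z) x|, k.+1%:R^-1]%classic).
    exact: interval_closed.
  by apply/seteqP; split => t /=; rewrite in_itv/=; [move=> [-> ->]|move=> /andP[]].
- by move=> k z; have [m hm] := lcG k z; exists m => z' /hm ->.
- move=> m; have [s bs Vs] := V_x m; exists m.+1%:R^-1, s; split => //.
    by rewrite in_itv/= invr_ge0 ler0n/= invf_le1 ?ltr0n// ler1n.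
  move=> k km dk; split => /=.
    by apply: Vs; split => // z /dk [].
  by rewrite lef_pV2 ?posrE ?ltr0n// ler_nat ltnS ltnW.
move=> t [z [_ zn zt]]; exists z; split => // k.
apply/GE/eqP; rewrite -normr_le0.
apply/ler_addgt0Pr => e e0; rewrite add0r.
near \oo => j; have [gt _] := zt k; have [_ tj] := zt j.
rewrite (le_trans gt)// (le_trans tj)// ltW//.
by near: j; exact: near_infty_natSinv_lt (PosNum e0).
Unshelve. all: by end_near. Qed.

End zero_sets.

(** * Paths and the Markov property *)

Definition image_measure d1 d2 (T1 : measurableType d1) (T2 : measurableType d2)
    (R : realType) (m : {measure set T1 -> \bar R}) (f : T1 -> T2)
    (mf : measurable_fun setT f) : {measure set T2 -> \bar R} :=
  measure_function_pushforward__canonical__measure_function_Measure m mf.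

Lemma integral_image_measure d1 d2 (T1 : measurableType d1)
    (T2 : measurableType d2) (R : realType) (m : {measure set T1 -> \bar R})
    (f : T1 -> T2) (mf : measurable_fun setT f) (g : T2 -> \bar R) :
  measurable_fun setT g -> (forall y, 0 <= g y) ->
  \int[image_measure m mf]_y g y = \int[m]_x g (f x).
Proof.
by move=> mg g0; have := ge0_integral_pushforward mf m measurableT mg; apply.
Qed.

Section process.
Context (R : realType) (E : ptopologicalType) (d : measure_display)
  (Omega : measurableType d) (M : right_process R E Omega).
Hypothesis borelE : borel_generated_by_continuous R E.
Notation TR := (measurableTypeR R).
Notation state := (borel (cemetery E)).

(* Negative times carry no meaning in position, hence the truncation. *)
Definition pos (t : R) (w : Omega) : state := position M (Num.max t 0%R) w.

Lemma posE t w : (0 <= t)%R -> pos t w = position M t w.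
Proof. by move=> t0; rewrite /pos max_l. Qed.

Definition path_generator : set (set Omega) :=
  [set position M t @^-1` A | t in [set t : R | (0 <= t)%R]
     & A in (measurable : set (set state))].

(* Omega with the sigma-algebra generated by the coordinates, on which x |->
   law M x is a Borel kernel. *)
Definition paths := g_sigma_algebraType path_generator.

Lemma measurable_position_paths t (A : set state) : (0 <= t)%R -> measurable A ->
  measurable (position M t @^-1` A : set paths).
Proof. by move=> t0 mA; apply: sub_sigma_algebra; exists t => //; exists A. Qed.

Lemma paths_measurable (C : set paths) :
  measurable C -> measurable (C : set Omega).
Proof.
move: C; apply: smallest_sub.
  by split; [exact: measurable0|move=> A mA; rewrite setTD; exact: measurableC|
    exact: bigcupT_measurable].
move=> _ [t t0 [A mA <-]]; apply: (filt_measurable t0); exact: position_adapted.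
Qed.

Lemma measurable_id_paths : measurable_fun setT (idfun : Omega -> paths).
Proof. by move=> _ C mC; rewrite setTI; exact: paths_measurable. Qed.

Lemma measurable_Some : measurable_fun setT (Some : borel E -> state).
Proof.
apply: (measurability _ (erefl : @measurable _ state = <<s @open (cemetery E) >>)).
move=> _ [U oU <-]; rewrite setTI; apply: sub_sigma_algebra; exact: oU.
Qed.

Lemma measurable_None : measurable ([set None] : set state).
Proof.
apply: sub_sigma_algebra; change (open (Some @^-1` [set None] : set E)).
by rewrite (_ : _ @^-1` _ = set0)//; [exact: open0|apply/seteqP; split].
Qed.

Lemma measurable_image_Some (A : set (borel E)) : measurable A ->
  measurable (Some @` A : set state).
Proof.
move: A; apply: smallest_sub; last first.
  move=> U oU; apply: sub_sigma_algebra.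
  change (open (Some @^-1` (Some @` U) : set E)).
  rewrite (_ : _ @^-1` _ = U)//; apply/seteqP; split => x /=; last by exists x.
  by move=> [y Uy [<-]].
split; first by rewrite image_set0; exact: measurable0.
- move=> A mA; rewrite (_ : _ @` _ = ~` (Some @` A `|` [set None])).
    by apply: measurableC; apply: measurableU => //; exact: measurable_None.
  apply/seteqP; split => -[x|] /=.
  + by move=> [y [_ Ay] [<-]] [[z Az [zy]]|//]; apply: Ay; rewrite -zy.
  + by move=> [].
  + by move=> h; exists x => //; split => // Ax; apply: h; left; exists x.
  + by case; right.
- by move=> F mF; rewrite image_bigcup; exact: bigcupT_measurable.
Qed.

Lemma measurable_ext0 (f : borel E -> \bar R) : measurable_fun setT f ->
  measurable_fun setT (ext0 f : state -> \bar R).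
Proof.
move=> mf _ S mS; rewrite setTI.
have -> : ext0 f @^-1` S = Some @` (f @^-1` S) `|` ([set None] `&` [set _ | S 0]).
  apply/seteqP; split => -[x|] /=.
  - by move=> Sx; left; exists x.
  - by move=> S0; right.
  - by case => [[y Sy [<-]]//|[]].
  - by case => [[]//|[]].
apply: measurableU.
  by apply: measurable_image_Some; rewrite -[X in measurable X]setTI; exact: mf.
apply: measurableI; first exact: measurable_None.
have [S0|S0] := pselect (S 0).
  by rewrite (_ : [set _ | _] = setT)//; apply/seteqP; split.
by rewrite (_ : [set _ | _] = set0)//; apply/seteqP; split.
Qed.

(** Time is discretized from the right: [s m t] is a multiple of 1/(m+1) strictly beyond t, because
    right continuity is a limit along the punctured right neighbourhood. The limit is taken after
    applying a real [F], since limits of measurable maps into [E] are not under control. *)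
Lemma measurable_continuous_pos (F : cemetery E -> R) : continuous F ->
  measurable_fun setT (fun p : TR * paths => F (pos p.1 p.2)).
Proof.
move=> cF; pose k m (t : R) := Num.truncn (Num.max t 0 * m.+1%:R)%R.
pose s m (t : R) : R := ((k m t).+1%:R / m.+1%:R)%R.
have mt0 (t : R) m : (0 <= Num.max t 0 * m.+1%:R)%R.
  by rewrite mulr_ge0// le_max lexx orbT.
have s_gt m t : (Num.max t 0 < s m t)%R.
  by rewrite /s ltr_pdivlMr ?ltr0n// truncnS_gt.
have s_le m t : (s m t <= Num.max t 0 + m.+1%:R^-1)%R.
  rewrite /s ler_pdivrMr ?ltr0n// mulrDl mulVf ?pnatr_eq0// -natr1 lerD2r.
  by rewrite truncn_le.
apply: (@measurable_fun_cvg _ _ R setT (fun m (p : TR * paths) => F (position M (s m p.1) p.2))).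

  move=> m _ B mB; rewrite setTI.
  rewrite (_ : _ @^-1` _ = \bigcup_j ([set t : TR | k m t = j] `*`
      (position M (j.+1%:R / m.+1%:R)%R @^-1` (F @^-1` B)))); last first.
    apply/seteqP; split => -[t w] /=; first by move=> BF; exists (k m t).
    by move=> [j _ /= [<-]].
  apply: bigcupT_measurable => j; apply: measurableX.
    rewrite (_ : [set t | _] = (fun t : TR => (Num.max t 0 * m.+1%:R)%R) @^-1`
        `[j%:R, j.+1%:R[%classic).
      have mm : measurable_fun setT (fun t : TR => (Num.max t 0 * m.+1%:R)%R : R).
        apply: measurable_funM => //; apply: measurable_maxr => //.
      by rewrite -[X in measurable X]setTI; exact: mm.
    apply/seteqP; split => t /=; rewrite in_itv/= -truncn_eq//; first by move/eqP.
    by move=> /eqP.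
  apply: measurable_position_paths; first by rewrite divr_ge0.
  have mF : measurable_fun setT (F : state -> R).
    apply: (measurability _ (RGenOpens.measurableE R)) => _ [_ [a [b ->]] <-].
    rewrite setTI; apply: sub_sigma_algebra.
    by apply: open_comp => [x _|]; [exact: cF|exact: interval_open].
  by rewrite -[X in measurable X]setTI; exact: mF.
move=> [t w] _ /=; apply: continuous_cvg; first exact: cF.
have := @position_right_continuous _ _ _ _ M (Num.max t 0)%R w.
rewrite le_max lexx orbT => /(_ isT) rc.
apply: (cvg_comp (fun m => s m t) (fun u => position M u w) _ rc).
move=> V /=; rewrite /at_right /within /= => -[e /= e0 eV].
near=> m; apply: eV => /=; last exact: s_gt.
rewrite distrC ger0_norm ?subr_ge0 1?ltW// ltrBlDl.
apply: le_lt_trans (s_le _ _) _; rewrite ltrD2l.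
by near: m; exact: near_infty_natSinv_lt (PosNum e0).
Unshelve. all: by end_near. Qed.

(** Preimages are needed only for generators: sets defined by continuous functions on [E], extended
    by 0 through [F0], and the cemetery, an isolated point detected by [F1]. Sets of [E] containing
    0 in the range pick up the cemetery under [F0], hence its removal. *)
Lemma measurable_pos_paths :
  measurable_fun setT (fun p : TR * paths => pos p.1 p.2).
Proof.
set h := (fun p => _).
pose F0 (f : E -> R) (x : cemetery E) : R := if x is Some y then f y else 0%R.
have cF0 f : continuous f -> continuous (F0 f).
  move=> cf; apply/continuousP => A oA.
  change (open (Some @^-1` (F0 f @^-1` A) : set E)).
  by move/continuousP : cf; exact.
pose F1 (x : cemetery E) : R := if x is Some y then 0%R else 1%R.
have cF1 : continuous F1.
  apply/continuousP => A oA; change (open (Some @^-1` (F1 @^-1` A) : set E)).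
  have [A0|A0] := pselect (A 0%R).
    by rewrite (_ : _ @^-1` _ = setT); [exact: openT|apply/seteqP; split].
  by rewrite (_ : _ @^-1` _ = set0); [exact: open0|apply/seteqP; split].
have mN : measurable (h @^-1` [set None]).
  rewrite (_ : _ @^-1` _ = (fun p => F1 (h p)) @^-1` [set 1%R]).
    by rewrite -[X in measurable X]setTI; exact: (measurable_continuous_pos cF1).
  apply/seteqP; split => p /=; first by move=> ->.
  by case: (h p) => //= x /eqP; rewrite eq_sym oner_eq0.
have mS (A : set (borel E)) : measurable A -> measurable (h @^-1` (Some @` A)).
  have -> : @measurable _ (borel E) = <<s @open E >> by [].
  rewrite -borelE; move: A; apply: smallest_sub.
    split; first by rewrite image_set0 preimage_set0; exact: measurable0.
      move=> A mA; rewrite (_ : _ @^-1` _ = ~` (h @^-1` (Some @` A) `|` h @^-1` [set None])).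
        by apply: measurableC; exact: measurableU.
      apply/seteqP; split => p /=.
        by move=> [y [_ Ay] <-] [[z Az [zy]]|//]; apply: Ay; rewrite -zy.
      case: (h p) => [x|]; last by case; right.
      by move=> hx; exists x => //; split => // Ax; apply: hx; left; exists x.
    by move=> F mF; rewrite image_bigcup preimage_bigcup; exact: bigcupT_measurable.
  move=> _ [f /= cf [U /= oU <-]].
  rewrite (_ : _ @^-1` _ = (fun p => F0 f (h p)) @^-1` U `\` h @^-1` [set None]).
    apply: measurableD => //; rewrite -[X in measurable X]setTI.
    exact: (measurable_continuous_pos (cF0 _ cf) measurableT (open_measurable oU)).
  apply/seteqP; split => p /=; first by move=> [y Uy <-].
  by case: (h p) => [x|] [] //= Ux _; exists x.
move=> _ A mA; rewrite setTI.
rewrite (_ : _ @^-1` _ = h @^-1` (Some @` (Some @^-1` A)) `|`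
    (h @^-1` [set None] `&` [set _ | A None])).
  apply: measurableU.
    by apply: mS; rewrite -[X in measurable X]setTI; exact: measurable_Some.
  apply: measurableI => //; have [A0|A0] := pselect (A None).
    by rewrite (_ : [set _ | _] = setT)//; apply/seteqP; split.
  by rewrite (_ : [set _ | _] = set0)//; apply/seteqP; split.
apply/seteqP; split => p /=; case: (h p) => [x|].
- by move=> Ax; left; exists x.
- by move=> A0; right.
- by case=> [[y Ay [<-]]//|[]].
- by case=> [[]//|[]].
Qed.

Lemma measurable_pos : measurable_fun setT (fun p : TR * Omega => pos p.1 p.2).
Proof.
have mi : measurable_fun setT (fun p : TR * Omega => (p.1, p.2) : TR * paths).
  apply: measurable_fun_pair; first exact: measurable_fst.
  by apply: (measurableT_comp measurable_id_paths); exact: measurable_snd.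
exact: (measurableT_comp measurable_pos_paths mi).
Qed.

Lemma measurable_pos_at t : measurable_fun setT (pos t : Omega -> state).
Proof.
have mi : measurable_fun setT (fun w : Omega => (t, w) : TR * Omega).
  by apply: measurable_fun_pair => //; exact: measurable_cst.
exact: (measurableT_comp measurable_pos mi).
Qed.

Lemma measurable_law (C : set paths) : measurable C ->
  measurable_fun setT (fun x : state => law M x C).
Proof. exact: law_borel_measurable. Qed.

End process.

(** * The Markov property for path events *)

Section markov.
Context (R : realType) (E : ptopologicalType) (d : measure_display)
  (Omega : measurableType d) (M : right_process R E Omega).
Hypothesis hausE : hausdorff_space E.
Hypothesis borelE : borel_generated_by_continuous R E.
Notation TR := (measurableTypeR R).
Notation state := (borel (cemetery E)).
Notation pos := (pos M).
Notation paths := (paths M).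

Let mpos t : measurable_fun setT (pos t : Omega -> state) :=
  measurable_pos_at M borelE t.

Lemma measurable_pos_preimage t (A : set state) : measurable A ->
  measurable (pos t @^-1` A : set Omega).
Proof. by move=> mA; rewrite -[X in measurable X]setTI; exact: mpos. Qed.

(** The time coordinate is a dummy: with it, measurability of sections applies to the set of all (t,
    y, w) with X_t(w) in A, which gives measurability jointly in t and y. *)
Definition path_kernel (p : TR * state) : {measure set paths -> \bar R} :=
  image_measure (law M p.2) (@measurable_id_paths _ _ _ _ M).

Lemma measurable_path_kernel (C : set paths) : measurable C ->
  measurable_fun setT (path_kernel ^~ C).
Proof.
by move=> mC; exact: (measurableT_comp (measurable_law mC) measurable_snd).
Qed.

HB.instance Definition _ :=
  isKernel.Build _ _ (TR * state)%type paths R path_kernel measurable_path_kernel.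

Lemma measurable_law_pos (A : set state) : measurable A ->
  measurable_fun setT (fun p : TR * state => law M p.2 (pos p.1 @^-1` A)).
Proof.
move=> mA.
pose B : set ((TR * state) * paths) := [set q | A (pos q.1.1 q.2)].
have mB : measurable B.
  have mi : measurable_fun setT (fun q : (TR * state) * paths => (q.1.1, q.2) : TR * paths).
    apply: measurable_fun_pair; last exact: measurable_snd.
    exact: (measurableT_comp measurable_fst measurable_fst).
  rewrite -[X in measurable X]setTI.
  exact: (measurableT_comp (@measurable_pos_paths _ _ _ _ M borelE) mi measurableT mA).
have bk p : exists c, forall C : set paths, measurable C ->
    mrestr (path_kernel p) measurableT C < c%:E.
  exists 2%R => C mC; rewrite /mrestr setIT (@le_lt_trans _ _ 1)//.
    exact: probability_le1 (paths_measurable mC).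
  by rewrite lte_fin ltr1n.
have [_] := measurable_prod_subset_xsection_kernel bk mB.
move=> h; apply: eq_measurable_fun h => -[t y] _ /=.
rewrite /mrestr setIT; congr (law M y _).
by apply/seteqP; split => w; rewrite /xsection /= inE.
Qed.

Definition tr (t : R) (g : state -> \bar R) (y : state) : \bar R :=
  \int[law M y]_w g (pos t w).

Lemma tr_ge0 t g y : (forall z, 0 <= g z) -> 0 <= tr t g y.
Proof. by move=> g0; exact: integral_ge0. Qed.

Lemma measurable_tr2 (g : state -> \bar R) :
  measurable_fun setT g -> (forall y, 0 <= g y) ->
  measurable_fun setT (fun p : TR * state => tr p.1 g p.2).
Proof.
move=> mg g0.
have := @measurable_fun_integral_kernel _ _ (TR * state)%type state R
  (fun p => image_measure (law M p.2) (mpos p.1)) measurable_law_pos g g0 mg.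
by apply: eq_measurable_fun => p _; rewrite integral_image_measure.
Qed.

Lemma measurable_tr t (g : state -> \bar R) :
  measurable_fun setT g -> (forall y, 0 <= g y) -> measurable_fun setT (tr t g).
Proof.
move=> mg g0.
have mi : measurable_fun setT (fun y : state => (t, y) : TR * state).
  by apply: measurable_fun_pair => //; exact: measurable_cst.
exact: (measurableT_comp (measurable_tr2 mg g0) mi).
Qed.

Lemma filt0 t : (0 <= t)%R -> filt M t set0.
Proof. by move=> t0; have [] := filt_sigma_algebra M t0. Qed.

Lemma filtT t : (0 <= t)%R -> filt M t setT.
Proof.
move=> t0; have [F0 FC _] := filt_sigma_algebra M t0.
by rewrite -(setD0 setT); exact: FC.
Qed.

Lemma filtC t L : (0 <= t)%R -> filt M t L -> filt M t (~` L).
Proof.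
by move=> t0 FL; have [_ FC _] := filt_sigma_algebra M t0; rewrite -setTD; exact: FC.
Qed.

Lemma filt_bigcup t (F : (set Omega)^nat) : (0 <= t)%R ->
  (forall i, filt M t (F i)) -> filt M t (\bigcup_i F i).
Proof. by move=> t0 FF; have [_ _] := filt_sigma_algebra M t0; exact. Qed.

Lemma filt_bigcap t (F : (set Omega)^nat) : (0 <= t)%R ->
  (forall i, filt M t (F i)) -> filt M t (\bigcap_i F i).
Proof.
move=> t0 FF; rewrite -[X in filt _ _ X]setCK setC_bigcap.
by apply: filtC => //; apply: filt_bigcup => // i; exact: filtC.
Qed.

Lemma filtI t A B : (0 <= t)%R -> filt M t A -> filt M t B -> filt M t (A `&` B).
Proof.
move=> t0 FA FB; rewrite (_ : A `&` B = \bigcap_i (if i is 0%N then A else B)).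
  by apply: filt_bigcap => // -[].
apply/seteqP; split => [w [Aw Bw] [|i]//|w h].
by split; [exact: h 0%N _|exact: h 1%N _].
Qed.

Lemma filt_pos t (A : set state) : (0 <= t)%R -> measurable A ->
  filt M t (pos t @^-1` A).
Proof.
move=> t0 mA; rewrite (_ : _ @^-1` _ = position M t @^-1` A).
  exact: position_adapted.
by apply/seteqP; split => w; rewrite /preimage /= posE.
Qed.

Lemma simple_markov_set x s t L (A : set state) : (0 <= s)%R -> (0 <= t)%R ->
  filt M s L -> measurable A ->
  law M x (L `&` pos (s + t) @^-1` A) =
  \int[law M x]_(w in L) law M (pos s w) (pos t @^-1` A).
Proof.
move=> s0 t0 FL mA.
have := @strong_markov _ _ _ _ M x (fun=> s%:E) L t A _ _ t0 mA.
rewrite (_ : [set w | _] = pos (s + t) @^-1` A); last first.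
  by apply/seteqP; split => w /=; rewrite posE ?addr_ge0.
move=> ->.
- apply: eq_integral => w _; rewrite /= (posE _ _ s0); congr (law M _ _).
  by apply/seteqP; split => w' /=; rewrite posE.
- split=> [w|u u0]; first by rewrite lee_fin.
  have [su|su] := leP s u.
    rewrite (_ : [set w | _] = setT); first exact: filtT.
    by apply/seteqP; split => w //= _; rewrite lee_fin.
  rewrite (_ : [set w | _] = set0); first exact: filt0.
  by apply/seteqP; split => w //=; rewrite lee_fin leNgt su.
- split=> [|u u0]; first exact: filt_measurable FL.
  have [su|su] := leP s u.
    rewrite (_ : [set w | _] = setT).
      by rewrite setIT; exact: filt_le FL.
    by apply/seteqP; split => w //= _; rewrite lee_fin.
  rewrite (_ : [set w | _] = set0); first by rewrite setI0; exact: filt0.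
  by apply/seteqP; split => w //=; rewrite lee_fin leNgt su.
Qed.

(** Both sides integrate [g] against the image under [pos (s + t)] of the law restricted to [L].
    That measure is a mixture of Dirac masses, and by [simple_markov_set] also a mixture of laws
    restarted at [pos s w]. *)
Lemma simple_markov x s t L (g : state -> \bar R) : (0 <= s)%R -> (0 <= t)%R ->
  filt M s L -> measurable_fun setT g -> (forall y, 0 <= g y) ->
  \int[law M x]_(w in L) g (pos (s + t) w) =
  \int[law M x]_(w in L) tr t g (pos s w).
Proof.
move=> s0 t0 FL mg g0; have mL := filt_measurable s0 FL.
have mgs : measurable_fun setT (fun w => g (pos (s + t) w)).
  exact: (measurableT_comp mg (mpos (s + t))).
transitivity (\int[image_measure (mrestr (law M x) mL) (mpos (s + t))]_y g y).
  rewrite integral_image_measure//.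
  rewrite [RHS](@integral_mixture _ _ _ _ R (law M x) L (fun w => \d_w))//.
  - by apply: eq_integral => w _; rewrite integral_dirac// diracT mul1e.
  - by move=> U mU; exact: measurable_fun_dirac.
  - move=> U mU; rewrite /mrestr -[RHS]/(\int[law M x]_(w in L) (\1_U w)%:E).
    by rewrite integral_indic.
rewrite (@integral_mixture _ _ _ _ R (law M x) L
  (fun w => image_measure (law M (pos s w)) (mpos t)))//.
- by apply: eq_integral => w _; rewrite integral_image_measure.
- move=> U mU; have mi : measurable_fun setT (fun w => (t, pos s w) : TR * state).
    by apply: measurable_fun_pair => //; exact: measurable_cst.
  exact: (measurableT_comp (measurable_law_pos mU) mi).
- move=> U mU; rewrite -[LHS]/(law M x (pos (s + t) @^-1` U `&` L)) setIC.
  exact: simple_markov_set.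
Qed.

Lemma tr_add s t g x : (0 <= s)%R -> (0 <= t)%R ->
  measurable_fun setT g -> (forall y, 0 <= g y) ->
  tr (s + t) g x = tr s (tr t g) x.
Proof. by move=> s0 t0 mg g0; rewrite /tr simple_markov//; exact: filtT. Qed.

Lemma measurable_set1_state (x : state) : measurable [set x].
Proof.
case: x => [x|]; last exact: measurable_None.
rewrite (_ : [set Some x] = Some @` [set x]); last by rewrite image_set1.
apply: measurable_image_Some; rewrite -(setCK [set x]); apply: measurableC.
apply: sub_sigma_algebra; apply: closed_openC.
exact: (accessible_closed_set1 (hausdorff_accessible hausE)).
Qed.

Lemma tr0 g (x : state) : measurable_fun setT g -> (forall y, 0 <= g y) ->
  tr 0 g x = g x.
Proof.
move=> mg g0; have m0 : measurable (pos 0 @^-1` [set x]).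
  exact: measurable_pos_preimage (measurable_set1_state x).
have P1 : law M x (pos 0 @^-1` [set x]) = 1.
  rewrite -(law_normal M x); congr (law M x _).
  by apply/seteqP; split => w /=; rewrite posE.
transitivity (\int[law M x]_w g x).
  apply: ge0_ae_eq_integral => //.
  - exact: (measurableT_comp mg (mpos 0)).
  - exists (~` (pos 0 @^-1` [set x])); split; first exact: measurableC.
      by have := probability_setC (law M x) m0; rewrite P1 subee.
    by move=> w /= h h'; apply: h => _; rewrite h'.
by rewrite integral_cst// [X in _ * X]probability_setT mule1.
Qed.

Definition cylinder (ts : seq R) (A : R -> set state) : set paths :=
  [set w | forall t, t \in ts -> A t (pos t w)].

Definition cylinders : set (set paths) :=
  [set C | exists ts A, [/\ all (fun t => 0 <= t)%R ts,
     forall t, measurable (A t) & C = cylinder ts A]].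

(** [H s y] is the probability that a process at [y] at clock time [s] meets the conditions at the
    later times [ts]; conditioning at the earliest of them gives the recursion. [H] does not depend
    on the base time [r], so the case [r = 0] identifies [H 0 y] as the probability of the cylinder
    under [law M y]. *)
Lemma cylinder_markov (A : R -> set state) (ts : seq R) :
  (forall t, measurable (A t)) ->
  exists H : R -> state -> \bar R, [/\
    forall s y, 0 <= H s y, forall s, measurable_fun setT (H s)
  & forall x r s L, (0 <= r)%R -> (0 <= s)%R -> path <=%R s ts ->
    filt M (r + s) L ->
    law M x (L `&` [set w | forall t, t \in ts -> A t (pos (r + t) w)]) =
    \int[law M x]_(w in L) H s (pos (r + s) w)].
Proof.
move=> mA; elim: ts => [|t ts [H [H0 mH IH]]].
  exists (fun _ _ => 1); split => //.
  move=> x r s L r0 s0 _ FL.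
  rewrite (_ : [set w | _] = setT); last by apply/seteqP; split.
  by rewrite setIT integral_cst ?mul1e//; apply: filt_measurable FL; rewrite addr_ge0.
have mg : measurable_fun setT (fun y : state => (\1_(A t) y)%:E * H t y).
  by apply: emeasurable_funM => //; apply/measurable_EFinP; exact: measurable_indic.
have g0 y : 0 <= (\1_(A t) y)%:E * H t y by apply: mule_ge0 => //; rewrite lee_fin.
exists (fun s => tr (t - s) (fun y => (\1_(A t) y)%:E * H t y)); split.
- by move=> s y; exact: tr_ge0.
- by move=> s; exact: measurable_tr.
move=> x r s L r0 s0 /= /andP[st pts] FL.
have rt0 : (0 <= r + t)%R by rewrite addr_ge0// (le_trans s0).
have rs0 : (0 <= r + s)%R by rewrite addr_ge0.
have FLt : filt M (r + t) L by apply: filt_le FL => //; rewrite lerD2l.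
rewrite (_ : L `&` _ = (L `&` pos (r + t) @^-1` (A t)) `&`
    [set w | forall t, t \in ts -> A t (pos (r + t) w)]); last first.
  apply/seteqP; split => w /=.
    move=> [Lw h]; split; first by split => //; apply: h; rewrite mem_head.
    by move=> u uts; apply: h; rewrite inE uts orbT.
  move=> [[Lw At] h]; split => // u; rewrite inE => /orP[/eqP->//|]; exact: h.
have FL' : filt M (r + t) (L `&` pos (r + t) @^-1` (A t)).
  by apply: filtI => //; exact: filt_pos.
rewrite (IH x r t)// ?(le_trans s0)//.
rewrite -simple_markov// ?subr_ge0// -addrA (addrC s) subrK.
rewrite integral_mkcondr; apply: eq_integral => w _.
rewrite /patch indicE; case: ifPn => h.
  by rewrite mem_set ?mul1e//; move: h; rewrite inE.
by rewrite memNset ?mul0e// => h'; move: h; rewrite notin_setE; apply.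
Qed.

Lemma cylinderI : setI_closed cylinders.
Proof.
move=> _ _ [s1 [A1 [s10 mA1 ->]]] [s2 [A2 [s20 mA2 ->]]].
exists (s1 ++ s2), (fun t => (if t \in s1 then A1 t else setT) `&`
                           (if t \in s2 then A2 t else setT)); split.
- by rewrite all_cat s10.
- by move=> t; apply: measurableI; case: ifP.
apply/seteqP; split => w /=; last first.
  move=> h; split => t ts; have := h t; rewrite mem_cat ts ?orbT => /(_ isT) [] //.
move=> [h1 h2] t _; split; case: ifP => //; [exact: h1|exact: h2].
Qed.

Lemma measurable_cylinders : cylinders `<=` (measurable : set (set paths)).
Proof.
move=> _ [ts [A [ts0 mA ->]]].
rewrite (_ : cylinder ts A = \bigcap_(t in [set` ts])
   (pos t @^-1` A t : set paths)); last by [].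
rewrite bigcap_seq big_seq; apply: bigsetI_measurable => t tts.
have t0 := allP ts0 t tts.
rewrite (_ : _ @^-1` _ = position M t @^-1` A t).
  exact: measurable_position_paths.
by apply/seteqP; split => w; rewrite /preimage /= posE.
Qed.

Lemma measurable_paths_cylinders : @measurable _ paths = <<s cylinders >>.
Proof.
apply/seteqP; split => C; last first.
  by apply: smallest_sub; [exact: sigma_algebra_measurable|exact: measurable_cylinders].
apply: smallest_sub; first exact: smallest_sigma_algebra.
move=> _ [t /= t0 [A mA <-]]; apply: sub_sigma_algebra.
exists [:: t], (fun=> A); split => //; first by rewrite /= t0.
apply/seteqP; split => w /=; last first.
  by move=> h; rewrite -(posE M w t0); apply: h; rewrite mem_head.
by move=> h u; rewrite inE => /eqP ->; rewrite /= posE.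
Qed.

Lemma cylindersT : cylinders setT.
Proof. by exists [::], (fun=> setT); split => //; apply/seteqP; split. Qed.

Lemma sorted_cylinder (ts : seq R) A :
  cylinder ts A = cylinder (sort <=%R ts) A.
Proof. by apply/seteqP; split => w /= h t; have := h t; rewrite mem_sort. Qed.

(** The target is [paths]: the shift is known only through the coordinates, hence measurable only
    for the sigma-algebra they generate. *)
Definition shift (s : R) (w : Omega) : paths :=
  projT1 (cid (position_shift M)) s w.

Lemma pos_shift s t w : (0 <= s)%R -> (0 <= t)%R ->
  pos t (shift s w) = pos (s + t) w.
Proof.
move=> s0 t0; rewrite !posE ?addr_ge0// addrC /shift.
by case: cid => theta /= h; rewrite h.
Qed.

Lemma measurable_shift s : (0 <= s)%R ->
  measurable_fun setT (shift s : Omega -> paths).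
Proof.
move=> s0; apply: (measurability _ (erefl : @measurable _ paths = <<s path_generator M >>)).
move=> _ [_ [t /= t0 [A mA <-]] <-]; rewrite setTI.
rewrite (_ : _ @^-1` _ = pos (s + t) @^-1` A).
  exact: measurable_pos_preimage.
by apply/seteqP; split => w /=; rewrite -pos_shift// (posE _ _ t0).
Qed.

(** Cylinders form a generating system stable under intersection, on which both sides reduce to the
    same function [H]; the Dynkin induction does the rest. *)
Lemma markov x s L (C : set paths) : (0 <= s)%R -> filt M s L -> measurable C ->
  law M x (L `&` shift s @^-1` C) = \int[law M x]_(w in L) law M (pos s w) C.
Proof.
move=> s0 FL; have mL := filt_measurable s0 FL.
have msh (C' : set paths) : measurable C' -> measurable (shift s @^-1` C').
  by move=> mC; rewrite -[X in measurable X]setTI; exact: measurable_shift.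
have mlaw (C' : set paths) : measurable C' ->
    measurable_fun setT (fun w => law M (pos s w) C').
  by move=> mC; exact: (measurableT_comp (measurable_law mC) (mpos s)).
have fin y (A : set Omega) : measurable A -> law M y A \is a fin_num.
  by move=> mA; exact: fin_num_measure.
rewrite measurable_paths_cylinders; move: C.
apply: (dynkin_induction measurable_paths_cylinders cylinderI).
- rewrite preimage_setT setIT.
  under eq_integral do rewrite probability_setT.
  by rewrite integral_cst// mul1e.
- move=> _ [ts [A [ts0 mA ->]]]; rewrite sorted_cylinder.
  have pts : path <=%R 0%R (sort <=%R ts).
    rewrite path_min_sorted; first by apply: sort_sorted; exact: le_total.
    by rewrite all_sort.
  have [H [H0 mH HE]] := cylinder_markov (sort <=%R ts) mA.
  have HA y : law M y (cylinder (sort <=%R ts) A) = H 0%R y.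
    rewrite -[in RHS](tr0 y (mH 0%R) (H0 0%R)) /tr.
    have := HE y 0%R 0%R setT; rewrite addr0 setTI => <- //; last exact: filtT.
    by congr (law M y _); apply/seteqP; split => w h t /h; rewrite add0r.
  under eq_integral do rewrite HA.
  have := HE x s 0%R L; rewrite addr0 => <- //.
  congr (law M x (_ `&` _)); apply/seteqP; split => w /= h t tts;
    have t0 : (0 <= t)%R by (move: tts; rewrite mem_sort => /(allP ts0)).
    by rewrite -pos_shift//; exact: h.
  by rewrite pos_shift//; exact: h.
- move=> C mC IH; rewrite preimage_setC -setDE measureD ?fin//; last 2 first.
  + by apply: msh.
  + by rewrite ltey_eq fin.
  transitivity (\int[law M x]_(w in L) (1 - law M (pos s w) C)); last first.
    apply: eq_integral => w _; rewrite probability_setC//; exact: (paths_measurable mC).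
  rewrite [X in _ - X]IH integralB//.
  + by rewrite integral_cst// mul1e.
  + exact: (finite_measure_integrable_cst _ 1%R).
  + apply/integrableP; split; first exact: measurable_funTS (mlaw _ mC).
    under eq_integral do rewrite gee0_abs//.
    rewrite -IH ltey_eq fin//; apply: measurableI => //; exact: msh.
- move=> F mF tF IH.
  have sT (f : nat -> \bar R) : \sum_(i <oo | i \in setT) f i = \sum_(i <oo) f i.
    by apply: eq_eseriesl => i; rewrite in_setT.
  rewrite preimage_bigcup setI_bigcupr measure_bigcup//; last 2 first.
  + by move=> n _; apply: measurableI => //; exact: msh.
  + move=> i j _ _ [w [[_ Fi] [_ Fj]]]; apply: (tF i j) => //.
    by exists (shift s w).
  rewrite sT (eq_eseriesr (g := fun n => \int[law M x]_(w in L) law M (pos s w) (F n))); last first.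
    by move=> n _; exact: IH.
  rewrite -integral_nneseries//; last by move=> n; exact: measurable_funTS (mlaw _ (mF n)).
  apply: eq_integral => w _; rewrite measure_bigcup ?sT//.
  by move=> n _; exact: paths_measurable.
Qed.

End markov.

Section time_integral_complements.
Context (R : realType).
Notation TR := (measurableTypeR R).
Notation leb := (@lebesgue_measure R).

Lemma measurable_integral_in d (T : measurableType d) (D : set TR)
    (f : TR -> T -> \bar R) :
  measurable D -> measurable_fun setT (fun p : TR * T => f p.1 p.2) ->
  (forall t w, 0 <= f t w) ->
  measurable_fun setT (fun w => \int[leb]_(t in D) f t w).
Proof.
move=> mD mf f0; pose g (p : TR * T) := f p.1 p.2 * (\1_D p.1)%:E.
have g0 p : 0 <= g p by apply: mule_ge0 => //; rewrite lee_fin.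
have mg : measurable_fun setT g.
  apply: emeasurable_funM => //; apply/measurable_EFinP.
  by apply: measurableT_comp => //; exact: measurable_indic.
apply: eq_measurable_fun (measurable_fun_fubini_tonelli_G (m1 := leb) g mg g0).
move=> w _; rewrite /fubini_G [RHS]integral_mkcond; apply: eq_integral => t _.
by rewrite /g /patch indicE /=; case: ifPn; rewrite ?mule1 ?mule0.
Qed.

Lemma integral_shift_in (a : R) (D : set TR) (f : TR -> \bar R) :
  measurable D -> measurable_fun setT f -> (forall t, 0 <= f t) ->
  \int[leb]_(t in (fun t => a + t)%R @^-1` D) f (a + t)%R =
  \int[leb]_(t in D) f t.
Proof.
move=> mD mf f0; rewrite [RHS]integral_mkcond [LHS]integral_mkcond.
apply: (@integral_shift _ a (f \_ D)).
- exact: ((measurable_restrictT f mD).1 (measurable_funTS mf)).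
- by move=> t; rewrite /patch; case: ifP.
Qed.

Lemma integral_half_line_le (f : TR -> \bar R) (c : \bar R) :
  measurable_fun setT f -> (forall t, 0 <= f t) ->
  (forall n : nat, \int[leb]_(t in `[0%R, n%:R[) f t <= c) ->
  \int[leb]_(t in `[0%R, +oo[) f t <= c.
Proof.
move=> mf f0 fc.
have UE : `[0%R, +oo[%classic = \bigcup_n `[0%R, n%:R[%classic :> set R.
  apply/seteqP; split => [t|t [n _]] /=; rewrite !in_itv/= ?andbT; last by case/andP.
  move=> t0; exists (Num.truncn t).+1 => //=.
  by rewrite in_itv/= t0/= truncnS_gt.
have nd : nondecreasing_seq (fun n : nat => `[0%R, n%:R[%classic : set R).
  move=> m n mn; apply/subsetPset => t /=; rewrite !in_itv/= => /andP[-> tm]/=.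
  by rewrite (lt_le_trans tm)// ler_nat.
have := @ge0_nondecreasing_set_cvg_integral _ TR R
  (fun n : nat => `[0%R, n%:R[%classic : set TR) f leb nd (fun i => measurable_itv _)
  (fun i => measurable_funTS mf) (fun i t _ => f0 t).
by rewrite -UE => /cvge_to_le; apply; exact: nearW.
Qed.

End time_integral_complements.

(** * Potentials and recurrence *)

Section potential.
Context (R : realType) (E : ptopologicalType) (d : measure_display)
  (Omega : measurableType d) (M : right_process R E Omega).
Hypothesis hausE : hausdorff_space E.
Hypothesis borelE : borel_generated_by_continuous R E.
Notation TR := (measurableTypeR R).
Notation leb := (@lebesgue_measure R).
Notation state := (borel (cemetery E)).
Notation pos := (pos M).
Notation tr := (tr M).

Definition ind (A : set state) (y : state) : \bar R := (\1_A y)%:E.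

Lemma ind_ge0 A y : 0 <= ind A y. Proof. by rewrite lee_fin. Qed.

Lemma measurable_ind A : measurable A -> measurable_fun setT (ind A).
Proof. by move=> mA; apply/measurable_EFinP; exact: measurable_indic. Qed.

Lemma tr_ind t (A : set state) y : measurable A ->
  tr t (ind A) y = law M y (pos t @^-1` A).
Proof.
move=> mA; rewrite /tr -[LHS]/(\int[law M y]_w (\1_(pos t @^-1` A) w)%:E).
by rewrite integral_indic ?setIT//; exact: measurable_pos_preimage.
Qed.

Lemma le_tr t f g y : (forall z, 0 <= f z) -> (forall z, f z <= g z) ->
  tr t f y <= tr t g y.
Proof. by move=> f0 fg; apply: le_integral_nonmeas => w _. Qed.

Lemma tr_le_cst t f y (K : R) : (forall z, 0 <= f z) ->
  (forall z, f z <= K%:E) -> tr t f y <= K%:E.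
Proof.
move=> f0 fK; apply: le_trans (_ : \int[law M y]_w K%:E <= _).
  by apply: le_integral_nonmeas => w _.
by rewrite integral_cst// [X in _ * X]probability_setT mule1.
Qed.

Lemma semigroupE t (f : E -> \bar R) x : (0 <= t)%R ->
  semigroup M t f x = tr t (ext0 f) (Some x).
Proof. by move=> t0; apply: eq_integral => w _; rewrite posE. Qed.

Lemma ext0_ind (A : set E) : ext0 (fun y => (\1_A y)%:E : \bar R) = ind (Some @` A).
Proof.
apply/funext => -[x|] /=; rewrite /ind !indicE.
  congr (_%:R%:E); congr nat_of_bool; apply/idP/idP; rewrite !inE; first by exists x.
  by move=> [y Ay [<-]].
by rewrite memNset// => -[].
Qed.

Lemma pos_None s t w : (s <= t)%R -> pos s w = None -> pos t w = None.
Proof.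
move=> st; have m0 (u : R) : (0 <= Num.max u 0)%R by rewrite le_max lexx orbT.
move=> /(position_lifetime M w (m0 s)) ls.
apply/(position_lifetime M w (m0 t)); apply: le_trans ls _.
by rewrite lee_fin ge_max le_max st/= le_max lexx orbT.
Qed.

Lemma ae_start (x : state) : {ae law M x, forall w, pos 0 w = x}.
Proof.
have m0 : measurable (pos 0 @^-1` [set x]).
  by apply: measurable_pos_preimage => //; exact: measurable_set1_state.
exists (~` (pos 0 @^-1` [set x])); split; [exact: measurableC| |by move=> w].
have := probability_setC (law M x) m0.
rewrite (_ : pos 0 @^-1` [set x] = [set w | position M 0%R w = x]) in m0 *.
  by rewrite law_normal subee.
by apply/seteqP; split => w /=; rewrite posE.
Qed.

Lemma tr_None t (g : state -> \bar R) : (forall y, 0 <= g y) -> (0 <= t)%R -> g None = 0 ->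
  tr t g None = 0.
Proof.
move=> g0 t0 gN; apply: integral_ae0 => //; apply: filterS (ae_start None) => w h.
by rewrite (pos_None t0 h).
Qed.

Definition potential (A : set state) (y : state) : \bar R :=
  \int[leb]_(t in `[0%R, +oo[) tr t (ind A) y.

Lemma measurable_potential A : measurable A -> measurable_fun setT (potential A).
Proof.
move=> mA; apply: measurable_integral_in => //.
  by apply: measurable_tr2 => //; [exact: measurable_ind|exact: ind_ge0].
by move=> t y; apply: tr_ge0; exact: ind_ge0.
Qed.

Lemma measurable_ind_pos A : measurable A ->
  measurable_fun setT (fun p : TR * Omega => ind A (pos p.1 p.2)).
Proof.
move=> mA; exact: (measurableT_comp (measurable_ind mA) (@measurable_pos _ _ _ _ M borelE)).
Qed.

Lemma potentialE A y : measurable A ->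
  potential A y = \int[law M y]_w \int[leb]_(t in `[0%R, +oo[) ind A (pos t w).
Proof.
move=> mA; rewrite tonelli_in//; last by move=> t w; exact: ind_ge0.
exact: measurable_ind_pos.
Qed.

Variable mu : {sigma_finite_measure set (borel E) -> \bar R}.
Hypothesis excM : excessive_measure M mu.

Let measS (A : set (borel E)) (mA : measurable A) := measurable_image_Some mA.

Lemma measurable_tr_Some t g : measurable_fun setT g -> (forall y, 0 <= g y) ->
  measurable_fun setT (fun x : borel E => tr t g (Some x)).
Proof.
move=> mg g0.
exact: (measurableT_comp (measurable_tr M borelE t mg g0) (@measurable_Some E)).
Qed.

Lemma ae_tr_null t (N : set (borel E)) : (0 < t)%R -> measurable N -> mu N = 0 ->
  {ae mu, forall x : borel E, tr t (ind (Some @` N)) (Some x) = 0}.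
Proof.
move=> t0 mN N0; apply: ge0_integral_eq0_ae.
- by apply: measurable_tr_Some; [exact: measurable_ind (measS mN)|exact: ind_ge0].
- by move=> x; apply: tr_ge0; exact: ind_ge0.
- apply/eqP; rewrite eq_le integral_ge0 ?andbT; last first.
    by move=> x _; apply: tr_ge0; exact: ind_ge0.
  rewrite -N0; apply: le_trans (excM mN t0); apply: le_integral_nonmeas => x _.
    by apply: tr_ge0; exact: ind_ge0.
  by rewrite (semigroupE _ _ (ltW t0)) ext0_ind.
Qed.

Lemma ae_tr_eq0 (t : R) (g : state -> \bar R) : (0 < t)%R -> measurable_fun setT g ->
  (forall y, 0 <= g y) -> g None = 0 ->
  {ae mu, forall x : borel E, g (Some x) = 0} ->
  {ae mu, forall x : borel E, tr t g (Some x) = 0}.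
Proof.
move=> t0 mg g0 gN [N [mN N0 gNx]].
apply: filterS (ae_tr_null t0 mN N0) => x.
rewrite tr_ind; last exact: measS.
move=> PN; apply: integral_ae0 => //.
exists (pos t @^-1` (Some @` N)); split => //.
  by apply: measurable_pos_preimage => //; exact: measS.
move=> w /= gw; case Ew : (pos t w) gw => [y|//] gy.
by exists y => //; apply: gNx.
Qed.

Hypothesis irr : strictly_irreducible M mu.

Lemma alive_some w : pos 0 w <> None -> exists n, pos n.+1%:R^-1 w <> None.
Proof.
move=> h; have : 0 < lifetime M w.
  rewrite ltNge; apply/negP => l0; apply: h.
  by rewrite posE//; apply/(position_lifetime M w (lexx 0%R)).
have : 0 <= lifetime M w by exact: lifetime_ge0.
case El : (lifetime M w) => [l| |]// _.
  rewrite lte_fin => l0; near \oo => n; exists n; rewrite posE ?invr_ge0//.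
  move=> /(position_lifetime M w); rewrite invr_ge0 ler0n => /(_ isT).
  rewrite El lee_fin leNgt => /negP; apply.
  by near: n; exact: near_infty_natSinv_lt (PosNum l0).
move=> _; exists 0%N; rewrite posE ?invr_ge0// => /(position_lifetime M w).
by rewrite invr_ge0 ler0n El => /(_ isT).
Unshelve. all: by end_near. Qed.

(** Tonelli only yields mu p_r 1_N = 0 for almost every time r. Some such r lies in ]0, s[, which
    has positive length, and p_s = p_(s-r) p_r carries the vanishing on to s because p_(s-r)
    preserves a.e. vanishing. *)
Lemma ae_tr_potential_eq0 (N : set (borel E)) : measurable N ->
  {ae mu, forall x : borel E, potential (Some @` N) (Some x) = 0} ->
  forall s, (0 < s)%R ->
  {ae mu, forall x : borel E, tr s (ind (Some @` N)) (Some x) = 0}.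
Proof.
move=> mN UN0 s s0; have mSN := measS mN.
have mi := measurable_ind mSN.
pose phi (t : TR) : \bar R := \int[mu]_x tr t (ind (Some @` N)) (Some x).
have f0 t x : 0 <= tr t (ind (Some @` N)) x by apply: tr_ge0; exact: ind_ge0.
have mf : measurable_fun setT (fun p : TR * borel E => tr p.1 (ind (Some @` N)) (Some p.2)).
  have mp : measurable_fun setT (fun p : TR * borel E => (p.1, Some p.2) : TR * state).
    apply: measurable_fun_pair; first exact: measurable_fst.
    exact: (measurableT_comp (@measurable_Some E) measurable_snd).
  exact: (measurableT_comp (measurable_tr2 M borelE mi (@ind_ge0 _)) mp).
have phi0 t : 0 <= phi t by apply: integral_ge0.
have mphi : measurable_fun setT phi.
  exact: (measurable_fun_fubini_tonelli_F (m2 := mu)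
    (fun p : TR * borel E => tr p.1 (ind (Some @` N)) (Some p.2)) mf (fun p => f0 _ _)).
have : \int[leb]_(t in `[0%R, +oo[) phi t = 0.
  rewrite -(@tonelli_in _ _ _ mu `[0%R, +oo[%classic
    (fun t x => tr t (ind (Some @` N)) (Some x)))//.
  by apply: integral_ae0 => // x; apply: integral_ge0.
have [+ _] := @ae_eq_integral_abs _ _ R leb _ (measurable_itv `[0%R, +oo[) phi
  (measurable_funTS mphi).
under eq_integral do rewrite gee0_abs//.
move=> /[apply] aephi.
have [r [r0 rs phir]] : exists r : R, [/\ (0 < r)%R, (r < s)%R & phi r = 0].
  apply: contrapT => /forallNP nr; case: aephi => Z [mZ Z0 sZ].
  have : leb `]0%R, s[%classic <= leb Z.
    apply: le_measure; rewrite ?inE//.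
    move=> r /=; rewrite in_itv/= => /andP[r0 rs]; apply: sZ => /= h.
    by apply: (nr r); split => //; apply: h; rewrite in_itv/= ltW.
  rewrite lebesgue_measure_itv/= lte_fin s0 -EFinB subr0 [leb Z]Z0 lee_fin.
  by rewrite leNgt s0.
have rae : {ae mu, forall x : borel E, tr r (ind (Some @` N)) (Some x) = 0}.
  by apply: ge0_integral_eq0_ae => //; apply: measurable_tr_Some => //; exact: ind_ge0.
have sr0 : (0 < s - r)%R by rewrite subr_gt0.
have := @ae_tr_eq0 (s - r) (tr r (ind (Some @` N))) sr0 _ (f0 r) _ rae.
move=> /(_ (measurable_tr M borelE r mi (@ind_ge0 _))).
have trN : tr r (ind (Some @` N)) None = 0.
  apply: tr_None => //; [exact: ind_ge0|exact: ltW|].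
  by rewrite /ind indicE memNset// => -[].
move=> /(_ trN); apply: filterS => x.
by rewrite -tr_add ?subrK ?ltW//; exact: ind_ge0.
Qed.

Lemma tr_ind_setU t (A B : set (borel E)) x : measurable A -> measurable B ->
  tr t (ind (Some @` A)) x = 0 -> tr t (ind (Some @` B)) x = 0 ->
  tr t (ind (Some @` (A `|` B))) x = 0.
Proof.
move=> mA mB; have mAs := measS mA; have mBs := measS mB.
rewrite !tr_ind ?image_setU//; last exact: measurableU.
rewrite preimage_setU => A0 B0; apply/eqP.
by rewrite -measure_le0 -(adde0 0) -{1}A0 -B0; apply: measureU2; exact: measurable_pos_preimage.
Qed.

Lemma potential_eq0_null (N : set (borel E)) : measurable N ->
  {ae mu, forall x : borel E, potential (Some @` N) (Some x) = 0} ->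
  mu N = 0.
Proof.
move=> mN UN0; have trN := ae_tr_potential_eq0 mN UN0.
have : completion_measurable mu N by exists N, N; split=> //; rewrite setDv.
move=> /irr[].
- move=> t t0; apply: filterS (trN t t0) => x trx _.
  by rewrite semigroupE ?ltW// ext0_ind.
- by move/negligibleP => /(_ mN).
move=> /(negligibleP _ (measurableC mN)) CN0.
(* The complement of [N] is null, so p_t 1_E vanishes a.e. along t = 1/(n+1). A point where it
   vanishes for every n would be dead at all these times, against survival on an initial interval;
   hence the exceptional null set is the whole space. *)
suff muT : mu setT = 0.
  by apply/eqP; rewrite -measure_le0 -muT; apply: le_measure; rewrite ?inE.
have aeT n : {ae mu, forall x : borel E,
    tr n.+1%:R^-1 (ind (Some @` setT)) (Some x) = 0}.
  have n0 : (0 < n.+1%:R^-1 :> R)%R by rewrite invr_gt0.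
  apply: filterS2 (trN _ n0) (ae_tr_null n0 (measurableC mN) CN0) => x h1 h2.
  by rewrite -(setUv N); apply: tr_ind_setU => //; exact: measurableC.
have /ae_foralln [Z [mZ Z0 sZ]] := aeT.
apply/eqP; rewrite -measure_le0 -[leRHS]Z0; apply: le_measure; rewrite ?inE//.
move=> x _; apply: sZ => /= h.
have mST : measurable (Some @` [set: E] : set state) by exact: measS.
have : (law M (Some x)).-negligible (\bigcup_n (pos n.+1%:R^-1 @^-1` (Some @` [set: E]))).
  apply: negligible_bigcup => n.
  apply/negligibleP; first exact: measurable_pos_preimage.
  by have := h n; rewrite tr_ind.
move=> neg; have : {ae law M (Some x), forall w : Omega, False}.
  have aen : {ae law M (Some x), forall w,
      ~ (\bigcup_n (pos n.+1%:R^-1 @^-1` (Some @` [set: E]))) w}.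
    by apply: negligibleS neg => w /= /contrapT.
  apply: filterS2 (ae_start (Some x)) aen => w w0; apply.
  have [|n nN] := @alive_some w; first by rewrite w0.
  by exists n => //=; case: (pos _ w) nN => // y _; exists y.
move=> [Y [mY Y0 sY]]; have : law M (Some x) setT <= law M (Some x) Y.
  by apply: le_measure; rewrite ?inE// => w _; exact: sY.
by rewrite [leRHS]Y0 [leLHS]probability_setT lee_fin ler10.
Qed.

Hypothesis rec : recurrent M mu.

(** Finite measure makes the indicator integrable, as the definition of recurrence requires of its
    test functions. *)
Lemma potential_0oo (A : set (borel E)) : measurable A -> mu A < +oo ->
  {ae mu, forall x : borel E, potential (Some @` A) (Some x) = 0 \/
                              potential (Some @` A) (Some x) = +oo}.
Proof.
move=> mA Aoo; have := rec (f := \1_A).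
have -> : EFin \o \1_A = (fun y : E => (\1_A y)%:E) by [].
rewrite ext0_ind => /(_ _ _)/filterS; apply.
- move=> x; suff -> : potential (Some @` A) (Some x) = \int[law M (Some x)]_w
    \int[leb]_(t in `[0%R, +oo[) ind (Some @` A) (position M t w) by [].
  rewrite potentialE; last exact: (measS mA).
  apply: eq_integral => w _; apply: eq_integral => t.
  by rewrite inE/= in_itv/= andbT => t0; rewrite posE.
- apply/integrableP; split; first by apply/measurable_EFinP; exact: measurable_indic.
  under eq_integral do rewrite gee0_abs ?lee_fin//.
  by rewrite integral_indic// setIT.
- by apply: aeW => x; rewrite indicE.
Qed.

End potential.

(** * Telescoping and almost everywhere invariance *)

Section recurrence.
Context (R : realType) (E : ptopologicalType) (d : measure_display)
  (Omega : measurableType d) (M : right_process R E Omega).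
Hypothesis hausE : hausdorff_space E.
Hypothesis borelE : borel_generated_by_continuous R E.
Notation TR := (measurableTypeR R).
Notation leb := (@lebesgue_measure R).
Notation state := (borel (cemetery E)).
Notation pos := (pos M).
Notation tr := (tr M).
Notation potential := (potential M).
Notation ind := (@ind R E).

Let mpos t : measurable_fun setT (pos t : Omega -> state) :=
  measurable_pos_at M borelE t.

Let mtr t (g : state -> \bar R) (mg : measurable_fun setT g) g0 :
  measurable_fun setT (tr t g) := measurable_tr M borelE t mg g0.

Let mtrt (g : state -> \bar R) (mg : measurable_fun setT g)
    (g0 : forall y, 0 <= g y) (x : state) :
  measurable_fun setT (fun t : TR => tr t g x).
Proof.
have mi : measurable_fun setT (fun t : TR => (t, x) : TR * state).
  by apply: measurable_fun_pair => //; exact: measurable_cst.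
exact: (measurableT_comp (measurable_tr2 M borelE mg g0) mi).
Qed.

Lemma ae_time_eq0 (f : TR -> \bar R) : measurable_fun setT f ->
  (forall t, 0 <= f t) -> \int[leb]_(t in `[0%R, +oo[) f t = 0 ->
  {ae leb, forall t : TR, (0 <= t)%R -> f t = 0}.
Proof.
move=> mf f0 If.
have [+ _] := @ae_eq_integral_abs _ _ R leb _ (measurable_itv `[0%R, +oo[) f
  (measurable_funTS mf).
under eq_integral do rewrite gee0_abs//.
move=> /(_ If); apply: filterS => t h t0; apply: h.
by rewrite /= in_itv/= t0.
Qed.

(* Telescoping: integrating e 1_A <= g - p_t g along the path up to time n
   leaves only the two boundary terms, of length t each. *)
Lemma potential_bound (A N : set state) (g : state -> \bar R) (K e t : R) x :
  measurable A -> measurable N -> measurable_fun setT g ->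
  (forall y, 0 <= g y) -> (forall y, g y <= K%:E) -> (0 < e)%R -> (0 < t)%R ->
  (forall y, ~ N y -> e%:E * ind A y + tr t g y <= g y) ->
  potential N x = 0 -> potential A x <= (t * K / e)%:E.
Proof.
move=> mA mN mg g0 gK e0 t0 gle UN.
have K0 : (0 <= K)%R by have := le_trans (g0 None) (gK None); rewrite lee_fin.
have mi : measurable_fun setT (ind A) by exact: measurable_ind.
have miN : measurable_fun setT (ind N) by exact: measurable_ind.
have i0 := @ind_ge0 R E A; have iN0 := @ind_ge0 R E N.
pose a (r : TR) := tr r (ind A) x; pose b (r : TR) := tr r g x.
have a0 r : 0 <= a r by exact: tr_ge0.
have b0 r : 0 <= b r by exact: tr_ge0.
have bK r : b r <= K%:E by exact: tr_le_cst.
have ma : measurable_fun setT a by exact: mtrt.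
have mb : measurable_fun setT b by exact: mtrt.
have mbt : measurable_fun setT (fun r : TR => b (t + r)%R).
  apply: (measurableT_comp mb); apply: measurable_funD => //.
(* Potential 0 means that [N] is not charged at almost every time r. At these times the inequality
   assumed off [N] can be integrated over the position at time r. *)
have key : {ae leb, forall r : TR, (0 <= r)%R -> e%:E * a r + b (t + r)%R <= b r}.
  have := ae_time_eq0 (mtrt miN iN0 x) (fun r => tr_ge0 M r x iN0) UN.
  apply: filterS => r h r0; have {}h := h r0.
  have mtg : measurable_fun setT (tr t g) by exact: mtr.
  have tg0 y : 0 <= tr t g y by exact: tr_ge0.
  rewrite /b (addrC t r) (tr_add M borelE x r0 (ltW t0) mg g0).
  have m1 : measurable_fun setT (fun w => ind A (pos r w)).
    exact: (measurableT_comp mi (mpos r)).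
  have m2 : measurable_fun setT (fun w => tr t g (pos r w)).
    exact: (measurableT_comp mtg (mpos r)).
  have m3 : measurable_fun setT (fun w => g (pos r w)).
    exact: (measurableT_comp mg (mpos r)).
  have m1e : measurable_fun setT (fun w => e%:E * ind A (pos r w)).
    exact: measurable_funeM.
  have e1 w : 0 <= e%:E * ind A (pos r w) by apply: mule_ge0 => //; rewrite lee_fin ltW.
  change (e%:E * (\int[law M x]_w ind A (pos r w)) +
    \int[law M x]_w tr t g (pos r w) <= \int[law M x]_w g (pos r w)).
  rewrite -ge0_integralZl//; last by rewrite lee_fin ltW.
  rewrite -ge0_integralD//.
  apply: ae_ge0_le_integral => //.
  - by move=> w _; apply: adde_ge0.
  - exact: emeasurable_funD.
  exists (pos r @^-1` N); split.
  - exact: measurable_pos_preimage.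
  - by rewrite tr_ind in h.
  - by move=> w /=; apply: contra_notP => nN _; exact: gle.
apply: integral_half_line_le => // n.
have mI (u v : R) : measurable (`[u, v[%classic : set TR) by exact: measurable_itv.
have fin_b (u v : R) : (u <= v)%R -> \int[leb]_(r in `[u, v[) b r <= ((v - u) * K)%:E.
  move=> uv; apply: le_trans (_ : \int[leb]_(r in `[u, v[) K%:E <= _).
    by apply: le_integral_nonmeas.
  rewrite integral_cst//= lebesgue_measure_itv/= lte_fin.
  case: ltP => [_|vu]; first by rewrite -EFinB -EFinM mulrC.
  by rewrite mule0 lee_fin mulr_ge0// subr_ge0.
have shift_b : \int[leb]_(r in `[0%R, n%:R[) b (t + r)%R = \int[leb]_(r in `[t, (t + n%:R)%R[) b r.
  rewrite -(@integral_shift_in _ t `[t, (t + n%:R)%R[%classic b)//.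
  congr (integral leb _ _); apply/seteqP; split => r /=; rewrite !in_itv/=;
    by rewrite lerDl ltrD2l.
have fin_c : \int[leb]_(r in `[t, (t + n%:R)%R[) b r \is a fin_num.
  rewrite ge0_fin_numE; last exact: integral_ge0.
  by apply: le_lt_trans (fin_b _ _ _) _; rewrite ?ltry// lerDl.
(* The integral over [t, t+n[ occurs twice: on the left as the translate of b(t+r) over [0, n[, on
   the right from covering [0, n[ by [0, t[ and [t, t+n[. It is finite and cancels, which leaves the
   bound t K for every n. *)
have : e%:E * \int[leb]_(r in `[0%R, n%:R[) a r + \int[leb]_(r in `[t, (t + n%:R)%R[) b r <=
    \int[leb]_(r in `[0%R, t[) b r + \int[leb]_(r in `[t, (t + n%:R)%R[) b r.
  rewrite -ge0_integral_setU//; last 2 first.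
  - exact: measurable_funTS.
  - apply/eqP/seteqP; split => // r; rewrite /= !in_itv/= => -[/andP[_ rt] /andP[]].
    by rewrite leNgt rt.
  apply: (@le_trans _ _ (\int[leb]_(r in `[0%R, n%:R[) b r)).
    have ma' (D : set TR) : measurable_fun D a by exact: measurable_funTS.
    have mb' (D : set TR) : measurable_fun D b by exact: measurable_funTS.
    have mbt' (D : set TR) : measurable_fun D (fun r : TR => b (t + r)%R).
      exact: measurable_funTS.
    have mea (D : set TR) : measurable_fun D (fun r => e%:E * a r).
      by apply: measurable_funTS; exact: measurable_funeM.
    have e1 r : 0 <= e%:E * a r by apply: mule_ge0 => //; rewrite lee_fin ltW.
    rewrite -shift_b -ge0_integralZl//; last by rewrite lee_fin ltW.
    rewrite -ge0_integralD//.
    apply: ae_ge0_le_integral => //.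
    - by move=> r _; apply: adde_ge0.
    - exact: emeasurable_funD.
    - by apply: filterS key => r h; rewrite /= in_itv/= => /andP[r0 _]; exact: h.
  apply: ge0_subset_integral => //; first exact: measurableU.
    exact: measurable_funTS.
  move=> r /=; rewrite !in_itv/= => /andP[r0 rn].
  have [rt|tr_] := ltP r t; first by left; rewrite r0.
  by right; rewrite /= (lt_le_trans rn)// lerDr ltW.
rewrite leeD2rE// => /le_trans/(_ (fin_b _ _ (ltW t0))); rewrite subr0.
have -> : (t * K)%:E = e%:E * (t * K / e)%:E.
  by rewrite -EFinM mulrCA divff ?mulr1// gt_eqF.
by rewrite lee_pmul2l.
Qed.

Variable mu : {sigma_finite_measure set (borel E) -> \bar R}.
Hypothesis excM : excessive_measure M mu.
Hypothesis irr : strictly_irreducible M mu.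
Hypothesis rec : recurrent M mu.

Let measS (A : set (borel E)) (mA : measurable A) := measurable_image_Some mA.

Lemma ae_potential_null (N : set (borel E)) : measurable N -> mu N = 0 ->
  {ae mu, forall x : borel E, potential (Some @` N) (Some x) = 0}.
Proof.
move=> mN N0; have mSN := measS mN.
have mi : measurable_fun setT (ind (Some @` N)) by exact: measurable_ind.
have i0 := @ind_ge0 R E (Some @` N).
apply: ge0_integral_eq0_ae.
- exact: (measurableT_comp (measurable_potential M borelE mSN) (@measurable_Some E)).
- by move=> x; apply: integral_ge0 => t _; exact: tr_ge0.
rewrite (@tonelli_in _ _ _ mu `[0%R, +oo[%classic
  (fun t x => tr t (ind (Some @` N)) (Some x)))//; last 2 first.
- have mp : measurable_fun setT (fun p : TR * borel E => (p.1, Some p.2) : TR * state).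
    apply: measurable_fun_pair; first exact: measurable_fst.
    exact: (measurableT_comp (@measurable_Some E) measurable_snd).
  exact: (measurableT_comp (measurable_tr2 M borelE mi i0) mp).
- by move=> t x; exact: tr_ge0.
(* Time 0 is separate: excessiveness of mu concerns t > 0 only, while p_0 1_N is 1_N itself. *)
apply: integral0_eq => t; rewrite /= in_itv/= andbT le_eqVlt => /orP[/eqP<-|t0].
  transitivity (\int[mu]_x (\1_N x)%:E); last by rewrite integral_indic// setIT.
  apply: eq_integral => x _; rewrite (tr0 M hausE borelE)//.
  by rewrite -(ext0_ind R N).
apply: integral_ae0; last exact: ae_tr_null.
by move=> x; exact: tr_ge0.
Qed.

(** The inequality is asked only a.e. because it is to be satisfied by Borel minorants of excessive
    functions. *)
Definition ae_supermedian (v : borel E -> \bar R) :=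
  [/\ measurable_fun setT v, forall x, 0 <= v x &
   forall t, (0 < t)%R -> {ae mu, forall x : borel E, tr t (ext0 v) (Some x) <= v x}].

Lemma ext0_ge0 (v : borel E -> \bar R) : (forall x, 0 <= v x) ->
  forall y, 0 <= ext0 v y.
Proof. by move=> v0 [y|] /=. Qed.

Lemma ae_invariant v (K : R) : ae_supermedian v -> (forall x, v x <= K%:E) ->
  forall t, (0 < t)%R ->
  {ae mu, forall x : borel E, tr t (ext0 v) (Some x) = v x}.
Proof.
move=> [mv v0 sv] vK t t0.
have K0 : (0 <= K)%R by have := le_trans (v0 point) (vK point); rewrite lee_fin.
pose g := ext0 v : state -> \bar R.
have mg : measurable_fun setT g by exact: measurable_ext0.
have g0 : forall y, 0 <= g y := ext0_ge0 v0.
have gK y : g y <= K%:E by case: y => [y|] /=; rewrite ?lee_fin.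
have mtg : measurable_fun setT (fun x : borel E => tr t g (Some x)).
  exact: measurable_tr_Some.
have tgK y : tr t g y <= K%:E by exact: tr_le_cst.
have tg0 y : 0 <= tr t g y by exact: tr_ge0.
pose N0 := [set x : borel E | v x < tr t g (Some x)].
have mN0 : measurable N0 by rewrite -[N0]setTI; exact: measurable_lte.
have N00 : mu N0 = 0.
  apply/negligibleP => //; apply: negligibleS (sv t t0) => x /= h.
  by apply/negP; rewrite -ltNge.
have [F FT F_] := sigma_finiteT mu.
(* The cut by [F n] makes the measure finite, so that recurrence applies to the indicator. *)
pose A k n := [set x : borel E | tr t g (Some x) + (k.+1%:R^-1)%:E <= v x] `&` F n.
have mA k n : measurable (A k n).
  apply: measurableI; last by case: (F_ n).
  rewrite -[X in measurable X]setTI; apply: measurable_lee => //.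
  exact: emeasurable_funD.
have A0 k n : mu (A k n) = 0.
  apply: (potential_eq0_null hausE borelE excM irr) => //.
  have Aoo : mu (A k n) < +oo.
    have [mF Foo] := F_ n; apply: le_lt_trans Foo.
    by apply: le_measure; rewrite ?inE//; exact: subIsetr.
  (* Recurrence leaves the values 0 and +oo; [potential_bound], available wherever the null set [N0]
     has potential 0, excludes +oo. *)
  apply: filterS2 (potential_0oo borelE rec (mA k n) Aoo) (ae_potential_null mN0 N00).
  move=> x [//|Uoo] UN.
  have k0 : (0 < k.+1%:R^-1 :> R)%R by rewrite invr_gt0.
  have := potential_bound (measS (mA k n)) (measS mN0) mg g0 gK k0 t0 _ UN.
  rewrite Uoo => h; suff : +oo <= (t * K / k.+1%:R^-1)%:E :> \bar R by []; apply: h.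
  move=> [y|] nN.
    have vy : tr t g (Some y) <= v y.
      by rewrite leNgt; apply/negP => h; apply: nN; exists y.
    have [yA|yA] := pselect ((Some @` A k n) (Some y)); last first.
      by rewrite /ind indicE memNset// mule0 add0e.
    rewrite /ind indicE mem_set// mule1 addeC.
    by case: yA => z [+ _] [<-].
  rewrite (tr_None M hausE borelE g0 (ltW t0) erefl).
  by rewrite /ind indicE memNset ?mule0 ?adde0// => -[].
have : mu.-negligible (N0 `|` \bigcup_k \bigcup_n A k n).
  apply: negligibleU; first exact/negligibleP.
  apply: negligible_bigcup => k; apply: negligible_bigcup => n.
  by apply/negligibleP => //; exact: A0.
apply: negligibleS => x /= /eqP; rewrite neq_lt => /orP[lt|]; last by left.
right; have : 0 < v x - tr t g (Some x).
  by rewrite sube_gt0.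
have vf : v x \is a fin_num.
  by rewrite ge0_fin_numE// (le_lt_trans (vK x))// ltry.
have tf : tr t g (Some x) \is a fin_num.
  by rewrite ge0_fin_numE// (le_lt_trans (tgK _))// ltry.
rewrite -(fineK vf) -(fineK tf) -EFinB lte_fin => h.
near \oo => k; exists k => //.
have [n _ Fx] : (\bigcup_n F n) x by rewrite -FT.
exists n => //; split => //=.
rewrite -(fineK vf) -(fineK tf) -EFinD lee_fin -lerBrDl ltW//.
by near: k; exact: near_infty_natSinv_lt (PosNum h).
Unshelve. all: by end_near. Qed.

End recurrence.

(** * Excessive functions *)

Section rational_enumeration.
Context (R : realType).

Definition nth_rat (n : nat) : R := ratr (odflt 0%R (unpickle n)).

Lemma nth_rat_dense (a b : R) : (a < b)%R ->
  exists n, (a < nth_rat n)%R /\ (nth_rat n < b)%R.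
Proof.
move=> /rat_in_itvoo[q]; rewrite in_itv/= => /andP[aq qb].
by exists (pickle q); rewrite /nth_rat pickleK.
Qed.

Lemma nth_rat_edense (a b : \bar R) : 0 <= a -> a < b ->
  exists n, a < (nth_rat n)%:E /\ (nth_rat n)%:E < b.
Proof.
case: a => [a| |]// a0; last by rewrite ltNge leey.
case: b => [b| |]//; first by rewrite lte_fin => /nth_rat_dense.
move=> _; have [|n [an _]] := @nth_rat_dense a (a + 1); first by rewrite ltrDl.
by exists n; rewrite lte_fin an ltry.
Qed.

End rational_enumeration.

(** * Borel minorants of universally measurable functions *)

Section sandwich.
Context (R : realType) d (T : measurableType d).
Variable mu : {sigma_finite_measure set T -> \bar R}.
Hypothesis Tpoint : exists x : T, True.

(** The hypothesis speaks of probabilities, so mu is restricted to pieces [F n] of finite measure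
    and normalized. Pieces of measure 0 cannot be normalized and receive the empty set; the point of
    [T] only provides the default law of the normalization. *)
Lemma universally_measurable_inner (A : set T) :
  (forall nu : probability T R, completion_measurable nu A) ->
  exists A1, [/\ measurable A1, A1 `<=` A & mu.-negligible (A `\` A1)].
Proof.
move=> cA; have [x0 _] := Tpoint.
have [F FT F_] := sigma_finiteT mu.
have /choice[B BF] n : exists B, [/\ measurable B, B `<=` A &
    mu.-negligible ((A `\` B) `&` F n)].
  have [mF Foo] := F_ n.
  have [F0|F0] := eqVneq (mu (F n)) 0.
    exists set0; split=> //; apply: negligibleS (_ : mu.-negligible (F n)).
      exact: subIsetr.
    exact/negligibleP.
  pose m : {measure set T -> \bar R} := mrestr mu mF.
  have FE : m setT = mu (F n) by rewrite /m /= /mrestr setTI.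
  have [A1 [A2 [mA1 mA2 A1A AA2]]] := cA (mnormalize m (\d_x0)).
  rewrite /= /mnormalize FE (negbTE F0) (lt_eqF Foo)/= => /eqP.
  rewrite mule_eq0 eqe invr_eq0 => /orP[/eqP A0|/eqP]; last first.
    by move=> /eqP; rewrite fine_eq0 ?(negbTE F0)// ge0_fin_numE.
  exists A1; split => //; exists ((A2 `\` A1) `&` F n); split => //.
    by apply: measurableI => //; exact: measurableD.
  by move=> x [[Ax A1x] Fx]; split => //; split => //; exact: AA2.
exists (\bigcup_n B n); split.
- by apply: bigcupT_measurable => n; case: (BF n).
- by move=> x [n _]; case: (BF n) => _ + _; exact.
apply: negligibleS (_ : mu.-negligible (\bigcup_n ((A `\` B n) `&` F n))).
  move=> x [Ax Bx]; have [n _ Fx] : (\bigcup_n F n) x by rewrite -FT.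
  by exists n => //; split => //; split => // Bnx; apply: Bx; exists n.
by apply: negligible_bigcup => n; case: (BF n).
Qed.

(** [v] is the supremum over rationals q of q^+ on a Borel set [A] inside {q < u} that exhausts it
    up to a null set. Where v < u, a rational between them places the point in one of the countably
    many null remainders. *)
Lemma universally_measurable_minorant (u : T -> \bar R) :
  universally_measurable_fun (R := R) u -> (forall x, 0 <= u x) ->
  exists v : T -> \bar R, [/\ measurable_fun setT v, forall x, 0 <= v x,
    forall x, v x <= u x & {ae mu, forall x, v x = u x}].
Proof.
move=> mu_ u0; pose q := @nth_rat R.
have /choice[A AP] n : exists A1, [/\ measurable A1,
    A1 `<=` [set x | (q n)%:E < u x] &
    mu.-negligible ([set x | (q n)%:E < u x] `\` A1)].
  apply: universally_measurable_inner => nu.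
  rewrite (_ : [set x | _] = u @^-1` `](q n)%:E, +oo]%classic).
    exact: mu_ (emeasurable_itv _) nu.
  by apply/seteqP; split => x /=; rewrite in_itv/= leey andbT.
pose f n x := (Num.max (q n) 0 * \1_(A n) x)%:E.
have f0 n x : 0 <= f n x by rewrite lee_fin mulr_ge0// le_max lexx orbT.
pose v x := esups (f ^~ x) 0%N.
have fv n x : f n x <= v x by apply: ereal_sup_ubound; exists n.
have vu x : v x <= u x.
  apply: ge_ereal_sup => _ [n _ <-]; rewrite /f indicE.
  have [xA|xA] := boolP (x \in A n); last by rewrite mulr0.
  rewrite mulr1 EFin_max ge_max u0 andbT ltW//.
  by have [_ + _] := AP n; apply; rewrite -inE.
exists v; split => //.
- apply: measurable_fun_esups => n; apply/measurable_EFinP.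
  by apply: measurable_funM => //; apply: measurable_indic; case: (AP n).
- by move=> x; exact: le_trans (fv 0%N x).
have : mu.-negligible (\bigcup_n ([set x | (q n)%:E < u x] `\` A n)).
  by apply: negligible_bigcup => n; case: (AP n).
apply: negligibleS => x /= /eqP; rewrite eq_le vu/= -ltNge => vux.
have v0 : 0 <= v x by exact: le_trans (fv 0%N x).
have [n [vq qu]] := nth_rat_edense v0 vux; exists n => //; split => // xA.
have := fv n x; rewrite /f indicE mem_set// mulr1 EFin_max ge_max leNgt.
by rewrite vq.
Qed.

End sandwich.

(** * Constancy of supermedian functions and conservativeness *)

Section constancy.
Context (R : realType) (E : ptopologicalType) (d : measure_display)
  (Omega : measurableType d) (M : right_process R E Omega).
Hypothesis hausE : hausdorff_space E.
Hypothesis borelE : borel_generated_by_continuous R E.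
Notation state := (borel (cemetery E)).
Notation pos := (pos M).
Notation tr := (tr M).
Notation potential := (potential M).
Notation ind := (@ind R E).
Variable mu : {sigma_finite_measure set (borel E) -> \bar R}.
Hypothesis excM : excessive_measure M mu.
Hypothesis irr : strictly_irreducible M mu.
Hypothesis rec : recurrent M mu.
Notation ae_supermedian := (ae_supermedian M mu).

Lemma le_ext0 (f g : E -> \bar R) : (forall x, f x <= g x) ->
  forall y, ext0 f y <= ext0 g y.
Proof. by move=> fg [y|] /=. Qed.

Lemma ae_supermedian_min v (a : R) : (0 <= a)%R -> ae_supermedian v ->
  ae_supermedian (fun x => mine (v x) a%:E).
Proof.
move=> a0 [mv v0 sv]; have m0 x : 0 <= mine (v x) a%:E by rewrite le_min v0.
split => //; first exact: measurable_mine.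
move=> t t0; apply: filterS (sv t t0) => x h; rewrite le_min; apply/andP; split.
  apply: le_trans h; apply: le_tr; first exact: ext0_ge0.
  by apply: le_ext0 => y; rewrite ge_min lexx.
apply: tr_le_cst; first exact: ext0_ge0.
by move=> [y|] /=; rewrite ?lee_fin// ge_min lexx orbT.
Qed.

(* The truncations of v at the levels a and a + 1 are both invariant and agree
   on {v <= a}, so that the process does not leave this set. *)
Lemma superlevel_01 v (a : R) : (0 <= a)%R -> ae_supermedian v ->
  mu.-negligible [set x | a%:E < v x] \/ mu.-negligible (~` [set x | a%:E < v x]).
Proof.
move=> a0 sv; have [mv v0 _] := sv; have a10 : (0 <= a + 1)%R by rewrite addr_ge0.
pose B : set (borel E) := [set x | a%:E < v x].
have mB : measurable B by rewrite -[B]setTI; exact: measurable_lte.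
apply: irr; first by exists B, B; split => //; rewrite setDv.
move=> t t0.
pose f b (x : borel E) := mine (v x) b%:E.
have inv b : (0 <= b)%R ->
    {ae mu, forall x : borel E, tr t (ext0 (f b)) (Some x) = f b x}.
  move=> b0; apply: (ae_invariant hausE borelE excM irr rec (K := b)) => //.
    exact: ae_supermedian_min.
  by move=> x; rewrite ge_min lexx orbT.
have f0 b x : (0 <= b)%R -> 0 <= f b x by move=> b0; rewrite le_min v0.
have fb b x : f b x <= b%:E by rewrite ge_min lexx orbT.
have ff x : f a x <= f (a + 1)%R x.
  by rewrite le_min !ge_min lexx /= lee_fin lerDl ler01 orbT.
have ffin b x : (0 <= b)%R -> f b x \is a fin_num.
  by move=> b0; rewrite ge0_fin_numE ?f0// (le_lt_trans (fb _ _))// ltry.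
(* [h] is positive exactly on [B]. At a point with v <= a both truncations equal v, so p_t h = 0
   there by invariance, and the process is a.s. outside [B] at time t. *)
pose h (x : borel E) := f (a + 1)%R x - f a x.
have h0 x : 0 <= h x by rewrite /h sube_ge0 ?ff// ffin.
have mf b : measurable_fun setT (f b) by exact: measurable_mine.
have mh : measurable_fun setT h by exact: emeasurable_funB.
have mp (g : borel E -> \bar R) : measurable_fun setT g ->
    measurable_fun setT (fun w => ext0 g (pos t w)).
  by move=> mg; exact: (measurableT_comp (measurable_ext0 mg) (measurable_pos_at M borelE t)).
have e0 (g : borel E -> \bar R) : (forall x, 0 <= g x) -> forall y, 0 <= ext0 g y.
  exact: ext0_ge0.
apply: filterS2 (inv a a0) (inv (a + 1)%R a10) => x ia ia1 /negP; rewrite -leNgt => va.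
have fx b : (a <= b)%R -> f b x = v x.
  by move=> ab; apply/min_idPl; apply: le_trans va _; rewrite lee_fin.
have trD : tr t (ext0 (f (a + 1)%R)) (Some x) =
    tr t (ext0 (f a)) (Some x) + tr t (ext0 h) (Some x).
  rewrite /tr -ge0_integralD//; last 4 first.
  - by move=> w _; apply: e0 => y; exact: f0.
  - exact: mp.
  - by move=> w _; exact: e0.
  - exact: mp.
  apply: eq_integral => w _; case: (pos t w) => [y|] /=; last by rewrite adde0.
  by rewrite [RHS]addeC; apply/esym/subeK; exact: ffin.
have : tr t (ext0 h) (Some x) = 0.
  have vfin : v x \is a fin_num by rewrite -(fx a)// ffin.
  move: trD vfin; rewrite ia ia1 !fx ?lerDl//.
  case: (v x) => [r| |]//; case: (tr t (ext0 h) (Some x)) => [s| |]//= + _.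
  by move=> [/eqP]; rewrite eq_sym -subr_eq0 (addrC r) addrK => /eqP ->.
move=> /(ge0_integral_eq0_ae (mp _ mh) (fun w => e0 _ h0 _)) aeh.
rewrite (semigroupE M _ _ (ltW t0)); apply: integral_ae0.
  by move=> w; apply: ext0_ge0 => y; rewrite lee_fin.
apply: filterS aeh => w; case: (pos t w) => [y|]//= hy.
rewrite indicE memNset// => /= By; move: hy; rewrite /h => /eqP.
have fay : f a y = a%:E by apply/min_idPr; exact: ltW.
rewrite fay sube_eq ?ffin// ?fin_num_adde_defr// add0e => /eqP.
rewrite /f; case: leP => [_ va'|_ []]; first by move: By; rewrite /B/= va' ltxx.
by apply/eqP; rewrite gt_eqF// ltrDl.
Qed.

(** A nonnegative rational level is, by [superlevel_01], exceeded a.e. or not exceeded a.e.; [c] is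
    the supremum of the levels exceeded a.e., possibly +oo. Adjoining 0 keeps [c] nonnegative. *)
Lemma ae_constant v : ae_supermedian v ->
  exists c : \bar R, 0 <= c /\ {ae mu, forall x, v x = c}.
Proof.
move=> sv; have [mv v0 _] := sv; pose q := @nth_rat R.
pose Q n := mu.-negligible (~` [set x | (q n)%:E < v x]).
pose c : \bar R := ereal_sup ([set 0] `|` [set (q n)%:E | n in Q]).
exists c.
have c0 : 0 <= c by apply: ereal_sup_ubound; left.
split => //.
have aeq n : {ae mu, forall x, (Q n -> (q n)%:E < v x) /\
    (~ Q n -> (0 <= q n)%R -> v x <= (q n)%:E)}.
  have [Qn|nQn] := pselect (Q n).
    by apply: negligibleS (Qn) => x /= h vx; apply: h; split => // /(_ Qn).
  have [qn0|qn0] := leP 0%R (q n); last by apply: aeW => x.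
  have [|//] := superlevel_01 qn0 sv.
  by apply: negligibleS => x /= h; apply/negPn/negP => nv; apply: h; split => // _ _; rewrite leNgt.
move/ae_foralln : aeq; apply: filterS => x xq.
apply/eqP; rewrite eq_le; apply/andP; split; last first.
  apply: ge_ereal_sup => _ [->//|[n Qn <-]].
  by apply: ltW; have [+ _] := xq n; apply.
rewrite leNgt; apply/negP => cv.
have [n [cq qv]] := nth_rat_edense c0 cv.
have q0 : (0 <= q n)%R by rewrite -lee_fin (le_trans c0)// ltW.
have [Qn|Qn] := pselect (Q n).
  by move: cq; rewrite ltNge => /negP; apply; apply: ereal_sup_ubound; right; exists n.
by have [_ /(_ Qn q0)] := xq n; rewrite leNgt qv.
Qed.

Lemma ae_conservative : {ae mu, forall x : borel E, forall n : nat,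
  law M (Some x) (pos n%:R @^-1` (Some @` setT)) = 1}.
Proof.
have s1 : ae_supermedian (cst 1).
  split => // t t0; apply: aeW => x; apply: tr_le_cst; first exact: ext0_ge0.
  by move=> [y|] /=; rewrite lee_fin.
have e1 : ext0 (cst 1 : E -> \bar R) = ind (Some @` setT).
  rewrite -ext0_ind; congr (ext0 _); apply/funext => x.
  by rewrite /cst indicT.
have mST : measurable (Some @` setT : set state) by exact: measurable_image_Some.
have inv := ae_invariant hausE borelE excM irr rec s1 (fun x => lexx _).
have : {ae mu, forall x : borel E, forall n : nat,
    tr n.+1%:R (ext0 (cst 1)) (Some x) = 1}.
  by apply/ae_foralln => n; exact: inv.
apply: filterS => x h n.
have h1 m : law M (Some x) (pos m.+1%:R @^-1` (Some @` setT)) = 1.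
  by rewrite -tr_ind// -e1 h.
(* Invariance covers positive times only; survival at time n, including n = 0, follows from survival
   at n+1. *)
apply/eqP; rewrite eq_le probability_le1/=; last exact: measurable_pos_preimage.
rewrite -(h1 n); apply: le_measure; rewrite ?inE.
- exact: measurable_pos_preimage.
- exact: measurable_pos_preimage.
move=> w /= [y _ yw]; case pn : (pos n%:R w) => [z|]; first by exists z.
by move: yw; rewrite (@pos_None _ _ _ _ M n%:R)// ler_nat.
Qed.

End constancy.

(** * Last exit times *)

Section occupation.
Context (R : realType) (E : ptopologicalType) (d : measure_display)
  (Omega : measurableType d) (M : right_process R E Omega).
Hypothesis hausE : hausdorff_space E.
Hypothesis borelE : borel_generated_by_continuous R E.
Notation TR := (measurableTypeR R).
Notation leb := (@lebesgue_measure R).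
Notation state := (borel (cemetery E)).
Notation pos := (pos M).
Notation paths := (paths M).
Notation tr := (tr M).
Notation potential := (potential M).
Notation ind := (@ind R E).

Definition occupation (A : set state) (s : R) (w : Omega) : \bar R :=
  \int[leb]_(t in `[s, +oo[) ind A (pos t w).

(** Unlike a visit, positive occupation is a path event without any capacity argument, so the Markov
    property applies to it; it implies a visit by [occupied_visit]. *)
Definition occupied (A : set state) (s : R) : set Omega :=
  [set w | 0 < occupation A s w].

Section fixed_set.
Variable A : set state.
Hypothesis mA : measurable A.

Let mi : measurable_fun setT (ind A). Proof. exact: measurable_ind. Qed.
Let i0 : forall y, 0 <= ind A y := @ind_ge0 R E A.

Let mpath : measurable_fun setT (fun p : TR * paths => ind A (pos p.1 p.2)).
Proof. exact: (measurableT_comp mi (@measurable_pos_paths _ _ _ _ M borelE)). Qed.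

Let mpos (w : Omega) : measurable_fun setT (fun t : TR => ind A (pos t w)).
Proof.
have mc : measurable_fun setT (fun t : TR => (t, w) : TR * paths).
  by apply: measurable_fun_pair => //; exact: measurable_cst.
exact: (measurableT_comp mpath mc).
Qed.

Lemma measurable_occupied s : measurable (occupied A s : set paths).
Proof.
have mo : measurable_fun setT (occupation A s : paths -> \bar R).
  by apply: (measurable_integral_in (f := fun t (w : paths) => ind A (pos t w))).
rewrite -[occupied A s]setTI; apply: measurable_lte => //.
Qed.

Lemma shift_occupied s : (0 <= s)%R ->
  shift M s @^-1` (occupied A 0%R) = occupied A s.
Proof.
move=> s0; apply/seteqP; suff Ew w : occupation A 0%R (shift M s w) = occupation A s w.
  by split => w; rewrite /occupied /= Ew.
rewrite /occupation -(integral_shift_in s (D := `[s, +oo[%classic) _ (mpos w))//.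
rewrite (_ : _ @^-1` _ = `[0%R, +oo[%classic); last first.
  by apply/seteqP; split => t /=; rewrite !in_itv/= !andbT lerDl.
apply: eq_integral => t; rewrite inE/= in_itv/= andbT => t0.
by rewrite pos_shift.
Qed.

Lemma le_occupied s t : (s <= t)%R -> occupied A t `<=` occupied A s.
Proof.
move=> st w; rewrite /occupied /= => /lt_le_trans; apply.
apply: ge0_subset_integral => //; first exact: measurable_funTS.
by move=> u /=; rewrite !in_itv/= !andbT; exact: le_trans.
Qed.

Lemma occupied_visit s w : occupied A s w -> exists2 t, (s <= t)%R & A (pos t w).
Proof.
apply: contraPP => /forall2NP nA; rewrite /occupied/= => /lt_eqF/eqP; apply.
apply/esym; apply: integral0_eq => t /=; rewrite in_itv/= andbT => st.
by have [//|] := nA t; rewrite /ind indicE => h; rewrite memNset.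
Qed.

Lemma not_occupied_potential x :
  law M x (occupied A 0%R) = 0 -> potential A x = 0.
Proof.
move=> P0; rewrite (potentialE M borelE)//; apply: integral_ae0.
  by move=> w; apply: integral_ge0.
exists (occupied A 0%R); split => //.
  exact: paths_measurable (measurable_occupied 0%R).
move=> w /= /eqP; rewrite neq_lt => /orP[|//].
by rewrite ltNge integral_ge0.
Qed.

Lemma occupied_None : ~ A None -> law M None (occupied A 0%R) = 0.
Proof.
move=> AN; apply/(measure_negligible (paths_measurable (measurable_occupied 0%R))).
apply: negligibleS (ae_start M hausE borelE None) => w /= + w0.
rewrite /occupied /= ltNge => /negP; apply; rewrite le_eqVlt; apply/orP; left.
apply/eqP; apply: integral0_eq => t; rewrite /= in_itv/= andbT => t0.
by rewrite (pos_None t0 w0) /ind indicE memNset.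
Qed.

(* Under law M x the tail event Lambda is independent of every event of the
   path, in particular of itself. *)
Lemma tail_zero_one (x : state) (c : R) : (0 <= c)%R ->
  (forall n L, filt M n.+1%:R L ->
    law M x (L `&` occupied A n.+1%:R) = c%:E * law M x L) ->
  let Lambda := \bigcap_n occupied A n.+1%:R in
  law M x Lambda = c%:E /\ c = (c * c)%R.
Proof.
move=> c0 ind_n Lambda.
have mO n : measurable (occupied A n.+1%:R : set paths) := measurable_occupied _.
have mOO n : measurable (occupied A n.+1%:R : set Omega) := paths_measurable (mO n).
have mL : measurable (Lambda : set paths) by exact: bigcapT_measurable.
have mLO : measurable (Lambda : set Omega) := paths_measurable mL.
(* [L] belongs to every later member of the filtration, so [ind_n] gives the same value for all
   large n, while the events decrease to [Lambda]. *)
have filtL m L : filt M m.+1%:R L -> law M x (L `&` Lambda) = c%:E * law M x L.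
  move=> FL; have mLL : measurable L by apply: filt_measurable FL.
  have : law M x (L `&` occupied A n.+1%:R) @[n --> \oo] --> law M x (L `&` Lambda).
    rewrite (_ : L `&` Lambda = \bigcap_n (L `&` occupied A n.+1%:R)); last first.
      apply/seteqP; split => [w [Lw h] n _|w h]; first by split => //; exact: h.
      by split; [have [] := h 0%N Logic.I|move=> n _; have [] := h n Logic.I].
    apply: nonincreasing_cvg_mu.
    - by rewrite (le_lt_trans (probability_le1 _ _)) ?ltry//; exact: measurableI.
    - by move=> n; exact: measurableI.
    - by apply: bigcapT_measurable => n; exact: measurableI.
    - move=> n k nk; apply/subsetPset; apply: setIS; apply: le_occupied.
      by rewrite ler_nat.
  move=> cv; apply: (cvg_unique _ cv) => //; apply: cvg_near_cst.
  near=> n; apply: ind_n; apply: filt_le FL => //.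
  by rewrite ler_nat ltnS; near: n; exact: nbhs_infty_ge.
(* Two finite measures on the path events, C -> P(C and Lambda) and C -> c P(C). They agree on
   cylinders, each of which is known by some time m+1, hence on [Lambda] as well. *)
pose m1 := image_measure (mrestr (law M x) mLO) (@measurable_id_paths _ _ _ _ M).
pose m2 : {measure set paths -> \bar R} :=
  mscale (NngNum c0) (image_measure (law M x) (@measurable_id_paths _ _ _ _ M)).
have m12 (C : set paths) : measurable C -> m1 C = m2 C.
  apply: (measure_unique (@cylinders _ _ _ _ M) (fun=> setT)) => //.
  - exact: measurable_paths_cylinders.
  - exact: cylinderI.
  - by move=> _; exact: cylindersT.
  - by rewrite bigcup_const.
  - move=> _ [ts [B [ts0 mB ->]]].
    have [m tsm] : exists m : nat, forall t, t \in ts -> (t <= m.+1%:R)%R.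
      exists (\max_(i < size ts) Num.truncn (nth 0%R ts i))%N => t tts.
      rewrite -(nth_index 0%R tts) (le_trans (ltW (truncnS_gt _)))// ler_nat ltnS.
      have it : (index t ts < size ts)%N by rewrite index_mem.
      exact: (leq_bigmax (Ordinal it)).
    apply: (@filtL m); rewrite (_ : cylinder ts B = \bigcap_i
        (if (i < size ts)%N then pos (nth 0%R ts i) @^-1` B (nth 0%R ts i) else setT)).
      apply: filt_bigcap => // i; case: ifPn => [its|_]; last exact: filtT.
      have its' : nth 0%R ts i \in ts by exact: mem_nth.
      have t0 := allP ts0 _ its'.
      by apply: (filt_le t0 (tsm _ its')); exact: filt_pos.
    apply/seteqP; split => w /=.
      by move=> h i _; case: ifP => // its; apply: h; exact: mem_nth.
    move=> h t tts; have := h (index t ts) Logic.I.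
    by rewrite index_mem tts /= nth_index.
  - move=> _; rewrite /m1 /= /pushforward /mrestr preimage_setT setTI.
    by rewrite (le_lt_trans (probability_le1 _ _)) ?ltry.
have m1E (C : set paths) : m1 C = law M x (C `&` Lambda) by [].
have m2E (C : set paths) : m2 C = c%:E * law M x C by [].
have LT : law M x Lambda = c%:E.
  have := m12 setT measurableT; rewrite m1E m2E setTI.
  by rewrite [X in _ * X]probability_setT mule1.
split => //; have := m12 _ mL; rewrite m1E m2E setIid LT.
by rewrite -EFinM => -[].
Unshelve. all: by end_near. Qed.

End fixed_set.

Variable mu : {sigma_finite_measure set (borel E) -> \bar R}.
Hypothesis excM : excessive_measure M mu.
Hypothesis irr : strictly_irreducible M mu.
Hypothesis rec : recurrent M mu.

(** The probability [v] of positive occupation is supermedian because later occupation implies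
    earlier occupation. Its a.e. value [c] is finite since v <= 1, and nonzero since otherwise the
    potential of [A] would vanish a.e. *)
Lemma ae_tail_occupied (A : set (borel E)) : measurable A -> mu A != 0 ->
  {ae mu, forall x : borel E,
    law M (Some x) (\bigcap_n occupied (Some @` A) n.+1%:R) = 1}.
Proof.
move=> mA A0; set S := Some @` A.
have mS : measurable (S : set state) by exact: measurable_image_Some.
have SN : ~ S None by case.
pose C s := occupied S s.
have mC s : measurable (C s : set paths) := measurable_occupied mS s.
have mCO s : measurable (C s : set Omega) := paths_measurable (mC s).
pose v (x : borel E) : \bar R := law M (Some x) (C 0%R).
have vE : ext0 v = fun y : state => law M y (C 0%R).
  by apply/funext => -[y|] //=; rewrite occupied_None.
have markovC x s L : (0 <= s)%R -> filt M s L ->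
    law M x (L `&` C s) = \int[law M x]_(w in L) ext0 v (pos s w).
  by move=> s0 FL; rewrite vE -(markov hausE borelE)// (shift_occupied mS).
have trv t x : (0 <= t)%R -> tr t (ext0 v) x = law M x (C t).
  by move=> t0; rewrite -[C t]setTI markovC//; exact: filtT.
have sv : ae_supermedian M mu v.
  split => //.
    have ml := measurable_law (mC 0%R).
    exact: (measurableT_comp ml (@measurable_Some E)).
  move=> t t0; apply: aeW => x; rewrite (trv _ _ (ltW t0)).
  by apply: le_measure; rewrite ?inE//; apply: le_occupied => //; exact: ltW.
have v1 x : v x <= 1%:E by exact: probability_le1.
have inv := ae_invariant hausE borelE excM irr rec sv v1.
have [c [c0 vc]] := ae_constant hausE borelE excM irr rec sv.
have [mv v0 _] := sv.
have [c_ [cE c_0 c_n0]] : exists c_ : R, [/\ c = c_%:E, (0 <= c_)%R & c_ != 0%R].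
  have nae : ~ {ae mu, forall x, v x = 0}.
    move=> v_0; move/eqP : A0; apply.
    apply: (potential_eq0_null hausE borelE excM irr) => //.
    by apply: filterS v_0 => x; exact: not_occupied_potential.
  case: c c0 vc => [c| |]//.
    move=> c0 vc; exists c; split => //; apply/eqP => c_0; apply: nae.
    by apply: filterS vc => x ->; rewrite c_0.
  move=> _ vc; exfalso; apply: nae; apply: filterS vc => x vx.
  by have := v1 x; rewrite vx.
pose N := [set x | v x != c].
have mN : measurable N by rewrite -[N]setTI; apply: measurable_neqe.
have N0 : mu N = 0.
  apply/(measure_negligible mN); apply: negligibleS vc => x /= /eqP; exact.
have aeN : {ae mu, forall x : borel E, forall n : nat,
    tr n.+1%:R (ind (Some @` N)) (Some x) = 0}.
  by apply/ae_foralln => n; exact: ae_tr_null.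
have aecons := ae_conservative hausE borelE excM irr rec.
apply: filterS2 aeN aecons => x trN cons.
(* At time n+1 the process is a.s. alive and outside {v != c}, so conditioning at that time replaces
   [v] by the constant [c] on every event of the past. *)
have key n L : filt M n.+1%:R L ->
    law M (Some x) (L `&` C n.+1%:R) = c_%:E * law M (Some x) L.
  move=> FL; have mL : measurable L by apply: filt_measurable FL.
  rewrite markovC//; transitivity (\int[law M (Some x)]_(w in L) c).
    apply: ge0_ae_eq_integral => //.
    - apply: measurable_funTS.
      exact: (measurableT_comp (measurable_ext0 mv) (measurable_pos_at M borelE _)).
    - by move=> w _; exact: ext0_ge0.
    have mSN : measurable (Some @` N : set state) by exact: measurable_image_Some.
    have mST : measurable (Some @` setT : set state) by exact: measurable_image_Some.
    have mpN := measurable_pos_preimage M borelE n.+1%:R mSN.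
    have mpT := measurable_pos_preimage M borelE n.+1%:R mST.
    exists (pos n.+1%:R @^-1` (Some @` N) `|` ~` (pos n.+1%:R @^-1` (Some @` setT))).
    split.
    - by apply: measurableU => //; exact: measurableC.
    - have /negligibleP n1 : law M (Some x) (pos n.+1%:R @^-1` (Some @` N)) = 0.
        by rewrite -tr_ind.
      have /negligibleP n2 : law M (Some x) (~` (pos n.+1%:R @^-1` (Some @` setT))) = 0.
        by rewrite probability_setC// cons subee.
      apply/negligibleP; first by apply: measurableU => //; exact: measurableC.
      by apply: negligibleU; [exact: n1|apply: n2; exact: measurableC].
    - move=> w /= h; have [[y _ yw]|] := pselect ((Some @` setT) (pos n.+1%:R w)); last by right.
      left; exists y => //; apply/eqP => vy; apply: h => _.
      by rewrite -yw /= vy.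
  by rewrite integral_cst// cE.
have [LE cc] := tail_zero_one mS c_0 key.
rewrite LE; congr (_%:E); apply/eqP; rewrite -(inj_eq (mulfI c_n0)) mulr1.
by apply/eqP.
Qed.

Lemma ae_last_exit (A : set (borel E)) : measurable A -> mu A != 0 ->
  {ae mu, forall x : borel E,
    (law M (Some x)).-negligible [set w | last_exit M (Some @` A) w < +oo]}.
Proof.
move=> mA A0; apply: filterS (ae_tail_occupied mA A0) => x P1.
have mS : measurable (Some @` A : set state) by exact: measurable_image_Some.
have mL : measurable (\bigcap_n occupied (Some @` A) n.+1%:R : set paths).
  by apply: bigcapT_measurable => n; exact: measurable_occupied.
exists (~` (\bigcap_n occupied (Some @` A) n.+1%:R)); split.
- by apply: measurableC; exact: paths_measurable mL.
- rewrite [LHS](probability_setC (law M (Some x)) (paths_measurable mL)).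
  by rewrite [X in 1 - X]P1 subee.
move=> w /= loo hL; move: loo; rewrite ltNge => /negP; apply.
have last_ge t : (0 <= t)%R -> (Some @` A) (pos t w) -> t%:E <= last_exit M (Some @` A) w.
  move=> t0 At; apply: ereal_sup_ubound; right; exists t => //; split => //.
  by rewrite -posE.
have : 0 <= last_exit M (Some @` A) w by apply: ereal_sup_ubound; left.
case El : (last_exit M (Some @` A) w) => [l| |]// l0.
have [t lt At] := occupied_visit (hL (Num.truncn l) Logic.I).
have t0 : (0 <= t)%R by rewrite (le_trans _ lt).
have tl : (t <= l)%R by rewrite -lee_fin -El; exact: last_ge.
by exfalso; move: tl; apply/negP; rewrite -ltNge (lt_le_trans _ lt)// truncnS_gt.
Qed.

End occupation.

(** * Hitting times of null sets *)

Section stopping_times.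
Context (R : realType) (E : ptopologicalType) (d : measure_display)
  (Omega : measurableType d) (M : right_process R E Omega).
Hypothesis borelE : borel_generated_by_continuous R E.
Notation TR := (measurableTypeR R).
Notation leb := (@lebesgue_measure R).
Notation state := (borel (cemetery E)).
Notation pos := (pos M).
Notation tr := (tr M).
Notation potential := (potential M).
Notation ind := (@ind R E).
Notation stopping := (stopping_time (filt M)).

Lemma pos_right_continuous t w (V : set (cemetery E)) : (0 <= t)%R ->
  open V -> V (pos t w) ->
  exists2 e : R, (0 < e)%R & forall s, (t <= s)%R -> (s < t + e)%R -> V (pos s w).
Proof.
move=> t0 oV; rewrite posE// => Vt.
have := @position_right_continuous _ _ _ _ M t w t0 V.
have Vn : nbhs (position M t w) V by exact: open_nbhs_nbhs.
move=> /(_ Vn) [e /= e0 eV]; exists e => // s.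
rewrite le_eqVlt => /orP[/eqP <- _|ts se]; first by rewrite posE.
rewrite posE; last by rewrite ltW// (le_lt_trans t0).
apply: eV => //=; rewrite distrC ger0_norm ?subr_ge0 1?ltW//.
by rewrite ltrBlDl.
Qed.

Lemma stopping_sup (S : nat -> Omega -> \bar R) : (forall n, stopping (S n)) ->
  stopping (fun w => ereal_sup (range (fun n => S n w))).
Proof.
move=> sS; split=> [w|t t0].
  by apply: le_trans (_ : S 0%N w <= _); [case: (sS 0%N)|apply: ereal_sup_ubound; exists 0%N].
rewrite (_ : [set w | _] = \bigcap_n [set w | S n w <= t%:E]).
  by apply: filt_bigcap => // n; case: (sS n) => _; exact.
apply/seteqP; split => w /= h.
  by move=> n _ /=; apply: le_trans h; apply: ereal_sup_ubound; exists n.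
by apply: ge_ereal_sup => _ [n _ <-]; exact: h.
Qed.

Definition next_entry (U : set state) (S : Omega -> \bar R) (w : Omega) : \bar R :=
  ereal_inf [set t%:E | t in [set t : R | [/\ (0 <= t)%R, S w <= t%:E & U (pos t w)]]].

Lemma le_next_entry U S w : S w <= next_entry U S w.
Proof. by apply: le_ereal_inf_tmp => _ [t [_ St _] <-]. Qed.

(** Right continuity keeps the path in the open set for a while after a visit, so rational times
    suffice. *)
Lemma next_entry_lt U S w (r : R) : open (U : set (cemetery E)) ->
  next_entry U S w < r%:E <-> exists n : nat, let q := @nth_rat R n in
    [/\ (0 <= q)%R, (q < r)%R, S w <= q%:E & U (pos q w)].
Proof.
move=> oU; split.
  move=> /ereal_inf_lt[_ [t [t0 St Ut] <-]]; rewrite lte_fin => tr_.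
  have [e e0 eU] := pos_right_continuous t0 oU Ut.
  have [|n [tq qm]] := @nth_rat_dense R t (Num.min (t + e) r)%R.
    by rewrite lt_min tr_ ltrDl e0.
  move: qm; rewrite lt_min => /andP[qe qr].
  exists n; split => //; first by rewrite (le_trans t0)// ltW.
    by apply: le_trans St _; rewrite lee_fin ltW.
  by apply: eU => //; exact: ltW.
move=> [n [q0 qr Sq Uq]]; apply: (@le_lt_trans _ _ (nth_rat R n)%:E).
  by apply: ereal_inf_lbound; exists (nth_rat R n).
by rewrite lte_fin.
Qed.

(** Strict inequalities are countable unions over rational times. The event {next entry <= t} then
    belongs to the filtration at every s > t, through the levels t + (s - t)/(n+1), and right
    continuity of the filtration brings it down to t. *)
Lemma stopping_next_entry U S : open (U : set (cemetery E)) -> stopping S ->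
  stopping (next_entry U S).
Proof.
move=> oU [S0 FS]; have mU : measurable (U : set state) by exact: sub_sigma_algebra.
split=> [w|t t0]; first exact: le_trans (S0 w) (le_next_entry _ _ _).
have lt_filt r s : (0 <= s)%R -> (r <= s)%R ->
    filt M s [set w | next_entry U S w < r%:E].
  move=> s0 rs; rewrite (_ : [set w | _] = \bigcup_n
      (if (0 <= nth_rat R n)%R && (nth_rat R n < r)%R
       then [set w | S w <= (nth_rat R n)%:E] `&` pos (nth_rat R n) @^-1` U else set0)).
    apply: filt_bigcup => // n; case: ifPn => [/andP[q0 qr]|_]; last exact: filt0.
    have qs : (nth_rat R n <= s)%R by rewrite (le_trans (ltW qr)).
    apply: filtI => //; first exact: (filt_le q0 qs (FS _ q0)).
    by apply: (filt_le q0 qs); exact: filt_pos.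
  apply/seteqP; split => w /=.
    by move=> /(next_entry_lt _ _ _ oU)[n [q0 qr Sq Uq]]; exists n => //; rewrite q0 qr.
  move=> [n _]; case: ifPn => // /andP[q0 qr] [Sq Uq].
  by apply/(next_entry_lt _ _ _ oU); exists n.
apply: filt_right_continuous => // s /= ts.
have s0 : (0 <= s)%R by rewrite (le_trans t0)// ltW.
rewrite (_ : [set w | _] = \bigcap_n
    [set w | next_entry U S w < (t + (s - t) / n.+1%:R)%:E]).
  apply: filt_bigcap => // n; apply: lt_filt => //.
  rewrite -lerBrDl ler_pdivrMr// ler_peMr ?ler1n//.
  by rewrite subr_ge0 ltW.
apply/seteqP; split => w /= h.
  move=> n _ /=; apply: le_lt_trans h _; rewrite lte_fin ltrDl divr_gt0//.
  by rewrite subr_gt0.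
apply/lee_addgt0Pr => e e0.
have st0 : (0 < s - t)%R by rewrite subr_gt0.
have est0 : (0 < e / (s - t))%R by rewrite divr_gt0.
near \oo => n.
apply: le_trans (ltW (h n Logic.I)) _; rewrite lee_fin lerD2l.
rewrite mulrC -ler_pdivlMr// ltW//.
by near: n; exact: (near_infty_natSinv_lt (PosNum est0)).
Unshelve. all: by end_near. Qed.

Lemma stopping_gt_measurable S (q : R) : stopping S -> (0 <= q)%R ->
  measurable [set w | q%:E < S w].
Proof.
move=> [_ FS] q0; rewrite (_ : [set w | _] = ~` [set w | S w <= q%:E]).
  by apply: measurableC; exact: filt_measurable (FS _ q0).
by apply/seteqP; split => w /=; rewrite ltNge => /negP.
Qed.

Section entry_time.
Variable x : state.
Variables (Z : set E) (U : (set E)^nat).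
Hypothesis oU : forall m, open (U m).
Hypothesis ZU : forall m, Z `<=` U m.
Hypothesis UZ : \bigcap_m closure (U m) `<=` Z.

(** A substitute for lower bounds of the entry time of [Z] by stopping times, with null events
    allowed. The class is stable under countable suprema and under waiting for the next entry into
    any [U m]. *)
Definition unhit_before (S : Omega -> \bar R) := stopping S /\
  (law M x).-negligible [set w | exists t : R,
    [/\ (0 <= t)%R, t%:E < S w & (Some @` Z) (pos t w)]].

Let V m : set state := Some @` U m.

Let oV m : open (V m : set (cemetery E)).
Proof.
change (open (Some @^-1` (Some @` U m) : set E)).
rewrite (_ : _ @^-1` _ = U m)//; apply/seteqP; split => y /=; last by exists y.
by move=> [z Uz [<-]].
Qed.

Lemma unhit_next_entry m S : unhit_before S -> unhit_before (next_entry (V m) S).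
Proof.
move=> [sS nS]; split; first exact: stopping_next_entry.
apply: negligibleS nS => w /= [t [t0 tD Zt]]; exists t; split => //.
rewrite ltNge; apply/negP => St; move: tD; rewrite ltNge => /negP; apply.
apply: ereal_inf_lbound; exists t => //; split => //.
by case: Zt => z Zz <-; exists z => //; exact: ZU.
Qed.

Lemma unhit_sup (S : nat -> Omega -> \bar R) : (forall n, unhit_before (S n)) ->
  unhit_before (fun w => ereal_sup (range (fun n => S n w))).
Proof.
move=> uS; split; first by apply: stopping_sup => n; case: (uS n).
have : (law M x).-negligible (\bigcup_n [set w | exists t : R,
    [/\ (0 <= t)%R, t%:E < S n w & (Some @` Z) (pos t w)]]).
  by apply: negligible_bigcup => n; case: (uS n).
apply: negligibleS => w [t [t0 /ereal_sup_gt[_ [n _ <-]] tS Zt]].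
by exists n => //; exists t.
Qed.

Lemma unhit0 : unhit_before (fun=> 0).
Proof.
split; first split => // t t0.
  by rewrite (_ : [set w | _] = setT); [exact: filtT|apply/seteqP; split].
rewrite (_ : [set w | _] = set0); first exact: negligible_set0.
by apply/seteqP; split => w // [t [t0]]; rewrite lte_fin ltNge t0.
Qed.

(* The essential supremum of the stopping times before which Z is not hit:
   it cannot be increased by waiting for the next entry into any U m. *)
Lemma maximal_unhit : exists2 S, unhit_before S & forall S', unhit_before S' ->
  (forall w, S w <= S' w) -> (law M x).-negligible [set w | S w < S' w].
Proof.
pose q := @nth_rat R.
(* The supremum is taken of the numbers P(q < S), one for each rational q >= 0; countably many
   near-maximizers [T] then suffice, and their supremum [S] attains every [a n]. *)
pose a n := ereal_sup [set law M x [set w | (q n)%:E < S w] | S in unhit_before].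
have aub n S : unhit_before S -> law M x [set w | (q n)%:E < S w] <= a n.
  by move=> uS; apply: ereal_sup_ubound; exists S.
have /choice[T TP] : forall nk : nat * nat, exists T, unhit_before T /\
    ((0 <= q nk.1)%R -> a nk.1 - (nk.2.+1%:R^-1)%:E <= law M x [set w | (q nk.1)%:E < T w]).
  move=> [n k] /=; have [q0|q0] := leP 0%R (q n); last by exists (fun=> 0); split; [exact: unhit0|].
  have a0 : 0 <= a n by apply: le_trans (aub n _ unhit0).
  have afin : a n \is a fin_num.
    rewrite ge0_fin_numE//; apply: (@le_lt_trans _ _ 1); last exact: ltry.
    apply: ge_ereal_sup => _ [S [sS _] <-]; apply: probability_le1.
    exact: stopping_gt_measurable.
  have k0 : (0 < k.+1%:R^-1 :> R)%R by rewrite invr_gt0.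
  have [_ [T uT <-] aT] := ub_ereal_sup_adherent k0 afin.
  by exists T; split => // _; exact: ltW.
pose S w := ereal_sup (range (fun j => T (unpair j) w)).
have uS : unhit_before S by apply: unhit_sup => j; case: (TP (unpair j)).
have TS p w : T p w <= S w.
  by apply: ereal_sup_ubound; exists (pickle p) => //; rewrite unpairK.
exists S => // S' uS' SS'.
have aS n : (0 <= q n)%R -> a n <= law M x [set w | (q n)%:E < S w].
  move=> q0; apply/lee_addgt0Pr => e e0; near \oo => k.
  have [[sT _] /(_ q0)] := TP (n, k); rewrite leeBlDr//= => /le_trans; apply.
  apply: leeD.
    apply: le_measure; rewrite ?inE; try exact: stopping_gt_measurable.
    by case: uS => sS _; exact: stopping_gt_measurable.
    by move=> w /= /lt_le_trans; apply.
  rewrite lee_fin ltW//; near: k.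
  exact: (near_infty_natSinv_lt (PosNum e0)).
(* Where S < S', a rational q lies between them; P(q < S') <= a n <= P(q < S) and the inclusion of
   the events make their difference null. *)
have : (law M x).-negligible (\bigcup_n (if (0 <= q n)%R then
    [set w | (q n)%:E < S' w] `\` [set w | (q n)%:E < S w] else set0)).
  apply: negligible_bigcup => n; case: ifPn => [q0|_]; last exact: negligible_set0.
  have m1 : measurable [set w | (q n)%:E < S w].
    by case: uS => sS _; exact: stopping_gt_measurable.
  have m2 : measurable [set w | (q n)%:E < S' w].
    by case: uS' => sS _; exact: stopping_gt_measurable.
  apply/negligibleP; first exact: measurableD.
  rewrite measureD//; last first.
    by rewrite (le_lt_trans (probability_le1 _ _))// ltry.
  rewrite setIidr; last by move=> w /= /lt_le_trans; apply.
  apply/eqP; rewrite eq_le; apply/andP; split.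
    rewrite sube_le0; exact: le_trans (aub _ _ uS') (aS _ q0).
  rewrite sube_ge0 ?fin_num_measure//.
  by apply: le_measure; rewrite ?inE// => w /= /lt_le_trans; apply.
apply: negligibleS => w /= lt.
have [n [Sq qS']] := nth_rat_edense ((uS.1).1 w) lt.
have q0 : (0 <= q n)%R by rewrite -lee_fin (le_trans ((uS.1).1 w))// ltW.
by exists n => //; rewrite q0; split => //=; apply/negP; rewrite -leNgt ltW.
Unshelve. all: by end_near. Qed.

(** By maximality, a.s. the next entry into each [U m] occurs at [S] itself. On {S < +oo} the path
    thus visits [U m] in every interval [S, S + e[, and right continuity puts X_S in the closure of
    every [U m], hence in [Z]. *)
Lemma entry_time : exists2 S, unhit_before S &
  (law M x).-negligible [set w | S w < +oo /\
    ~ (Some @` Z) (at_time (position M) (S w) w)].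
Proof.
have [S uS maxS] := maximal_unhit; exists S => //.
have : (law M x).-negligible (\bigcup_m [set w | S w < next_entry (V m) S w]).
  apply: negligible_bigcup => m; apply: maxS; first exact: unhit_next_entry.
  by move=> w; exact: le_next_entry.
apply: negligibleS => w /= [Soo nZ]; apply: contrapT => nD; apply: nZ.
have S0 : 0 <= S w by case: uS => -[].
case ES : (S w) Soo S0 => [s| |]// _; rewrite lee_fin => s0.
have sD m : next_entry (V m) S w <= s%:E.
  by rewrite -ES leNgt; apply/negP => h; apply: nD; exists m.
rewrite /= -posE//.
have cl m (W : set (cemetery E)) : open W -> W (pos s w) -> exists2 t, W (pos t w) & V m (pos t w).
  move=> oW Ws; have [e e0 eW] := pos_right_continuous s0 oW Ws.
  have : next_entry (V m) S w < (s + e)%:E.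
    by apply: le_lt_trans (sD m) _; rewrite lte_fin ltrDl.
  move=> /(next_entry_lt _ _ _ (oV m))[n [q0 qr Sq Uq]].
  by exists (nth_rat R n) => //; apply: eW => //; move: Sq; rewrite ES lee_fin.
case Ep : (pos s w) => [y|].
  exists y => //; apply: UZ => m _ W.
  rewrite nbhsE => -[W' [oW' W'y] W'W].
  have oSW : open (Some @` W' : set (cemetery E)).
    change (open (Some @^-1` (Some @` W') : set E)).
    rewrite (_ : _ @^-1` _ = W')//; apply/seteqP; split => z /=; last by exists z.
    by move=> [z' Wz [<-]].
  have [|t [z1 W1 z1t] [z2 U2 z2t]] := cl m _ oSW; first by rewrite Ep; exists y.
  by exists z2; split => //; apply: W'W; move: z2t; rewrite -z1t => -[->].
(* The cemetery is isolated, so a path sitting there at [S] would stay there for a while and could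
   not visit [U 0]. *)
have oN : open ([set None] : set (cemetery E)).
  change (open (Some @^-1` [set None] : set E)).
  by rewrite (_ : _ @^-1` _ = set0)//; [exact: open0|apply/seteqP; split].
by have [|t -> [z _]] := cl 0%N _ oN.
Qed.

End entry_time.

Lemma measurable_stopping S : stopping S -> measurable_fun setT S.
Proof.
move=> sS; apply: (measurability _ (ErealGenOInfty.measurableE R)).
move=> _ [_ [r ->] <-]; rewrite setTI.
rewrite (_ : _ @^-1` _ = [set w | r%:E < S w]); last first.
  by apply/seteqP; split => w /=; rewrite in_itv/= ?andbT ?leey ?andbT.
have [r0|r0] := leP 0%R r; first exact: stopping_gt_measurable.
rewrite (_ : [set w | _] = setT); first exact: measurableT.
apply/seteqP; split => w //= _; apply: lt_le_trans (_ : 0 <= _).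
  by rewrite lte_fin.
by case: sS.
Qed.

Lemma measurable_at_time S : stopping S ->
  measurable_fun setT (fun p : TR * Omega =>
    at_time (position M) (S p.2 + (Num.max p.1 0)%:E) p.2 : state).
Proof.
move=> sS; have mS := measurable_stopping sS; have [S0 _] := sS.
have mSoo : measurable [set p : TR * Omega | S p.2 = +oo].
  have := measurableT_comp mS (@measurable_snd _ _ TR Omega).
  move=> /(_ measurableT _ (emeasurable_set1 +oo)); rewrite setTI.
  by congr measurable.
have mf : measurable_fun setT (fun p : TR * Omega => pos (fine (S p.2) + Num.max p.1 0)%R p.2).
  have mi : measurable_fun setT (fun p : TR * Omega =>
      ((fine (S p.2) + Num.max p.1 0)%R, p.2) : TR * Omega).
    apply: measurable_fun_pair; last exact: measurable_snd.
    apply: measurable_funD.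
      apply: (measurableT_comp (f := fine)); first exact: fine_measurable.
      exact: (measurableT_comp mS measurable_snd).
    by apply: measurable_maxr => //; exact: measurable_fst.
  exact: (measurableT_comp (@measurable_pos _ _ _ _ M borelE) mi).
move=> _ B mB; rewrite setTI.
rewrite (_ : _ @^-1` _ =
  ([set p : TR * Omega | S p.2 = +oo] `&` [set _ | B None]) `|`
  ((fun p : TR * Omega => pos (fine (S p.2) + Num.max p.1 0)%R p.2) @^-1` B
     `\` [set p : TR * Omega | S p.2 = +oo])).
  apply: measurableU.
    apply: measurableI => //; have [BN|BN] := pselect (B None).
      by rewrite (_ : [set _ | _] = setT)//; apply/seteqP; split.
    by rewrite (_ : [set _ | _] = set0)//; apply/seteqP; split.
  by apply: measurableD => //; rewrite -[X in measurable X]setTI; exact: mf.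
have E1 (p : TR * Omega) : at_time (position M) (S p.2 + (Num.max p.1 0)%:E) p.2 =
    if S p.2 is +oo then None else pos (fine (S p.2) + Num.max p.1 0)%R p.2.
  have := S0 p.2; case: (S p.2) => [s| |]//=; rewrite lee_fin => s0.
  by rewrite posE// addr_ge0// le_max lexx orbT.
apply/seteqP; split => p /=; rewrite E1.
  by case: (S p.2) => [s| |] /= Bp; [right|left|right].
by case: (S p.2) => [s| |] /= [[]|[]].
Qed.

(** The expectation of U_A(X_S) is the expected occupation of [A] after [S], at most the total
    U_A(x) = 0. The strong Markov property is used at each fixed delay t, and Tonelli joins the
    delays. *)
Lemma strong_markov_potential (x : state) S (A : set (borel E)) : stopping S ->
  measurable A -> potential (Some @` A) x = 0 ->
  {ae law M x, forall w, potential (Some @` A) (at_time (position M) (S w) w) = 0}.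
Proof.
move=> sS mA U0; have [S0 _] := sS.
have mSA : measurable (Some @` A : set state) by exact: measurable_image_Some.
set SA := Some @` A in mSA U0 *.
have mi : measurable_fun setT (ind SA) by exact: measurable_ind.
have i0 := @ind_ge0 R E SA.
pose Y t w : state := at_time (position M) (S w + (Num.max t 0)%:E) w.
have mY : measurable_fun setT (fun p : TR * Omega => Y p.1 p.2).
  exact: measurable_at_time.
have Y0 w : Y 0%R w = at_time (position M) (S w) w.
  by rewrite /Y maxxx adde0.
have mYt t : measurable_fun setT (Y t).
  have mc : measurable_fun setT (fun w : Omega => (t, w) : TR * Omega).
    by apply: measurable_fun_pair => //; exact: measurable_cst.
  exact: (measurableT_comp mY mc).
have mtr : measurable_fun setT (fun p : TR * Omega => tr p.1 (ind SA) (Y 0%R p.2)).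
  have mp : measurable_fun setT (fun p : TR * Omega => (p.1, Y 0%R p.2) : TR * state).
    apply: measurable_fun_pair; first exact: measurable_fst.
    exact: (measurableT_comp (mYt 0%R) measurable_snd).
  exact: (measurableT_comp (measurable_tr2 M borelE mi i0) mp).
suff : {ae law M x, forall w, potential SA (Y 0%R w) = 0}.
  by apply: filterS => w; rewrite Y0.
apply: ge0_integral_eq0_ae.
- exact: (measurableT_comp (measurable_potential M borelE mSA) (mYt 0%R)).
- by move=> w; apply: integral_ge0 => t _; exact: tr_ge0.
rewrite (@tonelli_in _ _ _ (law M x) `[0%R, +oo[%classic
  (fun t w => tr t (ind SA) (Y 0%R w)))//; last by move=> t w; exact: tr_ge0.
transitivity (\int[leb]_(t in `[0%R, +oo[) \int[law M x]_w ind SA (Y t w)).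
  apply: eq_integral => t; rewrite inE/= in_itv/= andbT => t0.
  have := @strong_markov _ _ _ _ M x S setT t SA sS _ t0 mSA.
  rewrite setTI => sm; transitivity (law M x (Y t @^-1` SA)).
    rewrite (_ : Y t @^-1` SA = [set w | SA (at_time (position M) (S w + t%:E) w)]).
      rewrite sm; last first.
        by split => // u u0; rewrite setTI; case: sS => _; exact.
      apply: eq_integral => w _; rewrite tr_ind// Y0; congr (law M _ _).
      by apply/seteqP; split => w' /=; rewrite posE.
    by apply/seteqP; split => w /=; rewrite /Y max_l.
  rewrite -[RHS]/(\int[law M x]_w (\1_(Y t @^-1` SA) w)%:E).
  rewrite integral_indic ?setIT//.
  by rewrite -[X in measurable X]setTI; exact: mYt.
rewrite -tonelli_in//; last by exact: (measurableT_comp mi mY).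
apply/eqP; rewrite eq_le integral_ge0 ?andbT; last first.
  by move=> w _; exact: integral_ge0.
rewrite -[leRHS]U0 (potentialE M borelE)//; apply: le_integral_nonmeas => w _.
  exact: integral_ge0.
have mpw : measurable_fun setT (fun t : TR => ind SA (pos t w)).
  have mc : measurable_fun setT (fun t : TR => (t, w) : TR * Omega).
    by apply: measurable_fun_pair => //; exact: measurable_cst.
  exact: (measurableT_comp (measurable_ind_pos M borelE mSA) mc).
(* For S = +oo the path after [S] is in the cemetery and contributes 0; for finite [S] a translation
   yields the occupation of [s, +oo[. *)
have := S0 w; case ES : (S w) => [s| |]// s0; last first.
  rewrite integral0_eq; first exact: integral_ge0.
  by move=> t _; rewrite /Y ES /= /ind indicE memNset// => -[].
rewrite lee_fin in s0.
rewrite (_ : \int[leb]_(t in _) ind SA (Y t w) =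
    \int[leb]_(t in (fun t => s + t)%R @^-1` `[s, +oo[%classic) ind SA (pos (s + t)%R w)).
  rewrite (@integral_shift_in _ s `[s, +oo[%classic (fun t => ind SA (pos t w)))//.
  apply: ge0_subset_integral => //; first exact: measurable_funTS.
  by move=> t /=; rewrite !in_itv/= !andbT; exact: le_trans.
rewrite (_ : _ @^-1` _ = `[0%R, +oo[%classic); last first.
  by apply/seteqP; split => t /=; rewrite !in_itv/= !andbT lerDl.
apply: eq_integral => t; rewrite inE/= in_itv/= andbT => t0.
by rewrite /Y ES max_l//= posE// addr_ge0.
Qed.

End stopping_times.

(** * Polarity of finely open sets contained in null sets *)

Section polarity.
Context (R : realType) (E : ptopologicalType) (d : measure_display)
  (Omega : measurableType d) (M : right_process R E Omega).
Hypothesis hausE : hausdorff_space E.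
Hypothesis borelE : borel_generated_by_continuous R E.
Notation TR := (measurableTypeR R).
Notation leb := (@lebesgue_measure R).
Notation state := (borel (cemetery E)).
Notation pos := (pos M).
Notation potential := (potential M).
Notation ind := (@ind R E).

Lemma zero_set_measurable (Z : set E) : zero_set R Z -> measurable (Z : set (borel E)).
Proof.
move=> [g cg ->]; rewrite -[X in measurable X]setCK; apply: measurableC.
apply: sub_sigma_algebra; apply: closed_openC.
rewrite (_ : [set x | g x = 0%R] = g @^-1` [set 0%R])//.
by apply: preimage_closed => //; exact: closed_eq.
Qed.

Let graph (B : set E) : set (TR * Omega) := [set p | (Some @` B) (pos p.1 p.2)].

Lemma measurable_graph (B : set (borel E)) : measurable B -> measurable (graph B).
Proof.
move=> mB; rewrite -[graph B]setTI.
exact: (@measurable_pos _ _ _ _ M borelE measurableT _ (measurable_image_Some mB)).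
Qed.

(* Choquet's theorem, applied to a Souslin scheme that describes B by zero sets
   and at the same time the graph of X in B by rectangles. *)
Lemma hit_zero_set_hull (x : state) (B : set (borel E)) : measurable B ->
  ~ (law M x).-negligible [set w | exists2 t : R, (0 <= t)%R & (Some @` B) (pos t w)] ->
  exists (Z : set E) (U : (set E)^nat),
    [/\ Z `<=` B, forall m, open (U m), forall m, Z `<=` U m,
        \bigcap_m closure (U m) `<=` Z
      & ~ (law M x).-negligible
          [set w | exists2 t : R, (0 <= t)%R & (Some @` Z) (pos t w)]].
Proof.
move=> mB nB; have [G0 [zG0 lcG0 BE]] := borel_souslin_zero_set borelE mB.
have [N nN] : exists N : nat, ~ (law M x).-negligible
    [set w | exists2 t : R, t \in `[0%R, N%:R] & graph B (t, w)].
  apply: contrapT => /forallNP h; apply: nB.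
  have : (law M x).-negligible (\bigcup_(N : nat)
      [set w | exists2 t : R, t \in `[0%R, N%:R] & graph B (t, w)]).
    by apply: negligible_bigcup => N; exact: contrapT (h N).
  apply: negligibleS => w [t t0 Bt]; exists (Num.truncn t).+1 => //; exists t => //.
  by rewrite in_itv/= t0 ltW// truncnS_gt.
have /choice[SR SRP] (Z : set E) : exists SR : nat -> (nat -> nat) -> set (TR * Omega),
    zero_set R Z -> [/\ forall k z, closed_rectangle (SR k z),
      forall k, locally_constant (SR k) &
      graph Z = [set y | exists z, forall k, SR k z y]].
  have [zZ|nz] := pselect (zero_set R Z); last by exists (fun _ _ => set0).
  have [SR SRP] := measurable_souslin (measurable_graph (zero_set_measurable zZ)).
  by exists SR.
(* One branch codes countably many: row 0 is a branch of the scheme [G0] of [B], and row i+1 a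
   branch of the scheme of the graph over the zero set [G0 i (row z 0)]. *)
pose row (z : nat -> nat) (i : nat) : nat -> nat := fun m => z (pickle (i, m)).
pose G k z := SR (G0 (unpair k).1 (row z 0%N)) (unpair k).2 (row z (unpair k).1.+1).
have rG k z : closed_rectangle (G k z).
  by have [+ _ _] := SRP _ (zG0 (unpair k).1 (row z 0%N)); apply.
have agree_row i m z z' :
    agree (\max_(j < m) (pickle (i, nat_of_ord j)).+1)%N z z' -> agree m (row z i) (row z' i).
  by move=> zz' j jm; apply: zz'; exact: (leq_bigmax (Ordinal jm)).
have lcG k : locally_constant (G k).
  move=> z; rewrite /G; set i := (unpair k).1; set j := (unpair k).2.
  have [m1 h1] := lcG0 i (row z 0%N).
  have [_ lcS _] := SRP _ (zG0 i (row z 0%N)).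
  have [m2 h2] := lcS j (row z i.+1).
  exists (maxn (\max_(j < m1) (pickle (0%N, nat_of_ord j)).+1)
               (\max_(j < m2) (pickle (i.+1, nat_of_ord j)).+1))%N => z' zz'.
  rewrite (h1 (row z' 0%N)); last first.
    by apply: agree_row => l lm; apply: zz'; rewrite leq_max lm.
  by apply: h2; apply: agree_row => l lm; apply: zz'; rewrite leq_max lm orbT.
have graph_row z t w : (forall i, graph (G0 i z) (t, w)) ->
    exists2 y, pos t w = Some y & forall i, G0 i z y.
  move=> h; have [y _ yt] := h 0%N; exists y => // i.
  by have [y' Gy' y't] := h i; move: y't; rewrite -yt => -[<-].
have GE z t w : (forall k, G k z (t, w)) -> forall i, graph (G0 i (row z 0%N)) (t, w).
  move=> zG i; have [_ _ ->] := SRP _ (zG0 i (row z 0%N)).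
  exists (row z i.+1) => j; have := zG (pickle (i, j)).
  by rewrite /G unpairK.
have [|n nK] := @capacity R _ _ (law M x) N%:R G rG lcG.
  apply: contra_not nN; apply: negligibleS => w [t tN [y By yt]]; exists t => //.
  move: By; rewrite BE => -[z0 z0G].
  have /choice[zi ziP] i : exists zi, forall k, SR (G0 i z0) k zi (t, w).
    have : graph (G0 i z0) (t, w) by exists y.
    by have [_ _ ->] := SRP _ (zG0 i z0).
  pose z p := if (unpair p).1 is i.+1 then zi i (unpair p).2 else z0 (unpair p).2.
  exists z => k; rewrite /G.
  have -> : row z 0%N = z0 by apply/funext => m; rewrite /row /z unpairK.
  have -> : row z (unpair k).1.+1 = zi (unpair k).1.
    by apply/funext => m; rewrite /row /z unpairK.
  exact: ziP.
(* Only the bounds on row 0 enter [Z]; the other rows merely certify that (t, w) lies in the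
   graphs. *)
pose Z := [set y | exists z, (forall i, (z i <= row n 0%N i)%N) /\ forall k, G0 k z y].
have [U [oU ZU UZ]] := zero_set_hull (row n 0%N) zG0 lcG0.
exists Z, U; split => //; first by move=> y [z [_ zG]]; rewrite BE; exists z.
apply: contra_not nK; apply: negligibleS => w [t tN [z [zn zG]]]; exists t.
  by move: tN; rewrite in_itv/= => /andP[].
have [y yt Gy] := graph_row _ _ _ (GE _ _ _ zG).
by exists y => //; exists (row z 0%N); split => // i; exact: zn.
Qed.

Lemma potential_unhit (A : set (borel E)) (x : state) : measurable A ->
  potential (Some @` A) x = 0 ->
  (law M x).-negligible [set w | exists2 t : R, (0 <= t)%R &
    0 < potential (Some @` A) (pos t w) /\ pos t w <> None].
Proof.
move=> mA U0; have mSA : measurable (Some @` A : set state) by exact: measurable_image_Some.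
pose B := [set y : borel E | 0 < potential (Some @` A) (Some y)].
have mB : measurable B.
  rewrite -[B]setTI; apply: measurable_lte => //.
  exact: (measurableT_comp (measurable_potential M borelE mSA) (@measurable_Some E)).
apply: contrapT => nB.
have [|Z [U [ZB oU ZU UZ]]] := @hit_zero_set_hull x B mB.
  apply: contra_not nB; apply: negligibleS => w [t t0]; case yt : (pos t w) => [y|] [Uy //] _.
  by exists t => //; rewrite yt; exists y.
apply; have [S [sS nS] ZS] := entry_time M x oU ZU UZ.
have U0S := strong_markov_potential borelE sS mA U0.
(* A path that hits [Z] at t either does so before [S], or is outside [Z] at [S], or is at [S] in
   [Z], where the potential is positive. All three events are null. *)
have := negligibleU nS (negligibleU ZS U0S).
apply: negligibleS => w [t t0 Zt].
have [tS|St] := ltP t%:E (S w); first by left; exists t.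
have Soo : S w < +oo by rewrite (le_lt_trans St)// ltry.
right; have [[y Zy yS]|nZ] := pselect ((Some @` Z) (at_time (position M) (S w) w)); last by left.
by right => /= h; have := ZB _ Zy; rewrite /B /= yS h ltxx.
Qed.

(** Started in [B], the path a.s. stays in [B], hence in [A], during some initial interval; its
    occupation time of [A] is a.s. positive, and so is the expectation. *)
Lemma finely_open_potential (B A : set (borel E)) : measurable A -> B `<=` A ->
  finely_open M B -> forall y, B y -> 0 < potential (Some @` A) (Some y).
Proof.
move=> mA BA oB y By; have mSA : measurable (Some @` A : set state) by exact: measurable_image_Some.
have i0 := @ind_ge0 R E (Some @` A).
have mi := measurable_ind_pos M borelE mSA.
rewrite lt_neqAle eq_sym integral_ge0 ?andbT; last by move=> t _; exact: tr_ge0.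
apply/eqP => U0; have [D [_ BD hD]] := oB y By.
have mo : measurable_fun setT
    (fun w : Omega => \int[leb]_(t in `[0%R, +oo[) ind (Some @` A) (pos t w)).
  by apply: (measurable_integral_in (f := fun t w => ind (Some @` A) (pos t w))).
have := U0; rewrite (potentialE M borelE)// => /(ge0_integral_eq0_ae mo).
move=> /(_ (fun w => integral_ge0 _ (fun t _ => i0 _))) ae0.
have : {ae law M (Some y), forall w : Omega, False}.
  apply: filterS3 (ae_start M hausE borelE (Some y)) ae0 hD => w w0 o0 hw.
  have [e e0 eD] : exists2 e : R, (0 < e)%R &
      forall t, (0 < t)%R -> (t < e)%R -> ~ D (position M t w).
    have [|n [n0 nD]] := @nth_rat_edense R 0 (hitting M D w) _ hw => //.
    exists (nth_rat R n); first by rewrite -lte_fin.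
    move=> t t0 tn Dt; move: nD; rewrite ltNge => /negP; apply.
    apply: (@le_trans _ _ t%:E); last by rewrite lee_fin ltW.
    by apply: ereal_inf_lbound; exists t.
  (* [D] need not contain the cemetery, so survival on an initial interval is required
     separately. *)
  have [k k0 kN] : exists2 k : R, (0 < k)%R & forall t, (0 <= t)%R -> (t < k)%R -> pos t w <> None.
    have [|n nN] := @alive_some _ _ _ _ M w; first by rewrite w0.
    exists n.+1%:R^-1%R; first by rewrite invr_gt0.
    by move=> t t0 tn tN; apply: nN; apply: pos_None tN; exact: ltW.
  pose l := Num.min e k; have l0 : (0 < l)%R by rewrite lt_min e0.
  have : \int[leb]_(t in `]0%R, l[) ind (Some @` A) (pos t w) <= 0.
    rewrite -[leRHS]o0; apply: ge0_subset_integral => //.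
      apply: measurable_funTS.
      have mc : measurable_fun setT (fun t : TR => (t, w) : TR * Omega).
        by apply: measurable_fun_pair => //; exact: measurable_cst.
      exact: (measurableT_comp mi mc).
    by move=> t /=; rewrite !in_itv/= andbT => /andP[/ltW].
  rewrite (eq_integral (fun=> 1)).
    rewrite integral_cst//= lebesgue_measure_itv/= lte_fin l0 -EFinB subr0 mul1e.
    by rewrite lee_fin leNgt l0.
  move=> t; rewrite inE/= in_itv/= lt_min => /andP[t0 /andP[te tk]].
  rewrite /ind indicE mem_set//; have := kN t (ltW t0) tk; have := eD t t0 te.
  rewrite posE ?ltW//; case: (position M t w) => [z|]// nD _.
  exists z => //; apply: BA; apply: contrapT => nB; apply: nD; apply: BD.
  by exists z.
move=> [Y [mY Y0 sY]]; have : law M (Some y) setT <= law M (Some y) Y.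
  by apply: le_measure; rewrite ?inE// => w _; exact: sY.
by rewrite [leRHS]Y0 [leLHS]probability_setT lee_fin ler10.
Qed.

Variable mu : {sigma_finite_measure set (borel E) -> \bar R}.
Hypothesis excM : excessive_measure M mu.

Lemma outer_negligible (m : {measure set Omega -> \bar R}) (A : set Omega) :
  m.-negligible A -> (m^*)%mu A = 0.
Proof.
move=> [B [mB B0 AB]]; apply/eqP; rewrite eq_le; apply/andP; split; last exact: mu_ext_ge0.
by rewrite -B0 -(measurable_mu_extE m mB); exact: le_mu_ext.
Qed.

(** [A] itself may be hit. The Borel superset that is not hit is {U_A > 0}: for almost every
    starting point U_A = 0, because [A] is null, and then [potential_unhit] applies. *)
Lemma null_finely_open_polar (B A : set (borel E)) : measurable A -> mu A = 0 ->
  B `<=` A -> finely_open M B -> polar M mu B.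
Proof.
move=> mA A0 BA oB; have mSA : measurable (Some @` A : set state) by exact: measurable_image_Some.
exists [set y : borel E | 0 < potential (Some @` A) (Some y)]; split.
- rewrite -[X in measurable X]setTI; apply: measurable_lte => //.
  exact: (measurableT_comp (measurable_potential M borelE mSA) (@measurable_Some E)).
- by move=> y By; exact: finely_open_potential By.
apply: integral_ae0; first by move=> x; exact: mu_ext_ge0.
apply: filterS (ae_potential_null hausE borelE excM mA A0) => x Ux.
apply: outer_negligible; apply: negligibleS (potential_unhit mA Ux) => w /=.
move=> /ereal_inf_lt[_ [t [t0 [y Uy yt]] _] _]; exists t; first exact: ltW.
by rewrite posE ?ltW// -yt.
Qed.

End polarity.

(** * Passage from Borel minorants and Borel cores to the four assertions *)

Theorem proposition11 (R : realType) (E : ptopologicalType)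
    (mu : {sigma_finite_measure set (borel E) -> \bar R})
    (d : measure_display) (Omega : measurableType d)
    (M : right_process R E Omega) :
  hausdorff_space E ->
  borel_generated_by_continuous R E ->
  excessive_measure M mu ->
  (forall u : E -> \bar R, excessive M u -> nearly_borel_fun M u) ->
  strictly_irreducible M mu ->
  recurrent M mu ->
  [/\ (* (a) *)
      forall (u : E -> \bar R) (K : R), excessive M u ->
        (forall x, u x <= K%:E) ->
        forall t : R, (0 < t)%R ->
        {ae mu, forall x : borel E, semigroup M t u x = u x},
      (* (b) *)
      forall u : E -> \bar R, excessive M u ->
        exists c : \bar R, {ae mu, forall x : borel E, u x = c},
      (* (c) : mu^* is the extension of mu to its completion *)
      (exists G G' : set (borel E),
        [/\ finely_open M G, finely_open M G', G `&` G' = set0,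
            0 < mu^*%mu G & 0 < mu^*%mu G']) ->
        {ae mu, forall x : borel E,
          law M (Some x) [set w | lifetime M w = +oo] = 1}
    & (* (d) : B ranges over the sets measurable for the completion of mu *)
      forall B : set (borel E), completion_measurable mu B ->
        ~ polar M mu B -> finely_open M B ->
        {ae mu, forall x : borel E,
          (law M (Some x))^*%mu
            [set w | last_exit M (Some @` B) w < +oo] = 0}].
Proof.
move=> hausE borelE excM _ irr rec.
have supermedian u : excessive M u -> forall t x, (0 < t)%R -> semigroup M t u x <= u x.
  move=> [_ u0 mono cvu] t x t0; apply: (cvge_to_ge (cvu x)).
  near=> s; apply: mono; near: s; first exact: nbhs_right_gt.
  exact: nbhs_right_le.
have minorant u : excessive M u -> exists v : borel E -> \bar R,
    [/\ ae_supermedian M mu v, forall x, v x <= u x & {ae mu, forall x, v x = u x}].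
  move=> eu; have [um u0 _ _] := eu.
  have pt : exists x : borel E, True by exists point.
  have [v [mv v0 vu vae]] := universally_measurable_minorant mu pt um u0.
  (* A minorant is used because p_t v <= p_t u <= u, and u = v almost everywhere. *)
  exists v; split => //; split => // t t0; apply: filterS vae => x vx.
  rewrite vx; apply: le_trans (supermedian _ eu t x t0).
  by rewrite (semigroupE M _ _ (ltW t0)); apply: le_tr; [exact: ext0_ge0|exact: le_ext0].
split.
- move=> u K eu uK t t0; have [v [sv vu vae]] := minorant u eu.
  have vK x : v x <= K%:E by exact: le_trans (vu x) (uK x).
  apply: filterS2 vae (ae_invariant hausE borelE excM irr rec sv vK t0) => x vx inv.
  (* A squeeze: a.e. v = p_t v <= p_t u <= u = v. *)
  apply/eqP; rewrite eq_le supermedian//= -vx -inv (semigroupE M _ _ (ltW t0)).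
  by have [_ v0 _] := sv; apply: le_tr; [exact: ext0_ge0|exact: le_ext0].
- move=> u eu; have [v [sv vu vae]] := minorant u eu.
  have [c [_ vc]] := ae_constant hausE borelE excM irr rec sv.
  by exists c; apply: filterS2 vae vc => x <-.
- move=> _; apply: filterS (ae_conservative hausE borelE excM irr rec) => x cons.
  have mT n : measurable (pos M n%:R @^-1` (Some @` [set: E])).
    by apply: measurable_pos_preimage => //; exact: measurable_image_Some.
  have -> : [set w | lifetime M w = +oo] = \bigcap_n (pos M n%:R @^-1` (Some @` [set: E])).
    apply/seteqP; split => w /=.
      move=> loo n _ /=; case pn : (pos M n%:R w) => [y|]; first by exists y.
      by move: pn; rewrite posE// => /(position_lifetime M w (ler0n _ _)); rewrite loo.
    move=> h; have := lifetime_ge0 M w.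
    case El : (lifetime M w) => [l| |]// _; have [y _] := h (Num.truncn l).+1 Logic.I.
    rewrite posE//; have [_ ->] := position_lifetime M w (ler0n R (Num.truncn l).+1).
      by [].
    by rewrite El lee_fin ltW// truncnS_gt.
  have mI := bigcapT_measurable mT.
  have C0 : law M (Some x) (~` (\bigcap_n (pos M n%:R @^-1` (Some @` [set: E])))) = 0.
    rewrite setC_bigcap; apply/(measure_negligible _).
      by apply: bigcupT_measurable => n; exact: measurableC.
    apply: negligible_bigcup => n; apply/negligibleP; first exact: measurableC.
    by rewrite [LHS](probability_setC (law M (Some x)) (mT n)) [X in 1 - X]cons subee.
  by rewrite -[X in law _ _ X]setCK probability_setC ?C0 ?sube0//; exact: measurableC.
- move=> B [A1 [A2 [mA1 mA2 A1B BA2 A120]]] nB oB.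
  (* [A1] and [A2] enclose [B] with null difference. If [A1] is null then so is [A2], and [B] would
     be polar; otherwise the last exit from [B] is no earlier than that from [A1]. *)
  have [A10|A1n0] := eqVneq (mu A1) 0.
    exfalso; apply: nB; apply: (null_finely_open_polar hausE borelE excM mA2) oB => //.
    apply/eqP; rewrite -measure_le0 -(setDUK (subset_trans A1B BA2)).
    by rewrite (le_trans (measureU2 _ _ _))//= ?A10 ?A120 ?adde0//; exact: measurableD.
  apply: filterS (ae_last_exit hausE borelE excM irr rec mA1 A1n0) => x neg.
  apply: outer_negligible; apply: negligibleS neg => w /=; apply: le_lt_trans.
  apply: ereal_sup_le => _ [->|[t [t0 [y A1y yt]] <-]]; [by left|right].
  exists t => //; split => //.
  by exists y => //; exact: A1B.
Unshelve. all: by end_near. Qed.
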